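(* Let $(\Omega,\mu)$, $(\Omega',\mu')$ be measure spaces, let $1<p<\infty$, let $S_p\subset L_p(\mu)$ and $R_p\subset L_p(\mu')$ be closed subspaces, let $Q_p=L_p(\mu')/R_p$ and let $q:L_p(\mu')\to Q_p$ be the quotient map. Let $u:S_p\to Q_p$ be a linear map. Fix $C\ge1$. The following are equivalent. (i) There is a regular operator $\tilde u:L_p(\mu)\to L_p(\mu')$ with $\|\tilde u\|_{\rm reg}\le C$ such that $u=q\,\tilde u_{|S_p}$. (ii) For any Banach space $X$, $u_X$ is bounded and $\|u_X:S_p(X)\to Q_p(X)\|\le C$. (iii) For any finite dimensional Banach space $X$, $u_X$ is bounded and $\|u_X:S_p(X)\to Q_p(X)\|\le C$.
   Context: An operator $T:L_p(\mu)\to L_p(\mu')$ is regular if there is a constant $C$ with $\|\sup_k|Tx_k|\|_p\le C\|\sup_k|x_k|\|_p$ for all finite sequences $(x_k)$ in $L_p(\mu)$; $\|T\|_{\rm reg}$ is the smallest such $C$. For a Banach space $X$: $S_p(X)$ (resp. $R_p(X)$) is the closure in $L_p(\mu;X)$ (resp. $L_p(\mu';X)$) of the algebraic tensor product $S_p\otimes X$ (resp. $R_p\otimes X$), and $Q_p(X)=L_p(\mu';X)/R_p(X)$. There are natural linear inclusions with dense range $S_p\otimes X\subset S_p(X)$ and $Q_p\otimes X\subset Q_p(X)$. When $u\otimes id_X:S_p\otimes X\to Q_p\otimes X$ is bounded for the induced norms, its unique bounded extension $S_p(X)\to Q_p(X)$ is denoted by $u_X$, and one says that $u_X$ is bounded.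 *)

(* Defs.v *)
From HB Require Import structures.
From mathcomp Require Import all_boot all_order all_algebra.
From mathcomp Require Import generic_quotient.
From mathcomp Require Import all_classical all_reals all_analysis measurable_realfun.
From mathcomp Require Import complex.

Set Implicit Arguments.
Unset Strict Implicit.
Unset Printing Implicit Defensive.

Import Order.TTheory GRing.Theory Num.Theory.
Import numFieldNormedType.Exports.

Local Open Scope classical_set_scope.
Local Open Scope ring_scope.

Variant scalar_kind := RealScalars | ComplexScalars.

Definition scalars (R : realType) (k : scalar_kind) : numFieldType :=
  if k is RealScalars then R : numFieldType else R[i]%C : numFieldType.

Section scalars.
Context {R : realType} {k : scalar_kind}.
Local Notation K := (scalars R k).

(* The norm of a [normedModType K] takes its values in K: [re] and [ofR] convert
   between nonnegative elements of K and nonnegative elements of R. *)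
Definition re : K -> R :=
  match k return scalars R k -> R with
  | RealScalars => id
  | ComplexScalars => @complex.Re R
  end.

Definition ofR : R -> K :=
  match k return R -> scalars R k with
  | RealScalars => id
  | ComplexScalars => fun x => Complex x 0
  end.

Lemma reD (x y : K) : re (x + y) = re x + re y.
Proof. by rewrite /re; case: k x y => //= -[a b] [c d]. Qed.

Lemma re_le (x y : K) : x <= y -> re x <= re y.
Proof. by rewrite /re; case: k x y => //= -[a b] [c d] /andP[]. Qed.

Lemma re_lt (x y : K) : x < y -> re x < re y.
Proof. by rewrite /re; case: k x y => //= -[a b] [c d] /andP[]. Qed.

Lemma re0 : re 0 = 0.
Proof. by rewrite /re; case: k. Qed.

Lemma ofRK (x : R) : re (ofR x) = x.
Proof. by rewrite /re /ofR; case: k. Qed.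

Lemma reK (x : K) : 0 <= x -> ofR (re x) = x.
Proof.
by rewrite /re /ofR; case: k x => //= -[a b]; rewrite lecE/= => /andP[/eqP ->].
Qed.

Lemma ofRD (x y : R) : ofR (x + y) = ofR x + ofR y.
Proof.
rewrite /ofR; case: k => //=; apply/eqP.
by rewrite eq_complex/= addr0 !eqxx.
Qed.

Lemma ofRM (x y : R) : ofR (x * y) = ofR x * ofR y.
Proof.
rewrite /ofR; case: k => //=; apply/eqP.
by rewrite eq_complex/= !mulr0 mul0r subr0 addr0 !eqxx.
Qed.

Lemma ofR0 : ofR 0 = 0. Proof. by rewrite /ofR; case: k. Qed.

Lemma ofR_le (x y : R) : (ofR x <= ofR y) = (x <= y).
Proof. by rewrite /ofR; case: k => //=; rewrite lecE/= eqxx. Qed.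

Lemma ofR_lt (x y : R) : (ofR x < ofR y) = (x < y).
Proof. by rewrite /ofR; case: k => //=; rewrite ltcE/= eqxx. Qed.

Lemma reM (x y : K) : 0 <= x -> 0 <= y -> re (x * y) = re x * re y.
Proof. by move=> /reK <- /reK <-; rewrite -ofRM !ofRK. Qed.

Definition nrm (X : normedModType K) (x : X) : R := re `|x|.

Section nrm.
Variable X : normedModType K.
Implicit Types x y : X.

Lemma nrm_ge0 x : 0 <= nrm x.
Proof. by rewrite -re0; exact: re_le. Qed.

Lemma nrmK x : ofR (nrm x) = `|x|. Proof. exact: reK. Qed.

Lemma nrmD x y : nrm (x + y) <= nrm x + nrm y.
Proof. by rewrite -reD; apply: re_le; exact: ler_normD. Qed.

Lemma nrmZ (a : K) x : nrm (a *: x) = re `|a| * nrm x.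
Proof. by rewrite /nrm normrZ reM. Qed.

Lemma nrm0 : nrm (0 : X) = 0.
Proof. by rewrite /nrm normr0 re0. Qed.

Lemma nrmN x : nrm (- x) = nrm x.
Proof. by rewrite /nrm normrN. Qed.

Lemma nrm_eq0 x : nrm x = 0 -> x = 0.
Proof. by move=> x0; apply/normr0_eq0; rewrite -nrmK x0 ofR0. Qed.

Lemma nrm_dist x y : `|nrm x - nrm y| <= nrm (x - y).
Proof.
rewrite ler_norml; apply/andP; split.
  rewrite lerNl opprB lerBlDr -(nrmN (x - y)) opprB.
  by rewrite (le_trans _ (nrmD _ _))// subrK.
by rewrite lerBlDr (le_trans _ (nrmD _ _))// subrK.
Qed.

End nrm.
End scalars.

HB.mixin Record isTopClosed (V : topologicalType) (S : V -> bool) := {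
  topclosed_subproof : closed [set x | S x]
}.

#[short(type="closedSubspace")]
HB.structure Definition ClosedSubspace (K : numFieldType) (V : normedModType K) :=
  {S of @GRing.SubmodClosed K V S & isTopClosed V S}.

Section subspace.
Context {R : realType} {k : scalar_kind}.
Local Notation K := (scalars R k).
Context {V : normedModType K}.
Variable W : closedSubspace V.

Record subspace_of := Subspace { subspace_val : V; _ : subspace_val \in W }.

HB.instance Definition _ := [isSub for subspace_val].
HB.instance Definition _ := [Choice of subspace_of by <:].
HB.instance Definition _ := [SubChoice_isSubLmodule of subspace_of by <:].

Let norm (x : subspace_of) : K := `|\val x|.

Let normD (x y : subspace_of) : norm (x + y) <= norm x + norm y.
Proof. exact: ler_normD. Qed.

Let normZ (a : K) (x : subspace_of) : norm (a *: x) = `|a| * norm x.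
Proof. exact: normrZ. Qed.

Let norm_eq0 (x : subspace_of) : norm x = 0 -> x = 0.
Proof. by move=> /normr0_eq0 x0; apply/val_inj. Qed.

HB.instance Definition _ :=
  @Lmodule_isNormed.Build K subspace_of norm normD normZ norm_eq0.

Lemma subspace_normE (x : subspace_of) : nrm x = nrm (subspace_val x).
Proof. by []. Qed.

End subspace.

Section quotient_module.
Context {K : pzRingType} {V : lmodType K}.
Variable W : submodClosed V.
Local Open Scope quotient_scope.

Let memN x : (- x \in W) = (x \in W).
Proof.
have N y : y \in W -> - y \in W by rewrite -scaleN1r; exact: rpredZ.
by apply/idP/idP => [/N|/N//]; rewrite opprK.
Qed.

Definition qmod_equiv (x y : V) := x - y \in W.

Let qmod_equivP : equiv_class_of qmod_equiv.
Proof.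
split=> [x|x y|y x z]; rewrite /qmod_equiv ?subrr ?rpred0//.
  by rewrite -memN opprB.
by move=> xy yz; rewrite -(subrK y x) -addrA rpredD.
Qed.

Canonical qmod_equiv_rel := EquivRelPack qmod_equivP.
Canonical qmod_encModRel := defaultEncModRel qmod_equiv.

Definition qmod := {eq_quot qmod_equiv}.
HB.instance Definition _ : EqQuotient V qmod_equiv qmod := EqQuotient.on qmod.
HB.instance Definition _ := Choice.on qmod.

Lemma qmodE (x y : V) : (x == y %[mod qmod]) = (x - y \in W).
Proof. by rewrite piE. Qed.

Lemma qmodP (x y : V) : \pi_qmod x = \pi_qmod y <-> x - y \in W.
Proof. by rewrite -qmodE; split => [->|/eqP]. Qed.

Definition qmod_zero : qmod := \pi_qmod 0.
Definition qmod_opp (x : qmod) : qmod := \pi_qmod (- repr x).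
Definition qmod_add (x y : qmod) : qmod := \pi_qmod (repr x + repr y).
Definition qmod_scale (a : K) (x : qmod) : qmod := \pi_qmod (a *: repr x).

Let repr_pi (x : V) : repr (\pi_qmod x) - x \in W.
Proof. by apply/qmodP; rewrite reprK. Qed.

Let qoppE x : qmod_opp (\pi_qmod x) = \pi_qmod (- x).
Proof. by apply/qmodP; rewrite -opprD memN. Qed.

Let qaddE x y : qmod_add (\pi_qmod x) (\pi_qmod y) = \pi_qmod (x + y).
Proof. by apply/qmodP; rewrite opprD addrACA rpredD. Qed.

Let qscaleE a x : qmod_scale a (\pi_qmod x) = \pi_qmod (a *: x).
Proof. by apply/qmodP; rewrite -scalerBr rpredZ. Qed.

Let qaddA : associative qmod_add.
Proof.
move=> x y z; rewrite -[x]reprK -[y]reprK -[z]reprK.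
by rewrite (qaddE (repr y)) (qaddE (repr x) (repr y)) !qaddE addrA.
Qed.

Let qaddC : commutative qmod_add.
Proof. by move=> x y; rewrite -[x]reprK -[y]reprK !qaddE addrC. Qed.

Let qadd0 : left_id qmod_zero qmod_add.
Proof. by move=> x; rewrite -[x]reprK qaddE add0r. Qed.

Let qaddN : left_inverse qmod_zero qmod_opp qmod_add.
Proof. by move=> x; rewrite -[x]reprK (qoppE (repr x)) qaddE addNr. Qed.

HB.instance Definition _ := GRing.isZmodule.Build qmod qaddA qaddC qadd0 qaddN.

Let qscaleA a b x : qmod_scale a (qmod_scale b x) = qmod_scale (a * b) x.
Proof. by rewrite -[x]reprK (qscaleE b) !qscaleE scalerA. Qed.

Let qscale1 : left_id 1 qmod_scale.
Proof. by move=> x; rewrite -[x]reprK qscaleE scale1r. Qed.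

Let qscaleDr : right_distributive qmod_scale +%R.
Proof.
move=> a x y; rewrite -[x]reprK -[y]reprK.
by rewrite {1}/GRing.add /= qaddE !qscaleE scalerDr -qaddE.
Qed.

Let qscaleDl x : {morph qmod_scale^~ x : a b / a + b}.
Proof. by move=> a b; rewrite -[x]reprK /= !qscaleE scalerDl -qaddE. Qed.

HB.instance Definition _ :=
  GRing.Zmodule_isLmodule.Build K qmod qscaleA qscale1 qscaleDr qscaleDl.

Definition qpi (x : V) : qmod := \pi_qmod x.

Let qpi_linear : linear qpi.
Proof. by move=> a x y; rewrite /qpi -qaddE -qscaleE. Qed.

HB.instance Definition _ := GRing.isLinear.Build K V qmod *:%R qpi qpi_linear.

Lemma qpi_repr (x : qmod) : qpi (repr x) = x. Proof. exact: reprK. Qed.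

Lemma qpiP (x y : V) : qpi x = qpi y <-> x - y \in W. Proof. exact: qmodP. Qed.

Lemma repr_qpi (x : V) : repr (qpi x) - x \in W. Proof. exact: repr_pi. Qed.

End quotient_module.

Section quotient_space.
Context {R : realType} {k : scalar_kind}.
Local Notation K := (scalars R k).
Context {V : normedModType K}.
Variable W : closedSubspace V.

Definition quotient_space := qmod W.
HB.instance Definition _ := GRing.Lmodule.on quotient_space.

Definition quotient_map : V -> quotient_space := qpi W.
HB.instance Definition _ := GRing.Linear.on quotient_map.

Let lifts (x : quotient_space) := [set nrm v | v in [set v | quotient_map v = x]].
Let norm (x : quotient_space) : K := ofR (inf (lifts x)).

Let lifts_inf x : has_inf (lifts x).
Proof.
split; first by exists (nrm (repr x)), (repr x) => //; exact: qpi_repr.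
by exists 0 => _ [v _ <-]; exact: nrm_ge0.
Qed.

Let lifts_lb x v : quotient_map v = x -> inf (lifts x) <= nrm v.
Proof. by move=> vx; apply: ge_inf; [exact: (lifts_inf x).2|exists v]. Qed.

Let lifts_eps x e : 0 < e ->
  exists2 v, quotient_map v = x & nrm v < inf (lifts x) + e.
Proof.
by move=> /inf_adherent /(_ (lifts_inf x)) [_ [v vx <-]] ?; exists v.
Qed.

Let lifts_ge0 x : 0 <= inf (lifts x).
Proof. by apply: lb_le_inf; [exact: (lifts_inf x).1|move=> _ [v _ <-]; exact: nrm_ge0]. Qed.

Let normD x y : norm (x + y) <= norm x + norm y.
Proof.
rewrite /norm -ofRD ofR_le; apply/ler_addgt0Pr => e e0.
have [v vx vn] := lifts_eps x (divr_gt0 e0 (ltr0Sn R 1)).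
have [w wy wn] := lifts_eps y (divr_gt0 e0 (ltr0Sn R 1)).
have vw : quotient_map (v + w) = x + y by rewrite linearD -vx -wy.
rewrite (le_trans (lifts_lb vw))// (le_trans (nrmD _ _))//.
by rewrite [leRHS](_ : _ = (inf (lifts x) + e / 2) + (inf (lifts y) + e / 2))
  ?lerD ?ltW// addrACA -splitr.
Qed.

Let normZ_le (a : K) x : norm (a *: x) <= `|a| * norm x.
Proof.
have -> : `|a| = ofR (re `|a|) by rewrite reK.
rewrite /norm -ofRM ofR_le.
have a0 : 0 <= re `|a| by rewrite -(@re0 R k) re_le.
apply/ler_addgt0Pr => e e0.
have a1 : 0 < re `|a| + 1 by rewrite ltr_wpDl.
have [v vx vn] := lifts_eps x (divr_gt0 e0 a1).
have av : quotient_map (a *: v) = a *: x by rewrite linearZ -vx.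
rewrite (le_trans (lifts_lb av))// nrmZ (le_trans (ler_wpM2l a0 (ltW vn)))//.
rewrite mulrDr lerD2l mulrCA ler_piMr ?ltW// ltr_pdivrMr// mul1r ltrDl//.
Qed.

Let norm_ge0 x : 0 <= norm x.
Proof. by rewrite /norm -ofR0 ofR_le. Qed.

Let norm_0 : norm 0 = 0.
Proof.
rewrite /norm (_ : inf _ = 0) ?ofR0//; apply/eqP; rewrite eq_le lifts_ge0 andbT.
by rewrite -[leRHS](@nrm0 _ _ V) lifts_lb// linear0.
Qed.

Let normZ (a : K) x : norm (a *: x) = `|a| * norm x.
Proof.
have [->|a0] := eqVneq a 0; first by rewrite scale0r normr0 mul0r norm_0.
apply/eqP; rewrite eq_le normZ_le/= -ler_pdivlMl ?normr_gt0//.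
by rewrite -normfV (le_trans _ (normZ_le _ _))// scalerA mulVf// scale1r.
Qed.

Let norm_eq0 x : norm x = 0 -> x = 0.
Proof.
move=> /(congr1 re); rewrite ofRK re0 => x0.
suff Wx : repr x \in W.
  by rewrite -[x]qpi_repr -(linear0 (qpi W)); apply/qpiP; rewrite subr0.
have /(_ (repr x)) := @topclosed_subproof _ V W; apply.
move=> B /nbhs_ballP[e /= e0 eB].
have re0' : 0 < re e by rewrite -(@re0 R k) re_lt.
have [v vx] := lifts_eps x re0'; rewrite x0 add0r => ve.
exists (repr x - v); split; first by apply/qpiP; rewrite qpi_repr.
apply: eB; rewrite -ball_normE/= opprB addrC subrK.
by rewrite -nrmK -(reK (ltW e0)) ofR_lt.
Qed.

HB.instance Definition _ :=
  @Lmodule_isNormed.Build K quotient_space norm normD normZ norm_eq0.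

Lemma quotient_normE (x : quotient_space) :
  nrm x = inf [set nrm v | v in [set v | quotient_map v = x]].
Proof. by rewrite /nrm ofRK. Qed.

End quotient_space.

Section strongly_measurable.
Context {d : measure_display} {T : measurableType d}.

Definition simple_fun (Y : Type) (s : T -> Y) :=
  finite_set (range s) /\ forall y, measurable (s @^-1` [set y]).

(* Everywhere (rather than a.e.) limits; every a.e. limit of simple functions is
   a.e. equal to such a function, so the L_p classes are the same. *)
Definition strongly_measurable (Y : topologicalType) (f : T -> Y) :=
  exists s : (T -> Y)^nat,
    (forall n, simple_fun (s n)) /\ (forall t, s n t @[n --> \oo] --> f t).

Lemma simple_fun_preimage (Y : Type) (s : T -> Y) (B : set Y) :
  simple_fun s -> measurable (s @^-1` B).
Proof.
move=> [fs ms].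
rewrite (_ : _ @^-1` _ = \bigcup_(y in range s `&` B) s @^-1` [set y]).
  by apply: fin_bigcup_measurable => //; exact: sub_finite_set fs.
apply/seteqP; split=> [t Bt|t [y [_ By] /= ->//]].
by exists (s t) => //; split => //; exists t.
Qed.

Lemma simple_fun_comp (Y Z : Type) (h : Y -> Z) (s : T -> Y) :
  simple_fun s -> simple_fun (h \o s).
Proof.
move=> ss; split=> [|z].
  by have [fs _] := ss; rewrite -(image_comp s h); exact: finite_image.
by rewrite comp_preimage; exact: simple_fun_preimage.
Qed.

Lemma simple_fun_pair (Y Z : Type) (s : T -> Y) (r : T -> Z) :
  simple_fun s -> simple_fun r -> simple_fun (fun t => (s t, r t)).
Proof.
move=> [fs ms] [fr mr]; split=> [|[y z]].
  apply: sub_finite_set (finite_setX fs fr) => _ [t _ <-].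
  by split; exists t.
rewrite (_ : _ @^-1` _ = s @^-1` [set y] `&` r @^-1` [set z]).
  exact: measurableI.
by apply/seteqP; split=> t /=; [case=> -> ->|case=> -> ->].
Qed.

Lemma strongly_measurable_cst (Y : topologicalType) (y : Y) :
  strongly_measurable (cst y : T -> Y).
Proof.
exists (fun=> cst y); split=> [_|t]; last exact: cvg_cst.
split=> [|z]; first by apply: sub_finite_set (finite_set1 y) => _ [t _ <-].
by rewrite preimage_cst; case: ifP.
Qed.

Lemma strongly_measurable2 (Y Z U : topologicalType) (h : Y * Z -> U)
    (f : T -> Y) (g : T -> Z) : continuous h ->
  strongly_measurable f -> strongly_measurable g ->
  strongly_measurable (fun t => h (f t, g t)).
Proof.
move=> ch [s [ss sf]] [r [rs rg]].
exists (fun n t => h (s n t, r n t)); split=> [n|t].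
  exact: (simple_fun_comp _ (simple_fun_pair (ss n) (rs n))).
apply: (@cvg_comp _ _ _ (fun n => (s n t, r n t)) h _ (nbhs (f t, g t))).
  exact: cvg_pair.
exact: ch.
Qed.

Context {R : realType} {k : scalar_kind}.
Local Notation K := (scalars R k).

Lemma measurable_nrm (X : normedModType K) (f : T -> X) :
  strongly_measurable f -> measurable_fun setT (fun t => nrm (f t)).
Proof.
move=> [s [ss sf]].
apply: (@measurable_fun_cvg _ _ _ setT (fun n t => nrm (s n t))) => [n|t _].
  move=> _ B mB; rewrite setTI.
  by rewrite (_ : _ @^-1` B = s n @^-1` (@nrm R k X @^-1` B))//;
    exact: simple_fun_preimage.
apply/cvgrPdist_lt => e e0.
have e0' : 0 < ofR e :> K by rewrite -(@ofR0 R k) ofR_lt.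
have := sf t => /cvgrPdist_lt /(_ _ e0'); apply: filterS => n /= dn.
by rewrite (le_lt_trans (nrm_dist _ _))// -(@ofR_lt R k) nrmK.
Qed.

End strongly_measurable.

Section Lp.
Context {d : measure_display} {T : measurableType d} {R : realType}.
Variable mu : {measure set T -> \bar R}.
Context {k : scalar_kind} {p : R}.
Variable p1 : 1 < p.
Local Notation K := (scalars R k).
Variable X : normedModType K.
Implicit Types f g : T -> X.

Definition pnorm f : \bar R := Lnorm mu p%:E (fun t => (nrm (f t))%:E).

Let p0 : p != 0. Proof. by rewrite gt_eqF// (lt_trans ltr01). Qed.

Lemma pnorm_ge0 f : (0 <= pnorm f)%E. Proof. exact: Lnorm_ge0. Qed.

Let pint f : (\int[mu]_t `|(nrm (f t))%:E| `^ p = \int[mu]_t ((nrm (f t)) `^ p)%:E)%E.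
Proof. by apply: eq_integral => t _; rewrite gee0_abs ?lee_fin ?nrm_ge0. Qed.

Let mpow f : strongly_measurable f ->
  measurable_fun setT (fun t => (nrm (f t) `^ p)%:E).
Proof.
move=> /measurable_nrm mf; apply/measurable_EFinP.
exact: (@measurableT_comp _ _ _ _ _ _ (@powR R ^~ p)).
Qed.

Lemma ae_eq_pnorm f g : strongly_measurable f -> strongly_measurable g ->
  {ae mu, forall t, f t = g t} -> pnorm f = pnorm g.
Proof.
move=> mf mg fg; rewrite /pnorm unlock !pint; congr (_ `^ _)%E.
apply: ae_eq_integral; [by []|exact: mpow|exact: mpow|].
by apply: filterS fg => t /= -> _.
Qed.

Lemma pnorm_eq0 f : strongly_measurable f -> pnorm f = 0%E ->
  {ae mu, forall t, f t = 0}.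
Proof.
move=> mf; rewrite /pnorm unlock pint => /poweR_eq0_eq0 f0.
have /ae_eq_integral_abs : measurable_fun setT (fun t => (nrm (f t) `^ p)%:E).
  exact: mpow.
move=> /(_ mu measurableT) [+ _]; rewrite (_ : integral _ _ _ = 0%E); last first.
  rewrite -[RHS]f0; first by apply: eq_integral => t _; rewrite gee0_abs ?lee_fin ?powR_ge0.
  by apply: integral_ge0 => t _; rewrite lee_fin powR_ge0.
move=> /(_ erefl); apply: filterS => t /(_ I) [] /powR_eq0_eq0.
exact: nrm_eq0.
Qed.

Lemma pnormD f g : strongly_measurable f -> strongly_measurable g ->
  (pnorm (f + g)%R <= pnorm f + pnorm g)%E.
Proof.
move=> mf mg; have mD : strongly_measurable (f + g).
  exact: (strongly_measurable2 (@add_continuous X) mf mg).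
apply: le_trans (@eminkowski _ _ _ mu (fun t => nrm (f t)) (fun t => nrm (g t))
  p%:E (measurable_nrm mf) (measurable_nrm mg) _); last by rewrite lee_fin ltW.
rewrite /pnorm unlock; apply: gt0_ler_poweR.
- by rewrite invr_ge0 (le_trans ler01)// ltW.
- by rewrite in_itv/= leey integral_ge0// => t _; exact: poweR_ge0.
- by rewrite in_itv/= leey integral_ge0// => t _; exact: poweR_ge0.
apply: ge0_le_integral => //=.
- move: (mpow mD); congr (measurable_fun _ _); apply/funext => t /=.
  by rewrite ger0_norm ?nrm_ge0.
- apply/measurable_EFinP.
  apply: (@measurableT_comp _ _ _ _ _ _ (@powR R ^~ p)) => //.
  apply: measurableT_comp => //; apply: measurable_funD; exact: measurable_nrm.
- move=> t _; rewrite lee_fin; apply: ge0_ler_powR.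
  + by rewrite (le_trans ler01)// ltW.
  + by rewrite nnegrE.
  + by rewrite nnegrE.
  by rewrite !ger0_norm ?addr_ge0 ?nrm_ge0//; exact: nrmD.
Qed.

Lemma pnormZ (a : K) f : strongly_measurable f ->
  pnorm (a *: f) = ((re `|a|)%:E * pnorm f)%E.
Proof.
move=> mf; rewrite /pnorm unlock !pint.
have a0 : 0 <= re `|a| by rewrite -(@re0 R k) re_le.
under eq_integral => t _ do rewrite nrmZ powRM ?nrm_ge0// EFinM.
rewrite ge0_integralZl_EFin ?powR_ge0//; last 2 first.
- by move=> t _; rewrite lee_fin powR_ge0.
- exact: mpow.
rewrite poweRM ?lee_fin ?powR_ge0//; last first.
  by apply: integral_ge0 => t _; rewrite lee_fin powR_ge0.
by rewrite poweR_EFin -powRrM mulfV// powRr1.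
Qed.

(* The unused proof of [1 < p] lets canonical structures be inferred on [LpFun]. *)
Definition LpFun_pred of 1 < p : {pred T -> X} :=
  fun f => `[< strongly_measurable f /\ (pnorm f < +oo)%E >].

Lemma LpFun_predP f :
  (f \in LpFun_pred p1) <-> strongly_measurable f /\ (pnorm f < +oo)%E.
Proof. by split => [/asboolP|?]; last exact/asboolP. Qed.

Lemma pnorm0 : pnorm 0 = 0%E.
Proof.
rewrite /pnorm unlock pint; under eq_integral do rewrite nrm0 powR0//.
by rewrite integral0 poweR0r// invr_neq0.
Qed.

Let LpFun_submod : submod_closed (LpFun_pred p1).
Proof.
split.
  by apply/LpFun_predP; split; [exact: (strongly_measurable_cst 0)|rewrite pnorm0].
move=> a f g /LpFun_predP[mf nf] /LpFun_predP[mg ng]; apply/LpFun_predP.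
have maf : strongly_measurable (a *: f).
  exact: (strongly_measurable2 (@scale_continuous K X) (strongly_measurable_cst a) mf).
split; first exact: (strongly_measurable2 (@add_continuous X) maf mg).
rewrite (le_lt_trans (pnormD maf mg))// lte_add_pinfty// pnormZ//.
by rewrite lte_mul_pinfty// lee_fin -(@re0 R k) re_le.
Qed.

HB.instance Definition _ := GRing.isSubmodClosed.Build K _ (LpFun_pred p1) LpFun_submod.

Record LpFun := MkLpFun { LpFun_val :> T -> X; _ : LpFun_val \in LpFun_pred p1 }.

HB.instance Definition _ := [isSub for LpFun_val].
HB.instance Definition _ := [Choice of LpFun by <:].
HB.instance Definition _ := [SubChoice_isSubLmodule of LpFun by <:].

Lemma LpFun_sm (f : LpFun) : strongly_measurable f.
Proof. by have /LpFun_predP[] := valP f. Qed.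

Lemma LpFun_lty (f : LpFun) : (pnorm f < +oo)%E.
Proof. by have /LpFun_predP[] := valP f. Qed.

Definition Lnull_pred : {pred LpFun} := fun h => `[< {ae mu, forall t, h t = 0} >].

Let Lnull_submod : submod_closed Lnull_pred.
Proof.
split=> [|a f g /asboolP f0 /asboolP g0]; apply/asboolP; first exact: aeW.
by apply: filterS2 f0 g0 => t /= ft gt; rewrite [LHS](_ : _ = a *: f t + g t)// ft gt scaler0 addr0.
Qed.

HB.instance Definition _ := GRing.isSubmodClosed.Build K _ Lnull_pred Lnull_submod.

Definition Lp := qmod Lnull_pred.
HB.instance Definition _ := GRing.Lmodule.on Lp.

Definition Lp_repr (f : Lp) : LpFun := repr f.

Definition Lp_class : LpFun -> Lp := qpi Lnull_pred.
HB.instance Definition _ := GRing.Linear.on Lp_class.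

Lemma Lp_classP (f g : LpFun) :
  Lp_class f = Lp_class g <-> {ae mu, forall t, f t = g t}.
Proof.
split=> [/qpiP/asboolP|fg]; last apply/qpiP/asboolP; last apply: filterS fg.
  by apply: filterS => t /= /eqP; rewrite subr_eq0 => /eqP.
by move=> t ft; rewrite [LHS](_ : _ = f t - g t)// ft subrr.
Qed.

Lemma Lp_reprK (f : Lp) : Lp_class (Lp_repr f) = f. Proof. exact: qpi_repr. Qed.

Lemma Lp_classK (f : LpFun) : {ae mu, forall t, Lp_repr (Lp_class f) t = f t}.
Proof. by apply/Lp_classP; rewrite Lp_reprK. Qed.

Let norm (h : Lp) : K := ofR (fine (pnorm (Lp_repr h))).

Let normE (f : LpFun) : norm (Lp_class f) = ofR (fine (pnorm f)).
Proof.
congr (ofR (fine _)); apply: ae_eq_pnorm; [exact: LpFun_sm|exact: LpFun_sm|].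
exact: Lp_classK.
Qed.

Let pnorm_fin (f : LpFun) : pnorm f \is a fin_num.
Proof. by rewrite ge0_fin_numE ?pnorm_ge0 ?LpFun_lty. Qed.

Let normD (f g : Lp) : norm (f + g) <= norm f + norm g.
Proof.
rewrite -[f]Lp_reprK -[g]Lp_reprK -linearD !normE -ofRD ofR_le.
rewrite -fineD ?pnorm_fin// fine_le ?fin_numD ?pnorm_fin//.
by apply: pnormD; exact: LpFun_sm.
Qed.

Let normZ (a : K) (f : Lp) : norm (a *: f) = `|a| * norm f.
Proof.
rewrite -[f]Lp_reprK -linearZ !normE -[`|a|]reK// -ofRM; congr ofR.
by rewrite pnormZ ?fineM ?pnorm_fin//; exact: LpFun_sm.
Qed.

Let norm_eq0 (f : Lp) : norm f = 0 -> f = 0.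
Proof.
rewrite -[f]Lp_reprK normE => /(congr1 re); rewrite ofRK re0 => f0.
rewrite -(linear0 Lp_class); apply/Lp_classP.
apply: pnorm_eq0; first exact: LpFun_sm.
by rewrite -[LHS]fineK ?pnorm_fin// f0.
Qed.

HB.instance Definition _ :=
  @Lmodule_isNormed.Build K Lp norm normD normZ norm_eq0.

Lemma Lp_normE (f : Lp) : nrm f = fine (pnorm (Lp_repr f)).
Proof. by rewrite /nrm ofRK. Qed.

End Lp.

Section operators.
Context {R : realType} {k : scalar_kind}.
Local Notation K := (scalars R k).
Context {V W : normedModType K}.
Implicit Type U : {linear V -> W}.

Definition op_bound U (c : R) := 0 <= c /\ forall x, nrm (U x) <= c * nrm x.

Definition bounded_op U := exists c, op_bound U c.

Definition opnorm U : R := inf [set c | op_bound U c].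

End operators.

Section regular.
Context {d : measure_display} {T : measurableType d}.
Context {R : realType} {k : scalar_kind} {p : R}.
Local Notation K := (scalars R k).

(* The supremum of finitely many classes is that of any representatives. *)
Definition sup_pnorm (mu : {measure set T -> \bar R}) (p1 : 1 < p) (n : nat)
    (x : 'I_n -> Lp mu p1 K^o) : \bar R :=
  Lnorm mu p%:E (fun t => (\big[Num.max/0]_(i < n) nrm (Lp_repr (x i) t))%:E).

End regular.

Section regular_operator.
Context {d d' : measure_display} {T : measurableType d} {T' : measurableType d'}.
Context {R : realType} {k : scalar_kind} {p : R} {p1 : 1 < p}.
Local Notation K := (scalars R k).
Context {mu : {measure set T -> \bar R}} {mu' : {measure set T' -> \bar R}}.
Variable A : {linear Lp mu p1 K^o -> Lp mu' p1 K^o}.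

Definition reg_bound (c : R) := 0 <= c /\
  forall (n : nat) (x : 'I_n -> Lp mu p1 K^o),
    (sup_pnorm (fun i => A (x i)) <= c%:E * sup_pnorm x)%E.

Definition regular_op := exists c, reg_bound c.

Definition reg_norm : R := inf [set c | reg_bound c].

End regular_operator.

Lemma closure_submod (K : numFieldType) (V : normedModType K) (A : set V) :
  A 0 -> (forall a x y, A x -> A y -> A (a *: x + y)) ->
  submod_closed (fun x => `[< closure A x >]).
Proof.
move=> A0 AD; split=> [|a x y /asboolP Ax /asboolP Ay]; apply/asboolP.
  exact: subset_closure.
have ch : continuous (fun z : V * V => a *: z.1 + z.2).
  move=> z; apply: cvgD; last exact: cvg_snd.
  by apply: cvgZ; [exact: cvg_cst|exact: cvg_fst].
move=> B /(ch (x, y))[[U1 U2] [/= /Ax[v [Av Uv]] /Ay[w [Aw Uw]]]] UB.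
exists (a *: v + w); split; first exact: AD.
exact: (UB (v, w)).
Qed.

Section tensor.
Context {d : measure_display} {T : measurableType d} {R : realType}.
Context {mu : {measure set T -> \bar R}} {k : scalar_kind} {p : R} {p1 : 1 < p}.
Local Notation K := (scalars R k).
Variable X : normedModType K.

Let pnorm_homog (c : R) (f : T -> K^o) (g : T -> X) : 0 <= c ->
  strongly_measurable f -> (forall t, nrm (g t) = nrm (f t) * c) ->
  pnorm mu (p := p) g = (c%:E * pnorm mu (p := p) f)%E.
Proof.
move=> c0 mf gf.
have cE : re `|ofR c : K| = c by rewrite ger0_norm ?ofRK// -(@ofR0 R k) ofR_le.
rewrite -[c in RHS]cE -pnormZ// /pnorm; congr Lnorm; apply/funext => t.
by rewrite nrmZ cE gf mulrC.
Qed.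

Let tens_mem (f : LpFun mu p1 K^o) (x : X) :
  (fun t => (f t : K) *: x) \in LpFun_pred mu p1 (X := X).
Proof.
apply/LpFun_predP; split.
  apply: (strongly_measurable2 (@scale_continuous K X)).
    exact: LpFun_sm.
  exact: strongly_measurable_cst.
rewrite (@pnorm_homog (nrm x) f) ?nrm_ge0//; last 2 first.
- exact: LpFun_sm.
- by move=> t; rewrite nrmZ.
by rewrite lte_mul_pinfty ?lee_fin ?nrm_ge0// ?pnorm_ge0// LpFun_lty.
Qed.

Definition tens_fun (f : LpFun mu p1 K^o) (x : X) : LpFun mu p1 X :=
  MkLpFun (tens_mem f x).

Definition tens (f : Lp mu p1 K^o) (x : X) : Lp mu p1 X :=
  Lp_class (tens_fun (Lp_repr f) x).

Lemma tens_class (f : LpFun mu p1 K^o) (x : X) :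
  tens (Lp_class f) x = Lp_class (tens_fun f x).
Proof.
by apply/Lp_classP; apply: filterS (Lp_classK f) => t /= ->.
Qed.

Lemma tensPl (a : K) (f g : Lp mu p1 K^o) (x : X) :
  tens (a *: f + g) x = a *: tens f x + tens g x.
Proof.
rewrite -[f]Lp_reprK -[g]Lp_reprK -linearP !tens_class -linearP.
congr Lp_class; apply/val_inj/funext => t.
by rewrite [LHS]scalerDl -scalerA.
Qed.

Lemma tensZl (a : K) (f : Lp mu p1 K^o) (x : X) :
  tens (a *: f) x = a *: tens f x.
Proof.
rewrite -[f]Lp_reprK -linearZ !tens_class -linearZ.
congr Lp_class; apply/val_inj/funext => t.
by rewrite [RHS]scalerA.
Qed.

Lemma tensPr (a : K) (f : Lp mu p1 K^o) (x y : X) :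
  tens f (a *: x + y) = a *: tens f x + tens f y.
Proof.
rewrite -[f]Lp_reprK !tens_class -linearP.
congr Lp_class; apply/val_inj/funext => t.
by rewrite [LHS]scalerDr scalerA mulrC -scalerA.
Qed.

Variable S : closedSubspace (Lp mu p1 K^o).

(* The algebraic tensor product of S and X, as a subspace of L_p(mu; X). *)
Definition tensor_span : set (Lp mu p1 X) :=
  [set f | exists n (s : 'I_n -> subspace_of S) (x : 'I_n -> X),
    f = \sum_(i < n) tens (subspace_val (s i)) (x i)].

Definition tensor_closure_pred : {pred Lp mu p1 X} :=
  fun f => `[< closure tensor_span f >].

Let tensor_closure_submod : submod_closed tensor_closure_pred.
Proof.
apply: closure_submod.
  by exists 0%N, (fun=> 0), (fun=> 0); rewrite big_ord0.
move=> a _ _ [n [s [x ->]]] [m [r [y ->]]].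
exists (n + m)%N.
exists (fun i => match fintype.split i with inl j => a *: s j | inr j => r j end).
exists (fun i => match fintype.split i with inl j => x j | inr j => y j end).
rewrite big_split_ord/= scaler_sumr; congr (_ + _); apply: eq_bigr => i _.
  by rewrite (unsplitK (inl i)) /= tensZl.
by rewrite (unsplitK (inr i)).
Qed.

HB.instance Definition _ :=
  GRing.isSubmodClosed.Build K _ tensor_closure_pred tensor_closure_submod.

Let tensor_closure_closed : closed [set f | tensor_closure_pred f].
Proof.
rewrite (_ : [set _ | _] = closure tensor_span); first exact: closed_closure.
by apply/seteqP; split=> f /= /asboolP.
Qed.

HB.instance Definition _ :=
  isTopClosed.Build (Lp mu p1 X) tensor_closure_pred tensor_closure_closed.

Definition tensor_closure : closedSubspace (Lp mu p1 X) := tensor_closure_pred.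

Lemma tens_closure (s : subspace_of S) (x : X) :
  tens (subspace_val s) x \in tensor_closure.
Proof.
apply/asboolP; apply: subset_closure.
by exists 1%N, (fun=> s), (fun=> x); rewrite big_ord1.
Qed.

Definition sub_tens (s : subspace_of S) (x : X) : subspace_of tensor_closure :=
  Subspace (tens_closure s x).

(* The inclusion of the tensor product of L_p / S and X in L_p(X) / S_p(X); by
   [quot_tensE] it does not depend on the representative of f. *)
Definition quot_tens (f : quotient_space S) (x : X) : quotient_space tensor_closure :=
  quotient_map tensor_closure (tens (repr f) x).

Lemma quot_tensE (f : Lp mu p1 K^o) (x : X) :
  quot_tens (quotient_map S f) x = quotient_map tensor_closure (tens f x).
Proof.
apply/qpiP; set g := repr _.
have Sgf : g - f \in S by exact: repr_qpi.
rewrite (_ : _ - _ = tens (g - f) x); first exact: (tens_closure (Subspace Sgf)).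
by rewrite (addrC g) -(scaleN1r f) tensPl scaleN1r addrC.
Qed.

End tensor.

Section tensor_extension.
Context {d d' : measure_display} {T : measurableType d} {T' : measurableType d'}.
Context {R : realType} {k : scalar_kind} {p : R} {p1 : 1 < p}.
Local Notation K := (scalars R k).
Context {mu : {measure set T -> \bar R}} {mu' : {measure set T' -> \bar R}}.
Context {Sp : closedSubspace (Lp mu p1 K^o)} {Rp : closedSubspace (Lp mu' p1 K^o)}.
Variables (u : {linear subspace_of Sp -> quotient_space Rp}) (X : normedModType K).
Implicit Type U : {linear subspace_of (tensor_closure X Sp) ->
                          quotient_space (tensor_closure X Rp)}.

(* Such a U exists iff the tensor product of u and id_X is bounded for the norms
   of S_p(X) and Q_p(X), and it is then unique ([tensor_extension_uniq]). *)
Definition is_tensor_extension U :=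
  bounded_op U /\ forall s x, U (sub_tens s x) = quot_tens (u s) x.

Lemma tensor_extension_uniq U1 U2 :
  is_tensor_extension U1 -> is_tensor_extension U2 -> U1 =1 U2.
Proof.
move=> [[c1 [c10 b1]] e1] [[c2 [c20 b2]] e2] f.
have c0 : 0 < c1 + c2 + 1 by rewrite ltr_wpDl ?addr_ge0.
apply/eqP; rewrite -subr_eq0; apply/eqP/nrm_eq0/eqP.
rewrite eq_le nrm_ge0 andbT; apply/ler_addgt0Pr => e e0; rewrite add0r.
have d0 : 0 < e / (c1 + c2 + 1) by rewrite divr_gt0.
have d0' : 0 < ofR (e / (c1 + c2 + 1)) :> K by rewrite -(@ofR0 R k) ofR_lt.
have /asboolP := valP f.
move=> /(_ _ (nbhsx_ballx _ _ d0'))[_ [[n [s [x ->]]]]].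
rewrite -ball_normE/= -nrmK ofR_lt => fg.
pose g := \sum_(i < n) sub_tens (s i) (x i).
have gE : subspace_val g = \sum_(i < n) tens (subspace_val (s i)) (x i).
  by rewrite [LHS](raddf_sum (val : subspace_of (tensor_closure X Sp) -> _)).
have Ug : U1 g = U2 g.
  by rewrite !linear_sum; apply: eq_bigr => i _; rewrite e1 e2.
have -> : U1 f - U2 f = U1 (f - g) - U2 (f - g).
  by rewrite (linearB U1) (linearB U2) Ug opprB addrA subrK.
rewrite (le_trans (nrmD _ _))// nrmN (le_trans (lerD (b1 _) (b2 _)))//.
have h : nrm (f - g) <= e / (c1 + c2 + 1).
  by rewrite subspace_normE [subspace_val _](_ : _ = subspace_val f - subspace_val g)// gE ltW.
rewrite -mulrDl (le_trans (ler_wpM2l _ h)) ?addr_ge0//.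
by rewrite mulrCA ler_piMr ?ltW// ltr_pdivrMr// mul1r ltrDl.
Qed.

End tensor_extension.

Definition finite_dimensional (K : numFieldType) (X : lmodType K) :=
  exists n (e : 'I_n -> X), forall x, exists c : 'I_n -> K, x = \sum_(i < n) c i *: e i.

(* Main.v *)
Require Import Defs.
From HB Require Import structures.
From mathcomp Require Import all_boot all_order all_algebra.
From mathcomp Require Import all_classical all_reals all_analysis.
From mathcomp Require Import measurable_realfun complex lra ring.

(** The implication from (ii) to (iii) is a specialisation. The others rest on
    the following two arguments.

    From (i) to (ii). A linear combination of tensors of jointly simple functions
    is a sum [sum_l e_l (x) z_l] with indicators [e_l] of disjoint sets. For all
    phases [th_l], the function [sum_l th_l |z_l| e_l] has modulus at most
    [|sum_l e_l z_l|]; on the other side [|sum_l (A e_l) z_l|] is at most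
    [sum_l |z_l| |A e_l|], which is the supremum over the phases of
    [|A (sum_l th_l |z_l| e_l)|]. With finitely many phases this supremum is
    attained up to a factor close to 1, so regularity of [A] bounds the norm of
    the one by [C] times the norm of the other ([disjoint_tensor_bound]). Simple
    functions are dense and [L_p(X)] is complete, so that the tensor product of
    [A] and the identity extends to [S_p(X)] ([bounded_extension]); the quotient
    map then gives [u_X].

    From (iii) to (i). A lifting of [u] is sought through the bilinear form
    [(x, y) |-> <A x, y>] on [L_p(mu)] and [L_q(mu')], with [1/p + 1/q = 1]. Seen
    as a functional on kernels [w(s, t)], this form is prescribed on the tensors
    of [S_p] and the annihilator of [R_p], where it has to be the pairing with
    [u]. Regularity of [A] with constant [C] will follow from a bound of the form by
    [C] times the gauge of [w], the infimum of the masses [m] such that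
    [|w(s, t)| <= a(s) ^ (1/p) b(t) ^ (1/q)] for two densities of integral at most
    [m]. For a tensor [w = sum_j s_j (x) xi_j] in the prescribed domain, this bound
    is statement (iii) for the space [K ^ n] normed by the supremum over [t] of
    [|sum_j v_j xi_j(t)| / b(t) ^ (1/q)] ([dominated_estimate]). The Hahn-Banach
    theorem extends the functional to all kernels of finite gauge, Riesz
    representation recovers an operator [A] ([lifting_operator]), testing on
    kernels made of duality maps of the [A x_i] shows that it is regular
    ([lifting_regular]), and separation from [R_p] shows that it lifts [u]
    ([regular_lifting]).

    Only real functionals are used, the pairing being the integral of the real
    part of the product; this treats both scalar fields together. The duality of
    [L_p] and [L_q] is derived from uniform convexity: a closed subspace has a
    point closest to a given one, and the duality map [J] turns the difference of
    the two into a separating functional ([Lp_separation], [Lp_riesz]). *)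

Set Implicit Arguments.
Unset Strict Implicit.
Unset Printing Implicit Defensive.

Import Order.TTheory GRing.Theory Num.Theory.
Import numFieldNormedType.Exports.

Local Open Scope classical_set_scope.
Local Open Scope ring_scope.

(** * Real parts and moduli of scalars *)

Section scalar_facts.
Context {R : realType} {k : scalar_kind}.
Local Notation K := (scalars R k).
Local Notation nk := (@nrm R k K^o).
Implicit Types z w : K.

Lemma ofR1 : ofR 1 = 1 :> K. Proof. by rewrite /ofR; case: k. Qed.

Lemma ofRN (c : R) : ofR (- c) = - ofR c :> K.
Proof. by apply/eqP; rewrite -subr_eq0 opprK -ofRD addNr ofR0. Qed.

Lemma reN z : re (- z) = - re z.
Proof. by move: z; rewrite /re; case: k => //= -[a b]. Qed.

Lemma reB z w : re (z - w) = re z - re w.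
Proof. by rewrite reD reN. Qed.

Lemma re_ofRM (c : R) z : re (ofR c * z) = c * re z.
Proof.
move: z; rewrite /re /ofR; case: k => //= -[a b].
by rewrite [LHS]/= mul0r subr0.
Qed.

Lemma re_sum (I : Type) (r : seq I) (P : pred I) (F : I -> K) :
  re (\sum_(i <- r | P i) F i) = \sum_(i <- r | P i) re (F i).
Proof. by apply: (big_morph re); [exact: reD|exact: re0]. Qed.

Lemma norm_re_le z : `|re z| <= nk z.
Proof.
move: z; rewrite /nrm /re; case: k => //= z.
by case: z => a b /=; rewrite -[X in X <= _]sqrtr_sqr ler_wsqrtr// lerDl sqr_ge0.
Qed.

Lemma re_le_nk z : re z <= nk z.
Proof. exact: le_trans (ler_norm _) (norm_re_le z). Qed.

Lemma nkM z w : nk (z * w) = nk z * nk w.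
Proof. by rewrite /nrm normrM reM. Qed.

Lemma nk_ofR (c : R) : nk (ofR c) = `|c|.
Proof.
rewrite /nrm /re /ofR; case: k => //=.
by rewrite expr0n/= addr0 sqrtr_sqr.
Qed.

Lemma nk1 : nk 1 = 1. Proof. by rewrite -ofR1 nk_ofR normr1. Qed.

Lemma nkV z : nk z^-1 = (nk z)^-1.
Proof.
have [->|z0] := eqVneq z 0; first by rewrite invr0 !nrm0 invr0.
have nz0 : nk z != 0 by apply: contra_neq z0; exact: nrm_eq0.
by apply: (mulfI nz0); rewrite -nkM !divff// nk1.
Qed.

Lemma ofR_inj : injective (@ofR R k).
Proof. by move=> x y /(congr1 re); rewrite !ofRK. Qed.

Lemma nrm_ofRZ (X : normedModType K) (c : R) (x : X) :
  nrm (ofR c *: x) = `|c| * nrm x.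
Proof. by rewrite nrmZ -[re `|ofR c|]/(nk (ofR c)) nk_ofR. Qed.

Lemma nrm_distC (X : normedModType K) (x y : X) : nrm (x - y) = nrm (y - x).
Proof. by rewrite -nrmN opprB. Qed.

Lemma nrm_sum (X : normedModType K) (I : Type) (r : seq I) (P : pred I) (F : I -> X) :
  nrm (\sum_(i <- r | P i) F i) <= \sum_(i <- r | P i) nrm (F i).
Proof.
elim/big_rec2: _ => [|i y x _ xy]; first by rewrite nrm0.
by rewrite (le_trans (nrmD _ _))// lerD2l.
Qed.

Lemma parallelogram z w :
  nk (z + w) ^+ 2 + nk (z - w) ^+ 2 = 2 * (nk z ^+ 2 + nk w ^+ 2).
Proof.
move: z w; rewrite /nrm /re; case: k => /= [z w|[a b] [c d]].
  rewrite !real_normK ?num_real//; ring.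
by rewrite [LHS]/= !sqr_sqrtr ?addr_ge0 ?sqr_ge0//; ring.
Qed.

End scalar_facts.

(** * The norm topology and sequential completeness *)

Section nrm_topology.
Context {R : realType} {k : scalar_kind}.
Local Notation K := (scalars R k).
Variable X : normedModType K.

Lemma nrm_cvgP (I : Type) (F : set_system I) (FF : Filter F) (f : I -> X) (l : X) :
  f @ F --> l <-> forall e : R, 0 < e -> \forall i \near F, nrm (l - f i) < e.
Proof.
split=> [/cvgrPdist_lt fl e e0|fl].
  have e0' : 0 < ofR e :> K by rewrite -(@ofR0 R k) ofR_lt.
  by apply: filterS (fl _ e0') => i; rewrite -nrmK ofR_lt.
apply/cvgrPdist_lt => e e0.
have e0' : 0 < re e by rewrite -(@re0 R k) re_lt.
apply: filterS (fl _ e0') => i lfi.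
by rewrite -nrmK -(reK (ltW e0)) ofR_lt.
Qed.

Lemma nrm_cvg0P (u : nat -> X) (l : X) :
  (u n @[n --> \oo] --> l) <-> (nrm (u n - l) @[n --> \oo] --> (0 : R)).
Proof.
split=> [/nrm_cvgP h|/cvgrPdist_lt h].
  apply/cvgrPdist_lt => e /h; apply: filterS => n.
  by rewrite sub0r normrN ger0_norm ?nrm_ge0// nrm_distC.
apply/nrm_cvgP => e /h; apply: filterS => n.
by rewrite sub0r normrN ger0_norm ?nrm_ge0// nrm_distC.
Qed.

Lemma closure_nrmP (A : set X) (x : X) :
  closure A x <-> forall e : R, 0 < e -> exists2 y, A y & nrm (x - y) < e.
Proof.
split=> [Ax e e0|h B /nbhs_ballP[e /= e0 eB]].
  have e0' : 0 < ofR e :> K by rewrite -(@ofR0 R k) ofR_lt.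
  have [y [Ay]] := Ax _ (nbhsx_ballx _ _ e0').
  by rewrite -ball_normE/= -nrmK ofR_lt; exists y.
have e0' : 0 < re e by rewrite -(@re0 R k) re_lt.
have [y Ay xy] := h _ e0'; exists y; split=> //; apply: eB.
by rewrite -ball_normE/= -nrmK -(reK (ltW e0)) ofR_lt.
Qed.

(** Sequential completeness is expressed with the real-valued norm: in L_p
    spaces only sequences are available, because measurability and
    integration only pass to countable limits. *)
Definition nrm_cauchy (u : nat -> X) :=
  forall e : R, 0 < e -> exists N, forall n m, (N <= n)%N -> (N <= m)%N ->
    nrm (u n - u m) < e.

Definition seq_complete := forall u : nat -> X, nrm_cauchy u ->
  exists l : X, u n @[n --> \oo] --> l.

Lemma nrm_cauchyP (u : nat -> X) : nrm_cauchy u <-> cauchy (u @ \oo).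
Proof.
split=> [h|/cauchy_ballP h e e0].
  apply/cauchyP => e e0.
  have e0' : 0 < re e by rewrite -(@re0 R k) re_lt.
  have [N hN] := h _ e0'; exists (u N), N => // n /= Nn.
  by rewrite -ball_normE/= -nrmK -(reK (ltW e0)) ofR_lt hN.
have e0' : 0 < ofR e :> K by rewrite -(@ofR0 R k) ofR_lt.
have [[A B] /= [[N1 _ A1] [N2 _ B2]]  AB] := h _ e0'.
exists (maxn N1 N2) => n m; rewrite !geq_max => /andP[n1 _] /andP[_ m2].
have := AB (u n, u m) (conj (A1 n n1) (B2 m m2)).
by rewrite -ball_normE/= -nrmK ofR_lt.
Qed.

Lemma exp2V_gt0 n : 0 < 2 ^- n :> R. Proof. by rewrite invr_gt0 exprn_gt0. Qed.

Lemma exp2V_lt (e : R) : 0 < e -> exists N, forall n, (N <= n)%N -> 2 ^- n < e.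
Proof.
move=> e0; have h2 : `|2^-1 : R| < 1 by rewrite ger0_norm ?invr_ge0// invf_lt1 ?ltr1n.
have /cvgrPdist_lt /(_ e e0) [N _ h] := cvg_geometric (1 : R) h2.
exists N => n /h /=; rewrite sub0r normrN /geometric/= mul1r exprVn.
by rewrite ger0_norm ?invr_ge0 ?exprn_ge0.
Qed.

End nrm_topology.

Section complete.
Context {R : realType} {k : scalar_kind}.
Local Notation K := (scalars R k).

Lemma complete_seq (X : completeNormedModType K) : seq_complete X.
Proof.
move=> u /nrm_cauchyP /cauchy_cvg /cvg_ex[l ul].
by exists l.
Qed.

Lemma real_seq_complete (u : nat -> R) :
  (forall e : R, 0 < e -> exists N, forall n m, (N <= n)%N -> (N <= m)%N ->
    `|u n - u m| < e) -> exists l : R, u n @[n --> \oo] --> l.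
Proof.
move=> h; have /cauchy_cvg /cvg_ex[l ul] : cauchy (u @ \oo).
  apply/cauchyP => e e0.
  have [N hN] := h _ e0; exists (u N), N => // n /= Nn.
  by rewrite -ball_normE/= hN.
by exists l.
Qed.

Lemma scalar_seq_complete : seq_complete (K^o : normedModType K).
Proof.
move: (@norm_re_le R k); rewrite /seq_complete /nrm_cauchy /nrm /re.
case: k => /= hre u cu; first by apply: real_seq_complete => e /cu.
have im_le (z : R[i]) : `|complex.Im z| <= Normc.normc z.
  by case: z => a b /=; rewrite -[X in X <= _]sqrtr_sqr ler_wsqrtr// lerDr sqr_ge0.
have [|x ux] := @real_seq_complete (fun n => complex.Re (u n)).
  move=> e /cu[N hN]; exists N => n m Nn Nm; apply: le_lt_trans (hN n m Nn Nm).
  by rewrite -raddfB; exact: hre.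
have [|y uy] := @real_seq_complete (fun n => complex.Im (u n)).
  move=> e /cu[N hN]; exists N => n m Nn Nm; apply: le_lt_trans (hN n m Nn Nm).
  by rewrite -raddfB; exact: im_le.
exists (Complex x y); apply/(@nrm_cvgP R ComplexScalars) => e e0.
have e20 : 0 < e / 2 by rewrite divr_gt0.
move/cvgrPdist_lt : ux => /(_ _ e20); move/cvgrPdist_lt : uy => /(_ _ e20).
apply: filterS2 => n; rewrite /nrm /re /=.
case: (u n) => a b /= yb xa; rewrite (splitr e).
apply: le_lt_trans (ltrD xa yb).
rewrite -ler_sqr ?nnegrE ?addr_ge0 ?sqrtr_ge0// sqr_sqrtr ?addr_ge0 ?sqr_ge0//.
rewrite -(real_normK (num_real (x - a))) -(real_normK (num_real (y - b))).
by rewrite sqrrD addrAC lerDl mulrn_wge0// mulr_ge0.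
Qed.

(** Completeness for arbitrary Cauchy filters reduces to Cauchy sequences,
    since the norm topology has a countable base. *)
Lemma seq_complete_cauchy_cvg (X : normedModType K) : seq_complete X ->
  forall F : set_system X, ProperFilter F -> cauchy F -> cvg F.
Proof.
move=> cX F FF /cauchyP cF.
have /choice[u hu] n : exists x : X, F (ball x (ofR (2 ^- n))).
  by apply: cF; rewrite -(@ofR0 R k) ofR_lt invr_gt0 exprn_gt0.
have dist n m : nrm (u n - u m) < 2 ^- n + 2 ^- m.
  have [x [un um]] := filter_ex (filterI (hu n) (hu m)).
  rewrite -ball_normE/= -nrmK ofR_lt in un.
  rewrite -ball_normE/= -nrmK ofR_lt nrm_distC in um.
  apply: le_lt_trans (ltrD un um).
  by rewrite (le_trans _ (nrmD _ _))// addrA subrK.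
have [|l ul] := cX u.
  move=> e e0; have [N hN] := @exp2V_lt R _ (divr_gt0 e0 (ltr0Sn R 1)).
  exists N => n m Nn Nm; rewrite (lt_trans (dist _ _))// (splitr e).
  by rewrite ltrD ?hN.
apply/cvg_ex; exists l => B /nbhs_ballP[e /= e0 eB].
have e20 : 0 < re e / 2 by rewrite divr_gt0// -(@re0 R k) re_lt.
have [N hN] := exp2V_lt e20.
move/nrm_cvgP : ul => /(_ _ e20)[M _ hM].
apply: filterS (hu (maxn N M)) => x; rewrite -ball_normE/= -nrmK ofR_lt => ux.
apply: eB; rewrite -ball_normE/= -nrmK -(reK (ltW e0)) ofR_lt (splitr (re e)).
rewrite -(subrK (u (maxn N M)) l) -addrA (le_lt_trans (nrmD _ _))// ltrD//.
  by apply: hM; rewrite /= leq_maxr.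
by rewrite (lt_trans ux)// hN// leq_maxl.
Qed.

(** Rapidly Cauchy sequences suffice: extract a subsequence. *)
Lemma seq_completeP (X : normedModType K) :
  (forall u : nat -> X, (forall n, nrm (u n.+1 - u n) <= 2 ^- n) ->
     exists l : X, u n @[n --> \oo] --> l) ->
  seq_complete X.
Proof.
move=> h u cu.
have /choice[N hN] n := cu _ (@exp2V_gt0 R n).
pose g n := (\sum_(i < n.+1) N i + n)%N.
have gN n : (N n <= g n)%N by rewrite /g big_ord_recr/= addnAC leq_addl.
have gS n : (N n <= g n.+1)%N.
  by rewrite /g big_ord_recr/= big_ord_recr/= -!addnA addnCA leq_addr.
have [n|l ul] := h (u \o g).
  by apply/ltW/hN.
exists l; apply/nrm_cvgP => e e0.
have e20 : 0 < e / 2 by rewrite divr_gt0.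
have [M hM] := exp2V_lt e20.
move/nrm_cvgP : ul => /(_ _ e20)[M' _ hM'].
pose m := maxn M M'.
exists (N m) => // n /= Nn.
rewrite (splitr e) -(subrK (u (g m)) l) -addrA (le_lt_trans (nrmD _ _))// ltrD//.
  by apply: hM'; rewrite /= leq_maxr.
by rewrite (lt_trans (hN m _ _ (gN m) Nn))// hM// leq_maxl.
Qed.

End complete.

Section continuity.
Context {R : realType} {k : scalar_kind}.
Local Notation K := (scalars R k).
Local Notation nk := (@nrm R k K^o).

Lemma nrm_continuous (X : normedModType K) : continuous (@nrm R k X : X -> R).
Proof.
move=> x; apply/cvgrPdist_lt => e e0.
have /nrm_cvgP /(_ _ e0) : id @ x --> x by exact: cvg_id.
by apply: filterS => y; exact/le_lt_trans/nrm_dist.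
Qed.

Lemma re_continuous : continuous (re : K^o -> R).
Proof.
move=> x; apply/(@cvgrPdist_lt _ _ _ (nbhs (x : K^o))) => e e0.
have /(@nrm_cvgP R k K^o _ (nbhs (x : K^o))) /(_ _ e0) : id @ (x : K^o) --> (x : K^o) by exact: cvg_id.
by apply: filterS => y; rewrite -reB; exact/le_lt_trans/norm_re_le.
Qed.

Lemma ofR_continuous : continuous (ofR : R -> K^o).
Proof.
move=> x; apply/(@nrm_cvgP R k K^o) => e e0.
have /cvgrPdist_lt /(_ _ e0) : id @ x --> x by exact: cvg_id.
apply: filterS => y; rewrite (_ : ofR x - ofR y = ofR (x - y)) ?nk_ofR//.
by rewrite ofRD; congr (_ + _); rewrite -mulN1r -[- y]mulN1r ofRM; congr (_ * _);
  apply/eqP; rewrite -subr_eq0 -opprD oppr_eq0 -ofR1 -ofRD subrr ofR0.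
Qed.

End continuity.

(** * The duality map of the scalar field *)

Section duality_map.
Context {R : realType} {k : scalar_kind}.
Local Notation K := (scalars R k).
Local Notation nk := (@nrm R k K^o).
Implicit Types z w : K.

(** The duality map of the scalar field for the gauge [|z| ^ r]: the function
    [J r w] represents the derivative of [|.| ^ r / r] at [w].  Dividing by [z]
    instead of conjugating treats both scalar fields at once. *)
Definition J (r : R) z : K := ofR (nk z `^ r) * z^-1.

Variables (r : R).
Hypothesis r1 : 1 < r.

Let r0 : 0 < r. Proof. exact: lt_trans r1. Qed.
Let rn0 : r != 0. Proof. by rewrite gt_eqF. Qed.

Lemma nk_J z : nk (J r z) = nk z `^ (r - 1).
Proof.
rewrite nkM nk_ofR nkV ger0_norm ?powR_ge0//.
have [z0|z0] := eqVneq (nk z) 0.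
  by rewrite z0 invr0 mulr0 powR0// subr_eq0 gt_eqF.
by rewrite -(@mulr_powRB1 _ (nk z) r) ?nrm_ge0// mulrAC divff// mul1r.
Qed.

Lemma J_mul z : J r z * z = ofR (nk z `^ r).
Proof.
have [->|z0] := eqVneq z 0; first by rewrite mulr0 nrm0 powR0// ofR0.
by rewrite /J -mulrA mulVf// mulr1.
Qed.

Lemma powR_continuous_ge0 (s : R) : 0 < s ->
  forall x : R, 0 <= x -> forall e, 0 < e ->
  exists2 dt, 0 < dt & forall y, 0 <= y -> `|x - y| < dt -> `|x `^ s - y `^ s| < e.
Proof.
move=> s0 x; rewrite le_eqVlt => /predU1P[<- e e0|x0 e e0].
  exists (e `^ s^-1); first exact: powR_gt0.
  move=> y y0; rewrite !sub0r normrN ger0_norm// => ye.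
  rewrite powR0 ?gt_eqF// sub0r normrN ger0_norm ?powR_ge0//.
  have -> : e = (e `^ s^-1) `^ s by rewrite -powRrM mulVf ?gt_eqF// powRr1// ltW.
  by rewrite gt0_ltr_powR// nnegrE ?powR_ge0.
have /derivable1_diffP /differentiable_continuous /cvgrPdist_lt /(_ _ e0) :
    derivable (@powR R ^~ s) x 1.
  by apply: derivable_powR; rewrite in_itv/= x0.
move=> /nbhs_ballP[dt /= dt0 h]; exists dt => // y _ xy.
by apply: h; rewrite -ball_normE.
Qed.

Lemma nk_powR_continuous (s : R) : 0 < s ->
  continuous ((fun z => nk z `^ s) : K^o -> R).
Proof.
move=> s0 x; apply/(@cvgrPdist_lt _ _ _ (nbhs (x : K^o))) => e e0.
have [dt dt0 h] := powR_continuous_ge0 s0 (@nrm_ge0 R k K^o x) e0.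
have := @nrm_continuous R k K^o x.
move=> /(@cvgrPdist_lt _ _ _ (nbhs (x : K^o))) /(_ _ dt0).
by apply: filterS => y; apply: h; exact: nrm_ge0.
Qed.

(** Continuity at 0, where the quotient is not continuous, comes from the
    modulus of [J r z] being [|z| ^ (r - 1)]. *)
Lemma J_continuous : continuous (J r : K^o -> K^o).
Proof.
move=> x; have [->|x0] := eqVneq x 0.
  apply/(@nrm_cvgP R k K^o _ (nbhs (0 : K^o))) => e e0.
  have J0 : J r 0 = 0 by rewrite /J nrm0 powR0// ofR0 mul0r.
  have r10 : 0 < r - 1 by rewrite subr_gt0.
  have := @nk_powR_continuous _ r10 0.
  move=> /(@cvgrPdist_lt _ _ _ (nbhs (0 : K^o))) /(_ _ e0).
  apply: filterS => y /=; rewrite nrm0 powR0 ?gt_eqF//.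
  by rewrite J0 !sub0r normrN nrmN nk_J ger0_norm ?powR_ge0.
apply: (@cvgM K _ (nbhs (x : K^o))); last exact: inv_continuous.
apply: (@continuous_comp K^o R K^o); last exact: ofR_continuous.
exact: nk_powR_continuous.
Qed.

End duality_map.

(** * Real integrals and Hoelder's inequality *)

Section real_integrals.
Context {d : measure_display} {T : measurableType d} {R : realType}.
Variable mu : {measure set T -> \bar R}.
Implicit Types F G : T -> R.
Local Notation intble F := (mu.-integrable setT (EFin \o F)).

Lemma intble_measurable F : intble F -> measurable_fun setT F.
Proof. by move=> /measurable_int /measurable_EFinP. Qed.

Lemma intbleD F G : intble F -> intble G -> intble (fun t => F t + G t).
Proof. by move=> iF iG; apply: eq_integrable (integrableD _ iF iG). Qed.

Lemma intbleZ (c : R) F : intble F -> intble (fun t => c * F t).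
Proof. by move=> iF; apply: eq_integrable (integrableZl _ c iF). Qed.

Lemma intble_le F G : measurable_fun setT F -> (forall t, `|F t| <= G t) ->
  intble G -> intble F.
Proof.
move=> mF FG; apply: le_integrable => //; first exact/measurable_EFinP.
by move=> t _; rewrite /= lee_fin (le_trans (FG t))// ler_norm.
Qed.

Lemma intble0 : intble (fun=> 0).
Proof. exact: integrable0. Qed.

Lemma intble_sum (I : Type) (r : seq I) (F : I -> T -> R) :
  (forall i, intble (F i)) -> intble (fun t => \sum_(i <- r) F i t).
Proof.
move=> h; elim: r => [|i r ih].
  by rewrite (_ : (fun _ => _) = fun=> 0); [exact: intble0|apply/funext => t; rewrite big_nil].
rewrite (_ : (fun _ => _) = fun t => F i t + \sum_(j <- r) F j t); first exact: intbleD.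
by apply/funext => t; rewrite big_cons.
Qed.

Lemma le_Rint F G : intble F -> intble G -> (forall t, F t <= G t) ->
  \int[mu]_t F t <= \int[mu]_t G t.
Proof. by move=> iF iG FG; exact: le_Rintegral. Qed.

Lemma ge0_Rint F : (forall t, 0 <= F t) -> 0 <= \int[mu]_t F t.
Proof. by move=> F0; exact: Rintegral_ge0. Qed.

Lemma RintD F G : intble F -> intble G ->
  \int[mu]_t (F t + G t) = \int[mu]_t F t + \int[mu]_t G t.
Proof. by move=> iF iG; exact: RintegralD. Qed.

Lemma RintZ (c : R) F : intble F -> \int[mu]_t (c * F t) = c * \int[mu]_t F t.
Proof. by move=> iF; exact: RintegralZl. Qed.

Lemma Rint_sum (I : Type) (r : seq I) (F : I -> T -> R) :
  (forall i, intble (F i)) ->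
  \int[mu]_t (\sum_(i <- r) F i t) = \sum_(i <- r) \int[mu]_t F i t.
Proof.
move=> h; elim: r => [|i r ih].
  rewrite big_nil; under eq_Rintegral do rewrite big_nil.
  by rewrite /Rintegral integral0.
rewrite big_cons -ih -RintD//; last exact: intble_sum.
by apply: eq_Rintegral => t _; rewrite big_cons.
Qed.

Lemma EFin_Rint F : intble F -> (\int[mu]_t F t)%:E = (\int[mu]_t (F t)%:E)%E.
Proof.
move=> iF; rewrite /Rintegral fineK//.
by apply: integrable_fin_num => //; exact: measurableT.
Qed.

Lemma ae_eq_Rint F G : measurable_fun setT F -> measurable_fun setT G ->
  {ae mu, forall t, F t = G t} -> \int[mu]_t F t = \int[mu]_t G t.
Proof.
move=> mF mG FG; congr fine; apply: ae_eq_integral => //.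
- exact/measurable_EFinP.
- exact/measurable_EFinP.
- by apply: filterS FG => t /= -> _.
Qed.

Lemma ae_le_Rint F G :
  (forall t, 0 <= F t) -> (forall t, 0 <= G t) ->
  intble F -> intble G ->
  {ae mu, forall t, F t <= G t} -> \int[mu]_t F t <= \int[mu]_t G t.
Proof.
move=> F0 G0 iF iG FG; rewrite -lee_fin !EFin_Rint//.
apply: ae_ge0_le_integral => //.
- by move=> t _; rewrite lee_fin.
- by case/integrableP : iF.
- by move=> t _; rewrite lee_fin.
- by case/integrableP : iG.
- by apply: filterS FG => t h _; rewrite lee_fin.
Qed.

Lemma measurable_powR F (r : R) : measurable_fun setT F ->
  measurable_fun setT (fun t => F t `^ r).
Proof. exact: (@measurableT_comp _ _ _ _ _ _ (@powR R ^~ r)). Qed.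

Lemma dominated_cvg0 (F : nat -> T -> R) G :
  (forall n, measurable_fun setT (F n)) -> (forall n t, `|F n t| <= G t) ->
  intble G -> (forall t, F n t @[n --> \oo] --> (0 : R)) ->
  \int[mu]_t F n t @[n --> \oo] --> (0 : R).
Proof.
move=> mF FG iG F0.
have [|||||_ _ h] := @dominated_convergence _ _ _ mu setT measurableT
  (fun n => EFin \o F n) (cst 0%E) (EFin \o G).
- by move=> n; exact/measurable_EFinP.
- exact: measurable_cst.
- by apply: aeW => t _; apply: cvg_EFin; [exact: nearW|exact: F0].
- exact: iG.
- by apply: aeW => t n _ /=; rewrite lee_fin.
rewrite integral_cst// mul0e in h.
exact: (@fine_cvg _ _ _ _ (fun n => \int[mu]_t (F n t)%:E)%E _ h).
Qed.

(** Only an almost everywhere majorant is produced: the pointwise supremum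
    may be infinite on a null set, so it is not a real function. *)
Lemma monotone_intble (F : nat -> T -> R) (c : R) :
  (forall n, intble (F n)) -> (forall n t, 0 <= F n t) ->
  (forall t, {homo F ^~ t : n m / (n <= m)%N >-> n <= m}) ->
  (forall n, \int[mu]_t F n t <= c) ->
  exists G : T -> R, intble G /\ {ae mu, forall t, forall n, F n t <= G t}.
Proof.
move=> iF F0 ndF Fc.
pose H (t : T) : \bar R := limn (fun n => (F n t)%:E).
have ndE t : {homo (fun n => (F n t)%:E) : n m / (n <= m)%N >-> (n <= m)%E}.
  by move=> n m nm; rewrite lee_fin; exact: ndF.
have cvH t : (F n t)%:E @[n --> \oo] --> H t.
  exact: ereal_nondecreasing_is_cvgn.
have FH t n : ((F n t)%:E <= H t)%E.
  by rewrite /H (cvg_lim _ (ereal_nondecreasing_cvgn (ndE t)))//; apply: ereal_sup_ubound; exists n.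
have mFn n : measurable_fun setT (fun t => (F n t)%:E).
  by apply/measurable_EFinP; exact: intble_measurable.
have H0 t : (0 <= H t)%E by apply: le_trans (FH t 0%N); rewrite lee_fin.
have mH : measurable_fun setT H by apply: (@emeasurable_fun_cvg _ _ _ setT (fun n t => (F n t)%:E) H mFn) => t _; exact: cvH.
have iH : (\int[mu]_t H t <= c%:E)%E.
  have := @cvg_monotone_convergence _ _ _ mu setT measurableT (fun n t => (F n t)%:E)
    mFn (fun n t _ => F0 n t) (fun t _ => ndE t).
  move=> h; have /cvg_lim <- // := h.
  apply: lime_le; first by apply/cvg_ex; eexists; exact: h.
  by apply: nearW => n; rewrite -EFin_Rint// lee_fin.
have iH' : mu.-integrable setT H.
  apply/integrableP; split=> //.
  by under eq_integral do rewrite gee0_abs//; exact: le_lt_trans iH (ltry _).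
exists (fine \o H); split.
  apply: le_integrable iH' => //; first exact/measurable_EFinP/measurableT_comp.
  by move=> t _ /=; case: (H t) (H0 t) => //=; rewrite normr0 leey.
have := integrable_ae measurableT iH'; apply: filterS => t /(_ I) /fineK Ht n.
by rewrite -lee_fin /= Ht.
Qed.

End real_integrals.

Section real_hoelder.
Context {d : measure_display} {T : measurableType d} {R : realType}.
Variable mu : {measure set T -> \bar R}.
Local Notation intble F := (mu.-integrable setT (EFin \o F)).

(** Reduces a bound by a product of possibly zero factors to positive
    factors, by which one can divide. *)
Lemma ler_mul_addgt0 (x a b : R) : 0 <= a -> 0 <= b ->
  (forall e, 0 < e -> x <= (a + e) * (b + e)) -> x <= a * b.
Proof.
move=> a0 b0 h; apply/ler_addgt0Pr => e e0.
pose y := Num.min 1 (e / (a + b + 1)).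
have ab : 0 < a + b + 1 by rewrite ltr_wpDl// addr_ge0.
have y0 : 0 < y by rewrite lt_min ltr01 divr_gt0.
rewrite (le_trans (h _ y0))//.
have y1 : y <= 1 by rewrite ge_min lexx.
have : y * (a + b + 1) <= e by rewrite -ler_pdivlMr// ge_min lexx orbT.
by nra.
Qed.

(** Hoelder's inequality for real functions, with the norms replaced by
    arbitrary upper bounds: a positive bound can be used to normalise. *)
Lemma hoelder_bound (p q : R) (F G : T -> R) (A B : R) :
  0 < p -> 0 < q -> p^-1 + q^-1 = 1 ->
  measurable_fun setT F -> measurable_fun setT G ->
  (forall t, 0 <= F t) -> (forall t, 0 <= G t) ->
  intble (fun t => F t `^ p) -> intble (fun t => G t `^ q) ->
  intble (fun t => F t * G t) /\
  (0 <= A -> 0 <= B -> \int[mu]_t (F t `^ p) <= A `^ p ->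
   \int[mu]_t (G t `^ q) <= B `^ q -> \int[mu]_t (F t * G t) <= A * B).
Proof.
move=> p0 q0 pq mF mG F0 G0 iF iG.
have iFG : intble (fun t => F t * G t).
  apply: (@intble_le _ _ _ _ _ (fun t => p^-1 * F t `^ p + q^-1 * G t `^ q)).
  - exact: measurable_funM.
  - move=> t; rewrite ger0_norm ?mulr_ge0// (mulrC p^-1) (mulrC q^-1).
    exact: conjugate_powR.
  - by apply: intbleD; exact: intbleZ.
split=> // A0 B0 FA GB; apply: ler_mul_addgt0 => // e e0.
have Ae : 0 < A + e by rewrite ltr_wpDl.
have Be : 0 < B + e by rewrite ltr_wpDl.
set a := A + e in Ae *; set b := B + e in Be *.
have {}FA : \int[mu]_t (F t `^ p) <= a `^ p.
  by rewrite (le_trans FA)// ge0_ler_powR ?nnegrE ?lerDl// ltW.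
have {}GB : \int[mu]_t (G t `^ q) <= b `^ q.
  by rewrite (le_trans GB)// ge0_ler_powR ?nnegrE ?lerDl// ltW.
have ap : 0 < a `^ p by exact: powR_gt0.
have bq : 0 < b `^ q by exact: powR_gt0.
apply: (@le_trans _ _ (\int[mu]_t ((a * b) * (p^-1 / a `^ p * F t `^ p + q^-1 / b `^ q * G t `^ q)))).
  apply: le_Rint => //.
    by apply: intbleZ; apply: intbleD; exact: intbleZ.
  move=> t; rewrite -ler_pdivrMl ?mulr_gt0// invfM mulrACA.
  apply: le_trans (@conjugate_powR _ _ _ p q _ _ p0 q0 pq) _.
  - by rewrite mulr_ge0// invr_ge0 ltW.
  - by rewrite mulr_ge0// invr_ge0 ltW.
  rewrite !powRM ?invr_ge0 ?(ltW Ae) ?(ltW Be)//.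
  have powV (x r : R) : 0 < x -> x^-1 `^ r = (x `^ r)^-1.
    by move=> x0; rewrite -powR_inv1 ?ltW// -powRrM mulN1r powRN.
  rewrite !powV//.
  by rewrite lerD// le_eqVlt; apply/orP; left; apply/eqP; ring.
rewrite RintZ; last by apply: intbleD; exact: intbleZ.
rewrite RintD ?RintZ; [|exact: iG|exact: iF|exact: intbleZ|exact: intbleZ].
rewrite ger_pMr ?mulr_gt0// -pq lerD// -mulrA ger_pMr ?invr_gt0// ler_pdivrMl// mulr1//.
Qed.

End real_hoelder.

(** * Functions and classes in L_p *)

Section Lp_facts.
Context {d : measure_display} {T : measurableType d} {R : realType} {k : scalar_kind}.
Local Notation K := (scalars R k).
Variable mu : {measure set T -> \bar R}.
Local Notation intble F := (mu.-integrable setT (EFin \o F)).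

Lemma sm_comp_measurable (Y : topologicalType) (h : Y -> R) (f : T -> Y) :
  continuous h -> strongly_measurable f -> measurable_fun setT (h \o f).
Proof.
move=> ch [s [ss sf]].
apply: (@measurable_fun_cvg _ _ _ setT (fun n t => h (s n t))) => [n|t _].
  move=> _ B mB; rewrite setTI.
  by rewrite (_ : _ @^-1` B = s n @^-1` (h @^-1` B))//; exact: simple_fun_preimage.
exact: (continuous_cvg _ (ch _) (sf t)).
Qed.

Lemma sm_comp (Y Z : topologicalType) (h : Y -> Z) (f : T -> Y) :
  continuous h -> strongly_measurable f -> strongly_measurable (h \o f).
Proof.
move=> ch [s [ss sf]]; exists (fun n => h \o s n); split=> [n|t].
  exact: simple_fun_comp.
exact: (continuous_cvg _ (ch _) (sf t)).
Qed.

Lemma sm_simple (Y : topologicalType) (s : T -> Y) :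
  simple_fun s -> strongly_measurable s.
Proof. by move=> ss; exists (fun=> s); split=> // t; exact: cvg_cst. Qed.

Lemma sm_scale (X : normedModType K) (c : T -> K^o) (f : T -> X) :
  strongly_measurable c -> strongly_measurable f ->
  strongly_measurable (fun t => (c t : K) *: f t).
Proof. exact: (strongly_measurable2 (@scale_continuous K X)). Qed.

Lemma sm_add (X : normedModType K) (f g : T -> X) :
  strongly_measurable f -> strongly_measurable g ->
  strongly_measurable (fun t => f t + g t).
Proof. exact: (strongly_measurable2 (@add_continuous X)). Qed.

Lemma sm_opp (X : normedModType K) (f : T -> X) :
  strongly_measurable f -> strongly_measurable (fun t => - f t).
Proof. exact: (sm_comp (@opp_continuous X)). Qed.

Variables (p : R) (p1 : 1 < p).
Let p0 : 0 < p. Proof. exact: lt_trans p1. Qed.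
Let pn0 : p != 0. Proof. by rewrite gt_eqF. Qed.

Lemma Lnorm_nonneg (h : T -> R) : (forall t, 0 <= h t) ->
  Lnorm mu p%:E (fun t => (h t)%:E) = ((\int[mu]_t (h t `^ p)%:E) `^ p^-1)%E.
Proof.
move=> h0; rewrite unlock; apply: (congr1 (poweR ^~ p^-1)).
by apply: eq_integral => t _; rewrite gee0_abs ?lee_fin.
Qed.

Section vector_valued.
Variable X : normedModType K.

Lemma measurable_nrm_powR (f : T -> X) (r : R) : strongly_measurable f ->
  measurable_fun setT (fun t => nrm (f t) `^ r).
Proof. by move=> /measurable_nrm; exact: measurable_powR. Qed.

Lemma pnormE (f : T -> X) :
  pnorm mu (p := p) f = ((\int[mu]_t (nrm (f t) `^ p)%:E) `^ p^-1)%E.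
Proof. by apply: Lnorm_nonneg => t; exact: nrm_ge0. Qed.

Lemma LpFun_memP (f : T -> X) : (f \in LpFun_pred mu p1 (X := X)) <->
  strongly_measurable f /\ intble (fun t => nrm (f t) `^ p).
Proof.
have h : strongly_measurable f -> ((pnorm mu (p := p) f < +oo)%E <->
    (\int[mu]_t (nrm (f t) `^ p)%:E < +oo)%E).
  move=> _; rewrite pnormE; split; last exact: poweR_lty.
  move=> h; have := poweR_lty p h; rewrite -poweRrM mulVf// poweRe1//.
  by apply: integral_ge0 => t _; rewrite lee_fin powR_ge0.
rewrite LpFun_predP; split=> -[mf hf]; split=> //.
  apply/integrableP; split; first exact/measurable_EFinP/measurable_nrm_powR.
  under eq_integral do rewrite /= ger0_norm ?powR_ge0//.
  exact/h.
apply/h => //; move/integrableP : hf => [_]; apply: le_lt_trans.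
rewrite le_eqVlt; apply/orP; left; apply/eqP; apply: eq_integral => t _.
by rewrite /= ger0_norm ?powR_ge0.
Qed.

Lemma LpFun_intble (f : LpFun mu p1 X) : intble (fun t => nrm (f t) `^ p).
Proof. by have /LpFun_memP[] := valP f. Qed.

Lemma LpFun_normE (f : LpFun mu p1 X) :
  nrm (Lp_class f) = (\int[mu]_t (nrm (f t) `^ p)) `^ p^-1.
Proof.
rewrite Lp_normE (@ae_eq_pnorm _ _ _ mu _ p X _ f) ; [|exact: LpFun_sm|exact: LpFun_sm|exact: Lp_classK].
by rewrite pnormE -EFin_Rint ?poweR_EFin//; exact: LpFun_intble.
Qed.

Lemma LpFun_norm_powR (f : LpFun mu p1 X) :
  nrm (Lp_class f) `^ p = \int[mu]_t (nrm (f t) `^ p).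
Proof.
rewrite LpFun_normE -powRrM mulVf// powRr1// ge0_Rint// => t.
exact: powR_ge0.
Qed.

Lemma Lp_norm_powR (f : Lp mu p1 X) :
  nrm f `^ p = \int[mu]_t (nrm (Lp_repr f t) `^ p).
Proof. by rewrite -LpFun_norm_powR Lp_reprK. Qed.

Lemma Lp_intble (f : Lp mu p1 X) : intble (fun t => nrm (Lp_repr f t) `^ p).
Proof. exact: LpFun_intble. Qed.

(** Comparison of norms through the [p]-th powers, where integrals live. *)
Lemma nrm_le_powR (Y : normedModType K) (y : Y) (A : R) :
  0 <= A -> nrm y `^ p <= A `^ p -> nrm y <= A.
Proof.
move=> A0 h; rewrite leNgt; apply/negP => Ay; move: h; apply/negP; rewrite -ltNge.
by apply: gt0_ltr_powR => //; rewrite nnegrE ?nrm_ge0.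
Qed.

End vector_valued.

Section mult.
Variable X : normedModType K.

Lemma LpFun_le (Y : normedModType K) (f : T -> X) (g : LpFun mu p1 Y) :
  strongly_measurable f -> (forall t, nrm (f t) <= nrm (g t)) ->
  f \in LpFun_pred mu p1 (X := X).
Proof.
move=> mf fg; apply/LpFun_memP; split=> //.
apply: intble_le (LpFun_intble g); first exact: measurable_nrm_powR.
move=> t; rewrite ger0_norm ?powR_ge0// ge0_ler_powR ?nnegrE ?nrm_ge0//.
exact: ltW.
Qed.

Lemma Lp_norm_le (Y : normedModType K) (f : LpFun mu p1 X) (g : LpFun mu p1 Y) :
  (forall t, nrm (f t) <= nrm (g t)) -> nrm (Lp_class f) <= nrm (Lp_class g).
Proof.
move=> fg; apply: nrm_le_powR; first exact: nrm_ge0.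
rewrite !LpFun_norm_powR; apply: le_Rint; [exact: LpFun_intble|exact: LpFun_intble|].
by move=> t; rewrite ge0_ler_powR ?nnegrE ?nrm_ge0//; exact: ltW.
Qed.

End mult.
End Lp_facts.

(** * The real duality pairing *)

Section pairing.
Context {d : measure_display} {T : measurableType d} {R : realType} {k : scalar_kind}.
Local Notation K := (scalars R k).
Variable mu : {measure set T -> \bar R}.
Local Notation intble F := (mu.-integrable setT (EFin \o F)).

(** For both scalar fields, the real part of the pairing determines the
    pairing itself (replace [f] by its multiples), so that duality can be
    done with real functionals only. *)
Definition pairing (f g : T -> K^o) : R := \int[mu]_t re ((f t : K) * g t).

Lemma pairingC (f g : T -> K^o) : pairing f g = pairing g f.
Proof. by apply: eq_Rintegral => t _; rewrite mulrC. Qed.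

Lemma measurable_re_mul (f g : T -> K^o) :
  strongly_measurable f -> strongly_measurable g ->
  measurable_fun setT (fun t => re ((f t : K) * g t)).
Proof.
move=> mf mg; apply: (@sm_comp_measurable _ _ _ K^o re); first exact: re_continuous.
exact: (sm_scale mf mg).
Qed.

Lemma ae_eq_pairing (f f' g g' : T -> K^o) :
  strongly_measurable f -> strongly_measurable f' ->
  strongly_measurable g -> strongly_measurable g' ->
  {ae mu, forall t, f t = f' t} -> {ae mu, forall t, g t = g' t} ->
  pairing f g = pairing f' g'.
Proof.
move=> mf mf' mg mg' ff' gg'; apply: ae_eq_Rint.
- exact: measurable_re_mul.
- exact: measurable_re_mul.
- by apply: filterS2 ff' gg' => t -> ->.
Qed.

Variables (p q : R) (p1 : 1 < p) (q1 : 1 < q).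
Hypothesis pq : p^-1 + q^-1 = 1.
Let p0 : 0 < p. Proof. exact: lt_trans p1. Qed.
Let q0 : 0 < q. Proof. exact: lt_trans q1. Qed.
Implicit Types (f : LpFun mu p1 K^o) (g : LpFun mu q1 K^o).

Lemma intble_re_mul f g : intble (fun t => re ((f t : K) * g t)).
Proof.
have mf := measurable_nrm (LpFun_sm f); have mg := measurable_nrm (LpFun_sm g).
have [+ _] := hoelder_bound 0 0 p0 q0 pq mf mg (fun t => nrm_ge0 _) (fun t => nrm_ge0 _)
  (LpFun_intble f) (LpFun_intble g).
apply: intble_le; first by apply: measurable_re_mul; exact: LpFun_sm.
by move=> t; rewrite -nkM; exact: norm_re_le.
Qed.

Lemma pairingDl f f' g : pairing (f + f') g = pairing f g + pairing f' g.
Proof.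
rewrite /pairing -RintD; [|exact: intble_re_mul|exact: intble_re_mul].
by apply: eq_Rintegral => t _; rewrite -reD -mulrDl.
Qed.

Lemma pairingDr f g g' : pairing f (g + g') = pairing f g + pairing f g'.
Proof.
rewrite /pairing -RintD; [|exact: intble_re_mul|exact: intble_re_mul].
by apply: eq_Rintegral => t _; rewrite -reD -mulrDr.
Qed.

Lemma pairingZ (a : K) (f g : T -> K^o) : pairing (a *: f) g = pairing f (a *: g).
Proof.
apply: eq_Rintegral => t _.
rewrite [LHS](_ : _ = re ((a * f t : K) * g t))//.
by rewrite [RHS](_ : _ = re ((f t : K) * (a * g t)))// mulrCA mulrA.
Qed.

Lemma pairing_ofRZ (c : R) f g : pairing f (ofR c *: g) = c * pairing f g.
Proof.
rewrite /pairing -RintZ; last exact: intble_re_mul.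
by apply: eq_Rintegral => t _; rewrite mulrCA re_ofRM.
Qed.

End pairing.

(** * Simple functions and completeness of L_p(X) *)

Section Lp_complete.
Context {d : measure_display} {T : measurableType d} {R : realType} {k : scalar_kind}.
Local Notation K := (scalars R k).
Variable mu : {measure set T -> \bar R}.
Local Notation intble F := (mu.-integrable setT (EFin \o F)).
Variables (p : R) (p1 : 1 < p) (X : normedModType K).
Let p0 : 0 < p. Proof. exact: lt_trans p1. Qed.
Let pn0 : p != 0. Proof. by rewrite gt_eqF. Qed.

Lemma simple_fun_if (Y : Type) (b : T -> bool) (s : T -> Y) (y : Y) :
  measurable_fun setT b -> simple_fun s ->
  simple_fun (fun t => if b t then s t else y).
Proof.
move=> mb ss.
have sb : simple_fun b.
  split=> [|c]; first exact: finite_finset.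
  by have := mb measurableT [set c] I; rewrite setTI.
exact: (simple_fun_comp (fun z : bool * Y => if z.1 then z.2 else y) (simple_fun_pair sb ss)).
Qed.

Lemma sm_if (Y : topologicalType) (b : T -> bool) (f : T -> Y) (y : Y) :
  measurable_fun setT b -> strongly_measurable f ->
  strongly_measurable (fun t => if b t then f t else y).
Proof.
move=> mb [s [ss sf]]; exists (fun n t => if b t then s n t else y).
split=> [n|t]; first exact: simple_fun_if.
by case: (boolP (b t)) => // _; exact: cvg_cst.
Qed.

Lemma simple_fun_map (I : Type) (r : seq I) (f : I -> T -> K^o) :
  (forall i, simple_fun (f i)) -> simple_fun (fun t => [seq f i t | i <- r]).
Proof.
move=> sf; elim: r => [|i r ih] /=.
  split; first by apply: (sub_finite_set (B := [set [::]])) => // _ [t _ <-].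
  move=> y; have [<-|ny] := eqVneq [::] y.
    by rewrite (_ : _ @^-1` _ = setT)//; apply/seteqP; split.
  by rewrite (_ : _ @^-1` _ = set0)//; apply/seteqP; split=> // t /= /eqP; rewrite (negbTE ny).
exact: (simple_fun_comp (fun z => z.1 :: z.2) (simple_fun_pair (sf i) ih)).
Qed.

Lemma cvg0_lt (u : nat -> R) (e : R) : 0 < e -> u n @[n --> \oo] --> (0 : R) ->
  exists N, forall n, (N <= n)%N -> u n < e.
Proof.
move=> e0 /cvgrPdist_lt /(_ _ e0)[N _ hN]; exists N => n /hN.
by rewrite sub0r normrN; exact/le_lt_trans/ler_norm.
Qed.

Lemma nrm_powR_cvg0 (u : nat -> X) (r : R) : 0 < r ->
  nrm (u n) @[n --> \oo] --> (0 : R) -> nrm (u n) `^ r @[n --> \oo] --> (0 : R).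
Proof.
move=> r0 u0; apply/cvgrPdist_lt => e e0.
have [N hN] := cvg0_lt (powR_gt0 r^-1 e0) u0.
exists N => // n /hN h; rewrite sub0r normrN ger0_norm ?powR_ge0//.
have -> : e = (e `^ r^-1) `^ r by rewrite -powRrM mulVf ?gt_eqF// powRr1// ltW.
by rewrite gt0_ltr_powR// nnegrE ?powR_ge0 ?nrm_ge0.
Qed.

(** Truncating pointwise approximants [s n] to where [|s n| <= 2 |f|] makes
    them dominated without destroying pointwise convergence. *)
Lemma simple_approx (f : LpFun mu p1 X) (e : R) : 0 < e ->
  exists s : LpFun mu p1 X, simple_fun s /\ nrm (Lp_class f - Lp_class s) < e.
Proof.
move=> e0; have mf := LpFun_sm f; have [s [ss sf]] := mf.
pose b n t := nrm (s n t) <= 2 * nrm (f t).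
pose s' n t := if b n t then s n t else 0.
have ss' n : simple_fun (s' n).
  apply: simple_fun_if => //; apply: measurable_fun_ler.
    exact/measurable_nrm/sm_simple.
  by apply: measurable_funM => //; exact: measurable_nrm.
have s'f n t : nrm (s' n t) <= nrm ((ofR 2 *: f) t).
  rewrite [X in _ <= X](_ : _ = 2 * nrm (f t)).
    by rewrite /s' /b; case: ifP => // _; rewrite nrm0 mulr_ge0 ?nrm_ge0.
  by rewrite [LHS](@nrm_ofRZ R k X 2 (f t)) ger0_norm.
have s'L n : s' n \in LpFun_pred mu p1 (X := X).
  exact: (LpFun_le (g := (ofR 2 *: f : LpFun mu p1 X)) (sm_simple (ss' n))).
pose S n : LpFun mu p1 X := MkLpFun (s'L n).
pose F n t := nrm ((f - S n) t) `^ p.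
have F0 t : F n t @[n --> \oo] --> (0 : R).
  apply: nrm_powR_cvg0 => //.
  have [ft0|ft0] := eqVneq (f t) 0.
    rewrite (_ : (fun n => _) = fun=> 0); first exact: cvg_cst.
    apply/funext => n; rewrite [X in nrm X](_ : _ = f t - s' n t)// /s' /b ft0 nrm0 mulr0.
    case: ifP => [|_]; last by rewrite subr0 nrm0.
    move=> h; rewrite sub0r nrmN; apply/eqP; rewrite eq_le h nrm_ge0//.
  have nf0 : 0 < nrm (f t).
    rewrite lt_neqAle nrm_ge0 andbT eq_sym; apply: contra_neq ft0; exact: nrm_eq0.
  have /nrm_cvgP h := sf t.
  apply/cvgrPdist_lt => c c0; apply: filterS2 (h _ nf0) (h _ c0) => n h1 h2.
  rewrite sub0r normrN ger0_norm ?nrm_ge0//.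
  rewrite [X in nrm X](_ : _ = f t - s' n t)// /s' ifT// /b.
  by rewrite -(subrK (f t) (s n t)) (le_trans (nrmD _ _))// mulr2n mulrDl mul1r lerD2r nrm_distC ltW.
have := @dominated_cvg0 _ _ _ mu F (fun t => 3 `^ p * nrm (f t) `^ p) _ _ _ F0.
have -> : (fun n => \int[mu]_t F n t) = fun n => nrm (Lp_class f - Lp_class (S n)) `^ p.
  by apply/funext => n; rewrite -linearB LpFun_norm_powR.
move=> h; have [N hN] : exists N, forall n, (N <= n)%N -> nrm (Lp_class f - Lp_class (S n)) `^ p < e `^ p.
  apply: cvg0_lt; first exact: powR_gt0.
  apply: h.
  - by move=> n; apply: measurable_nrm_powR; exact: LpFun_sm.
  - move=> n t; rewrite ger0_norm ?powR_ge0// -powRM ?nrm_ge0//.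
  rewrite ge0_ler_powR ?nnegrE ?nrm_ge0 ?mulr_ge0 ?nrm_ge0//; first exact: ltW.
  rewrite [X in nrm X](_ : _ = f t - s' n t)// (le_trans (nrmD _ _))// nrmN.
  have := s'f n t; rewrite [X in _ <= X](@nrm_ofRZ R k X 2 (f t)) ger0_norm//; lra.
  - by apply: intbleZ; exact: LpFun_intble.
exists (S N); split; [exact: ss'|rewrite ltNge]; apply/negP => h2.
have := hN N (leqnn _); apply/negP; rewrite -leNgt.
by apply: ge0_ler_powR h2; rewrite ?nnegrE ?nrm_ge0// ltW.
Qed.

Lemma sum_exp2V n : \sum_(i < n) 2 ^- i <= 2 :> R.
Proof.
suff -> : \sum_(i < n) 2 ^- i = 2 - 2 * 2 ^- n :> R.
  by rewrite gerBl mulr_ge0// invr_ge0 exprn_ge0.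
elim: n => [|n ih]; first by rewrite big_ord0 expr0 invr1; ring.
rewrite big_ord_recr/= ih exprS invfM.
have : (2 : R) * 2^-1 = 1 by rewrite divff.
set a := 2 ^- n; set b := 2^-1 => hb.
by rewrite mulrA hb; ring.
Qed.

(** Riesz-Fischer for strongly measurable functions.  Working with simple
    approximants of the given sequence makes strong measurability of the limit
    hold by definition. *)
Lemma Lp_seq_complete : seq_complete X -> seq_complete (Lp mu p1 X).
Proof.
move=> cX; apply: seq_completeP => u hu.
have /choice[s hs] n : exists s : LpFun mu p1 X,
    simple_fun s /\ nrm (u n - Lp_class s) < 2 ^- n.
  by rewrite -{1}(Lp_reprK (u n)); apply: simple_approx; exact: exp2V_gt0.
pose v n := Lp_class (s n).
have hv n : nrm (v n.+1 - v n) <= 3 * 2 ^- n.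
  have -> : v n.+1 - v n = (v n.+1 - u n.+1) + (u n.+1 - u n) + (u n - v n).
    by rewrite -addrA [_ - _ + (_ - v n)]addrA subrK addrA subrK.
  have h2 : 2 ^- n.+1 <= 2 ^- n :> R by rewrite lef_pV2 ?posrE ?exprn_gt0// ler_eXn2l// ltr1n.
  have := ltW (hs n).2; have := ltW (hs n.+1).2; have := hu n.
  rewrite -/(v n) -/(v n.+1) (nrm_distC (u n.+1) (v n.+1)).
  have := nrmD (v n.+1 - u n.+1 + (u n.+1 - u n)) (u n - v n).
  have := nrmD (v n.+1 - u n.+1) (u n.+1 - u n).
  lra.
have hL n : (fun t => ofR (nrm ((s n.+1 - s n) t))) \in LpFun_pred mu p1 (X := K^o).
  apply: (LpFun_le (g := s n.+1 - s n)).
    apply: (@sm_comp _ _ X K^o (ofR \o @nrm R k X)); last exact: LpFun_sm.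
    move=> x; apply: (@continuous_comp X R K^o); first exact: nrm_continuous.
    exact: ofR_continuous.
  by move=> t; rewrite nk_ofR ger0_norm ?nrm_ge0.
pose h n : LpFun mu p1 K^o := MkLpFun (hL n).
have nh n : nrm (Lp_class (h n)) <= 3 * 2 ^- n.
  apply: le_trans (hv n); rewrite -linearB; apply: Lp_norm_le => t.
  by rewrite nk_ofR ger0_norm ?nrm_ge0.
pose G N t := \sum_(n < N) nrm (s n.+1 t - s n t).
have G0 N t : 0 <= G N t by apply: sumr_ge0 => i _; exact: nrm_ge0.
have GE N t : nrm ((\sum_(n < N) h n : LpFun mu p1 K^o) t) = G N t.
  rewrite (_ : LpFun_val _ t = ofR (G N t)); first by rewrite nk_ofR ger0_norm.
  rewrite /G; elim: N {G0} => [|N ih]; first by rewrite !big_ord0 ofR0.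
  by rewrite !big_ord_recr/= ofRD -ih.
have iG N : intble (fun t => G N t `^ p).
  have := LpFun_intble (\sum_(n < N) h n : LpFun mu p1 K^o).
  by apply: eq_integrable => // t _; rewrite /= GE.
have [|||H [iH GH]] := @monotone_intble _ _ _ mu (fun N t => G N t `^ p) (6 `^ p) iG.
- by move=> n t; exact: powR_ge0.
- move=> t n m nm; rewrite ge0_ler_powR ?nnegrE ?G0//; first exact: ltW.
  by rewrite /G -(subnKC nm) big_split_ord/= lerDl sumr_ge0// => i _; exact: nrm_ge0.
- move=> N; rewrite (_ : Rintegral _ _ _ = \int[mu]_t (nrm ((\sum_(n < N) h n : LpFun mu p1 K^o) t) `^ p)).
    rewrite -LpFun_norm_powR ge0_ler_powR ?nnegrE ?nrm_ge0//; first exact: ltW.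
    rewrite linear_sum (le_trans (nrm_sum _ _ _))//.
    apply: (@le_trans _ _ (\sum_(i < N) 3 * 2 ^- i)).
      by apply: ler_sum => i _; exact: nh.
    rewrite -mulr_sumr.
    by have := sum_exp2V N; lra.
  by apply: eq_Rintegral => t _; rewrite GE.
have [N0 [mN0 N00 hN0]] := GH.
(* Off the null set N0 the approximants converge; on N0 they are replaced by 0,
   so that the limit exists everywhere and is a limit of simple functions. *)
pose b t := t \notin N0.
pose s' n t := if b t then s n t else 0.
have mb : measurable_fun setT b.
  apply: (measurable_fun_bool true); rewrite setTI.
  rewrite (_ : _ @^-1` _ = ~` N0); first exact: measurableC.
  by apply/seteqP; split=> t /=; rewrite /b -(notin_setE N0 t).
have ss' n : simple_fun (s' n) by apply: simple_fun_if => //; exact: (hs n).1.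
have incr t n m : (n <= m)%N -> nrm (s m t - s n t) <= G m t - G n t.
  move=> nm; rewrite -(subnKC nm) /G big_split_ord/= addrAC subrr add0r.
  elim: (m - n)%N => [|j ih]; first by rewrite addn0 subrr nrm0 big_ord0.
  have -> : s (n + j.+1)%N t - s n t =
      (s (n + j).+1 t - s (n + j)%N t) + (s (n + j)%N t - s n t).
    by rewrite addnS addrA subrK.
  by rewrite (le_trans (nrmD _ _))// big_ord_recr/= addrC lerD.
have GHp t n : b t -> G n t `^ p <= H t.
  move=> /negP bt; apply: contrapT => c; apply: bt; rewrite inE; apply: hN0 => /(_ n).
  exact: c.
have GHt t n : b t -> G n t <= H t `^ p^-1.
  move=> bt; have -> : G n t = (G n t `^ p) `^ p^-1 by rewrite -powRrM divff// powRr1.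
  rewrite ge0_ler_powR ?nnegrE ?powR_ge0 ?invr_ge0 ?(ltW p0) ?GHp//.
  by rewrite (le_trans _ (GHp _ n bt)) ?powR_ge0.
have /choice[f hf] t : exists x : X, s' n t @[n --> \oo] --> x.
  apply: cX; rewrite /s'; case: (boolP (b t)) => [bt|_]; last first.
    by move=> e e0; exists 0%N => n m _ _; rewrite subrr nrm0.
  have : cvgn (G ^~ t).
    apply: nondecreasing_is_cvgn.
      move=> n m nm; rewrite /G -(subnKC nm) big_split_ord/= lerDl sumr_ge0// => i _; exact: nrm_ge0.
    by exists (H t `^ p^-1) => _ [n _ <-]; exact: GHt.
  move=> /cvg_cauchy /cauchy_ballP cG e e0.
  have [[A B] /= [[N1 _ A1] [N2 _ B2]] AB] := cG _ e0.
  exists (maxn N1 N2).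
  have {A1 B2 AB} key n m : (maxn N1 N2 <= n)%N -> (maxn N1 N2 <= m)%N -> (n <= m)%N ->
      nrm (s n t - s m t) < e.
    rewrite !geq_max => /andP[n1 _] /andP[_ m2] nm.
    have := AB (G n t, G m t) (conj (A1 n n1) (B2 m m2)).
    rewrite -ball_normE/= distrC; apply: le_lt_trans.
    by rewrite nrm_distC (le_trans (incr _ _ _ nm))// ler_norm.
  move=> n m n1 m1; have [nm|/ltnW mn] := leqP n m; first exact: key.
  by rewrite nrm_distC; exact: key.
have mf : strongly_measurable f by exists s'.
have s'L n : s' n \in LpFun_pred mu p1 (X := X).
  apply: (LpFun_le (g := s n) (sm_simple (ss' n))) => t.
  by rewrite /s'; case: ifP => // _; rewrite nrm0 nrm_ge0.
pose S n : LpFun mu p1 X := MkLpFun (s'L n).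
have SE n : Lp_class (S n) = v n.
  apply/Lp_classP; exists N0; split=> // t /= ht; apply: contrapT => tN; apply: ht.
  by rewrite /S/= /s' ifT// /b notin_setE.
have bound n t : nrm (f t - s' n t) `^ p <= `|H t|.
  have := hf t; rewrite /s'; case: (boolP (b t)) => [bt ft|_ f0]; last first.
    have -> : f t = 0 by apply: (cvg_unique _ f0 (cvg_cst _)).
    by rewrite subrr nrm0 powR0.
  have H0 : 0 <= H t by rewrite (le_trans _ (GHp _ 0%N bt)) ?powR_ge0.
  have -> : `|H t| = (H t `^ p^-1) `^ p by rewrite -powRrM mulVf// powRr1// ger0_norm.
  rewrite ge0_ler_powR ?nnegrE ?nrm_ge0 ?powR_ge0//; first exact: ltW.
  apply/ler_addgt0Pl => e e0; move/nrm_cvgP : ft => /(_ _ e0)[M _ hM].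
  have /hM /ltW h1 : (M <= maxn M n)%N by rewrite leq_maxl.
  rewrite -(subrK (s (maxn M n) t) (f t)) -addrA (le_trans (nrmD _ _))// lerD//.
  rewrite (le_trans (incr t n (maxn M n) _)) ?leq_maxr//.
  by rewrite (le_trans _ (GHt _ (maxn M n) bt))// gerBl.
have iH' : intble (fun t => `|H t|) by apply: integrable_abse iH.
have gL : (fun t => f t - s' 0%N t) \in LpFun_pred mu p1 (X := X).
  have mg : strongly_measurable (fun t => f t - s' 0%N t).
    by apply: sm_add => //; apply: sm_opp; exact: sm_simple.
  apply/LpFun_memP; split=> //; apply: intble_le iH'; first exact: measurable_nrm_powR.
  by move=> t; rewrite ger0_norm ?powR_ge0.
pose fb : LpFun mu p1 X := S 0%N + MkLpFun gL.
have fbE t : fb t = f t by rewrite [LHS](_ : _ = s' 0%N t + (f t - s' 0%N t))// addrC subrK.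
exists (Lp_class fb); apply/nrm_cvgP => e e0.
have e20 : 0 < e / 2 by rewrite divr_gt0.
have [M1 hM1] := exp2V_lt e20.
have [M2 hM2] : exists N, forall n, (N <= n)%N -> nrm (Lp_class fb - v n) `^ p < (e / 2) `^ p.
  apply: cvg0_lt; first exact: powR_gt0.
  rewrite (_ : (fun n => _) = fun n => \int[mu]_t (nrm (f t - s' n t) `^ p)); last first.
    apply/funext => n; rewrite -SE -linearB LpFun_norm_powR.
    by apply: eq_Rintegral => t _; rewrite [X in nrm X](_ : _ = fb t - s' n t)// fbE.
  apply: dominated_cvg0 iH' _.
  - move=> n; apply: measurable_nrm_powR.
    by apply: sm_add => //; apply: sm_opp; exact: sm_simple.
  - by move=> n t; rewrite ger0_norm ?powR_ge0.
  - move=> t; apply: nrm_powR_cvg0 => //; have /nrm_cvg0P := hf t.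
    by under eq_fun do rewrite nrm_distC.
exists (maxn M1 M2) => // n /=; rewrite geq_max => /andP[n1 n2].
rewrite (splitr e) -(subrK (v n) (Lp_class fb)) -addrA (le_lt_trans (nrmD _ _))// ltrD//.
  rewrite ltNge; apply/negP => h2.
  have := hM2 n n2; apply/negP; rewrite -leNgt.
  by apply: ge0_ler_powR h2; rewrite ?nnegrE ?nrm_ge0// ltW.
by rewrite nrm_distC (lt_trans (hs n).2)// hM1.
Qed.

End Lp_complete.

(** * Power inequalities *)

Section power_inequalities.
Context {R : realType}.
Implicit Types x y s t r : R.

Lemma powR_subadd t x y : 1 <= t -> 0 <= x -> 0 <= y ->
  x `^ t + y `^ t <= (x + y) `^ t.
Proof.
move=> t1 x0 y0; have t0 : 0 < t by exact: lt_le_trans t1.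
have [xy0|xy0] := eqVneq (x + y) 0.
  have -> : x = 0 by lra.
  have -> : y = 0 by lra.
  by rewrite addr0 powR0 ?gt_eqF// addr0.
have xyp : 0 < x + y by rewrite lt_neqAle eq_sym xy0 addr_ge0.
have key u : 0 <= u -> u <= x + y -> u `^ t <= u / (x + y) * (x + y) `^ t.
  move=> u0 uxy; have -> : u `^ t = (u / (x + y)) `^ t * (x + y) `^ t.
    by rewrite -powRM ?divr_ge0 ?(ltW xyp)// divfK.
  rewrite ler_wpM2r ?powR_ge0//.
  have [->|un0] := eqVneq u 0; first by rewrite mul0r powR0// gt_eqF.
  have up : 0 < u by rewrite lt_neqAle eq_sym un0.
  by apply: ge1r_powR => //; rewrite divr_gt0//= ler_pdivrMr// mul1r.
apply: le_trans (lerD (key x x0 _) (key y y0 _)) _; rewrite ?lerDl ?lerDr//.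
by rewrite -mulrDl -mulrDl divff// mul1r.
Qed.

(** The tangent inequality for the convex function [x ^ t] is Young's
    inequality. *)
Lemma powR_tangent t x s : 1 < t -> 0 <= x -> 0 <= s ->
  s `^ t + t * s `^ (t - 1) * (x - s) <= x `^ t.
Proof.
move=> t1 x0 s0; have t0 : 0 < t by exact: lt_trans t1.
have t10 : 0 < t - 1 by rewrite subr_gt0.
have := @conjugate_powR R x (s `^ (t - 1)) t (t / (t - 1)) x0 (powR_ge0 _ _) t0.
rewrite divr_gt0// => /(_ isT); rewrite invf_div -powRrM.
have -> : (t - 1) * (t / (t - 1)) = t by rewrite mulrC divfK// gt_eqF.
have -> : t^-1 + (t - 1) / t = 1.
  by rewrite -{1}(mul1r t^-1) -mulrDl subrKC divff// gt_eqF.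
move=> /(_ erefl) h.
have e : s * s `^ (t - 1) = s `^ t by rewrite mulr_powRB1.
have {}h : t * (x * s `^ (t - 1)) <= x `^ t + s `^ t * (t - 1).
  rewrite -ler_pdivlMl// mulrDr; apply: le_trans h _.
  by rewrite le_eqVlt; apply/orP; left; apply/eqP; ring.
have -> : t * s `^ (t - 1) * (x - s) = t * (x * s `^ (t - 1)) - t * (s * s `^ (t - 1)) by ring.
by rewrite e; lra.
Qed.

Lemma powR_mid_convex t x y : 1 <= t -> 0 <= x -> 0 <= y ->
  ((x + y) / 2) `^ t <= (x `^ t + y `^ t) / 2.
Proof.
rewrite le_eqVlt => /predU1P[<- x0 y0|t1 x0 y0].
  by rewrite !powRr1 ?divr_ge0 ?addr_ge0.
have s0 : 0 <= (x + y) / 2 by rewrite divr_ge0 ?addr_ge0.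
have := powR_tangent t1 x0 s0; have := powR_tangent t1 y0 s0.
set s := (x + y) / 2; have -> : x = 2 * s - y by rewrite /s; field.
set a := t * _; set b := s `^ t; set c := _ `^ t; set e := _ `^ t.
lra.
Qed.

(** Quantitative convexity of [x ^ r] for [1 < r < 2]: applying weighted AM-GM to
    [x s^(r-1) = x^(2-r) (x s)^(r-1)] improves the tangent inequality by a square
    in the variable [x ^ (r / 2)]. *)
Lemma powR_tangent2 r x s : 1 < r -> r < 2 -> 0 <= x -> 0 <= s ->
  s `^ r + r * s `^ (r - 1) * (x - s) + (r - 1) * (x `^ (r / 2) - s `^ (r / 2)) ^+ 2
   <= x `^ r.
Proof.
move=> r1 r2 x0 s0; have r0 : 0 < r by exact: lt_trans r1.
have r10 : 0 < r - 1 by rewrite subr_gt0.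
have r20 : 0 < 2 - r by rewrite subr_gt0.
have sq u : 0 <= u -> (u `^ (r / 2)) ^+ 2 = u `^ r.
  by move=> u0; rewrite -powR_mulrn ?powR_ge0// -powRrM divfK.
have := @conjugate_powR R (x `^ (2 - r)) ((x * s) `^ (r - 1)) (r / (2 - r))
  (r / (2 * (r - 1))) (powR_ge0 _ _) (powR_ge0 _ _).
rewrite !divr_gt0 ?mulr_gt0// => /(_ isT isT).
rewrite !invf_div -!powRrM.
have -> : (2 - r) / r + 2 * (r - 1) / r = 1.
  by rewrite -mulrDl -[RHS](@divff _ r) ?gt_eqF//; congr (_ / _); ring.
move=> /(_ erefl).
have -> : (2 - r) * (r / (2 - r)) = r by rewrite mulrC divfK// gt_eqF.
have -> : (r - 1) * (r / (2 * (r - 1))) = r / 2.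
  by move: r10 => /lt0r_neq0 h; field.
have -> : x `^ (2 - r) * (x * s) `^ (r - 1) = x * s `^ (r - 1).
  rewrite powRM// mulrA; congr (_ * _); have [->|xn0] := eqVneq x 0.
    by rewrite !powR0 ?mulr0// gt_eqF.
  rewrite -powRD ?xn0 ?implybT// (_ : _ + _ = 1) ?powRr1//; ring.
rewrite powRM// => h.
have {}h : r * (x * s `^ (r - 1)) <=
    x `^ r * (2 - r) + x `^ (r / 2) * s `^ (r / 2) * (2 * (r - 1)).
  rewrite -ler_pdivlMl// mulrDr; apply: le_trans h _.
  by rewrite le_eqVlt; apply/orP; left; apply/eqP; ring.
have e : s * s `^ (r - 1) = s `^ r by rewrite mulr_powRB1.
have -> : r * s `^ (r - 1) * (x - s) = r * (x * s `^ (r - 1)) - r * (s * s `^ (r - 1)) by ring.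
by rewrite e sqrrB !sq//; move: h; set a := _ * s `^ (r / 2); nra.
Qed.

Lemma powR_mid2 r x y : 1 < r -> r < 2 -> 0 <= x -> 0 <= y ->
  ((x + y) / 2) `^ r + (r - 1) / 4 * (x `^ (r / 2) - y `^ (r / 2)) ^+ 2
    <= (x `^ r + y `^ r) / 2.
Proof.
move=> r1 r2 x0 y0.
have s0 : 0 <= (x + y) / 2 by rewrite divr_ge0 ?addr_ge0.
have := powR_tangent2 r1 r2 x0 s0; have := powR_tangent2 r1 r2 y0 s0.
set s := (x + y) / 2.
have hx : x - s = - (y - s) by rewrite /s; field.
rewrite hx mulrN; set a := r * _ * _.
set X := x `^ (r / 2); set Y := y `^ (r / 2); set S := s `^ (r / 2).
have : 0 <= (r - 1) * (X + Y - 2 * S) ^+ 2 by rewrite mulr_ge0 ?sqr_ge0// subr_ge0 ltW.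
nra.
Qed.

Lemma powR_add_le r x y : 0 <= r -> 0 <= x -> 0 <= y ->
  (x + y) `^ r <= 2 `^ r * (x `^ r + y `^ r).
Proof.
move=> r0 x0 y0; wlog xy : x y x0 y0 / x <= y => [h|].
  have [/h|/ltW /h] := leP x y; first exact.
  by rewrite addrC [X in _ -> _ <= _ * X]addrC; exact.
apply: (@le_trans _ _ ((2 * y) `^ r)).
  by rewrite ge0_ler_powR ?nnegrE ?addr_ge0 ?mulr_ge0//; lra.
by rewrite powRM// ler_wpM2l ?powR_ge0// lerDr powR_ge0.
Qed.

End power_inequalities.

(** * Uniform convexity *)

Section uniform_convexity.
Context {R : realType} {k : scalar_kind}.
Local Notation K := (scalars R k).
Local Notation nk := (@nrm R k K^o).
Implicit Types z w : K.

(** The deficit in the midpoint convexity of [|.| ^ r]. *)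
Definition midgap (r : R) z w : R :=
  (nk z `^ r + nk w `^ r) / 2 - (nk (z + w) / 2) `^ r.

(** For [r >= 2] the inequality is the parallelogram identity, raised to the
    power [r / 2 >= 1] by superadditivity on one side and convexity on the
    other. *)
Lemma midgap_ge2 (r : R) z w : 2 <= r -> nk (z - w) `^ r <= 2 `^ r * midgap r z w.
Proof.
move=> r2; have r0 : 0 < r by apply: lt_le_trans r2.
have sq u : 0 <= u -> (u ^+ 2) `^ (r / 2) = u `^ r :> R.
  by move=> u0; rewrite -powR_mulrn// -powRrM mulrC divfK.
have r21 : 1 <= r / 2 by rewrite ler_pdivlMr// mul1r.
have := powR_mid_convex r21 (sqr_ge0 (nk z)) (sqr_ge0 (nk w)).
rewrite !sq ?nrm_ge0//.
have -> : (nk z ^+ 2 + nk w ^+ 2) / 2 = (nk (z + w) / 2) ^+ 2 + (nk (z - w) / 2) ^+ 2.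
  rewrite !expr_div_n -mulrDl parallelogram; by field.
have := powR_subadd r21 (sqr_ge0 (nk (z + w) / 2)) (sqr_ge0 (nk (z - w) / 2)).
rewrite !sq ?divr_ge0 ?nrm_ge0// => h1 h2.
rewrite /midgap (_ : nk (z - w) `^ r = 2 `^ r * (nk (z - w) / 2) `^ r); last first.
  by rewrite -powRM ?divr_ge0 ?nrm_ge0// mulrC divfK.
by rewrite ler_wpM2l ?powR_ge0// lerBrDl (le_trans h1 h2).
Qed.

(** For [r < 2] there are two reasons for which distant points have a gap.
    If the moduli differ by a fixed fraction, the scalar inequality
    [powR_mid2] applies. If they are nearly equal, the parallelogram
    identity makes [|z + w|] smaller than [|z| + |w|] by a fixed factor. *)
Lemma midgap_lt2 (r eta : R) : 1 < r -> r < 2 -> 0 < eta -> eta <= 1 ->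
  exists2 c : R, 0 < c & forall z w, eta * Num.max (nk z) (nk w) < nk (z - w) ->
    c * Num.max (nk z) (nk w) `^ r <= midgap r z w.
Proof.
move=> r1 r2 e0 e1; have r0 : 0 < r by exact: lt_trans r1.
have r20 : 0 < r / 2 by rewrite divr_gt0.
pose a : R := (r - 1) / 4 * (1 - (1 - eta / 2) `^ (r / 2)) ^+ 2.
pose b : R := (2^-1) `^ r * (1 - (1 - eta ^+ 2 / 8) `^ (r / 2)).
have lt1 u : 0 < u -> u <= 1 -> (1 - u) `^ (r / 2) < 1.
  move=> u0 u1; have h1 : 1 `^ (r / 2) = 1 :> R by rewrite powR1.
  rewrite -[ltRHS]h1.
  by rewrite gt0_ltr_powR ?nnegrE ?subr_ge0// ltrBlDr ltrDl.
have e2 : eta ^+ 2 <= 1 by rewrite expr_le1// ltW.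
have a0 : 0 < a.
  rewrite mulr_gt0 ?divr_gt0 ?subr_gt0// exprn_gt0// subr_gt0 lt1 ?divr_gt0//; lra.
have b0 : 0 < b.
  by rewrite mulr_gt0 ?powR_gt0 ?subr_gt0 ?lt1 ?divr_gt0 ?exprn_gt0//; lra.
exists (Num.min a b); first by rewrite lt_min a0.
move=> z w; wlog zw : z w / nk w <= nk z => [h|].
  have /orP[/h//|/h] := le_total (nk w) (nk z).
  rewrite maxC nrm_distC /midgap; have -> : w + z = z + w by exact: addrC.
  by rewrite (addrC (nk w `^ r)).
rewrite max_l//; set M := nk z in zw *; set y := nk w in zw *; set D := nk (z - w) => De.
have y0 : 0 <= y by exact: nrm_ge0.
have M0 : 0 <= M by exact: nrm_ge0.
have pl : nk (z + w) ^+ 2 + D ^+ 2 = 2 * (M ^+ 2 + y ^+ 2) by exact: parallelogram.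
have m0 : 0 <= nk (z + w) by exact: nrm_ge0.
have mle : nk (z + w) <= M + y by exact: nrmD.
set m := nk (z + w) in pl m0 mle *.
have De2 : (eta * M) ^+ 2 < D ^+ 2 by rewrite ltr_pXn2r ?nnegrE ?mulr_ge0 ?nrm_ge0// ltW.
have Mr0 : 0 <= M `^ r by exact: powR_ge0.
(* Moduli that differ by a fixed fraction, then nearly equal moduli. *)
have [yM|yM] := leP y ((1 - eta / 2) * M).
  apply: (@le_trans _ _ (a * M `^ r)); first by rewrite ler_wpM2r// ge_min lexx.
  have := powR_mid2 r1 r2 M0 y0.
  have -> : a * M `^ r = (r - 1) / 4 * (M `^ (r / 2) * (1 - (1 - eta / 2) `^ (r / 2))) ^+ 2.
    have -> : M `^ r = (M `^ (r / 2)) ^+ 2 by rewrite -powR_mulrn ?powR_ge0// -powRrM divfK.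
    by rewrite /a; ring.
  rewrite /midgap -/m -/M -/y => h; rewrite lerBrDl; apply: le_trans h.
  rewrite lerD//; first by apply: ge0_ler_powR; rewrite ?nnegrE ?divr_ge0 ?addr_ge0 ?(ltW r0)// ler_pM2r.
  have r14 : 0 <= (r - 1) / 4 by rewrite divr_ge0// subr_ge0 ltW.
  have u0 : 0 <= 1 - eta / 2 by lra.
  have A0 : 0 <= M `^ (r / 2) * (1 - (1 - eta / 2) `^ (r / 2)).
    by rewrite mulr_ge0 ?powR_ge0// subr_ge0 ltW// lt1 ?divr_gt0//; lra.
  have B0 : 0 <= M `^ (r / 2) - y `^ (r / 2).
    by rewrite subr_ge0 ge0_ler_powR ?nnegrE ?(ltW r20).
  rewrite ler_wpM2l// ler_pXn2r ?nnegrE// mulrBr mulr1 lerB//.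
  have -> : M `^ (r / 2) * (1 - eta / 2) `^ (r / 2) = ((1 - eta / 2) * M) `^ (r / 2).
    by rewrite powRM// mulrC.
  by apply: ge0_ler_powR; rewrite ?(ltW r20) ?nnegrE ?mulr_ge0.
apply: (@le_trans _ _ (b * M `^ r)); first by rewrite ler_wpM2r// ge_min lexx orbT.
have s0 : 0 <= (M + y) / 2 by rewrite divr_ge0// addr_ge0.
have h1 := powR_mid_convex (ltW r1) M0 y0.
have h2 : (m / 2) ^+ 2 <= ((M + y) / 2) ^+ 2 * (1 - eta ^+ 2 / 8).
  have : (M - y) ^+ 2 <= (eta / 2 * M) ^+ 2.
    rewrite ler_pXn2r ?nnegrE ?subr_ge0 ?mulr_ge0 ?divr_ge0 ?(ltW e0)//; lra.
  have : (M + y) ^+ 2 <= (2 * M) ^+ 2.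
    by rewrite ler_pXn2r ?nnegrE ?addr_ge0 ?mulr_ge0//; lra.
  move=> h3 h4; have h5 : eta ^+ 2 * (M + y) ^+ 2 <= eta ^+ 2 * (2 * M) ^+ 2.
    by rewrite ler_wpM2l ?sqr_ge0.
  have h6 : 0 <= eta ^+ 2 * M ^+ 2 by rewrite mulr_ge0 ?sqr_ge0.
  by move: h4 h5 h6 De2 pl; clear; lra.
have h3 : (m / 2) `^ r <= ((M + y) / 2) `^ r * (1 - eta ^+ 2 / 8) `^ (r / 2).
  have sq u : 0 <= u -> u `^ r = (u ^+ 2) `^ (r / 2).
    by move=> u0; rewrite -powR_mulrn// -powRrM mulrC divfK.
  have u8 : 0 <= 1 - eta ^+ 2 / 8 by lra.
  rewrite (sq (m / 2)) ?divr_ge0// (sq ((M + y) / 2))// -powRM ?sqr_ge0//.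
  by rewrite ge0_ler_powR ?nnegrE ?mulr_ge0 ?sqr_ge0 ?(ltW r20)//; lra.
have h4 : (2^-1) `^ r * M `^ r <= ((M + y) / 2) `^ r.
  by rewrite -powRM ?invr_ge0// ge0_ler_powR ?nnegrE ?mulr_ge0 ?invr_ge0 ?(ltW r0)//; lra.
rewrite /midgap -/m -/M -/y /b.
have h5 : 0 <= 1 - (1 - eta ^+ 2 / 8) `^ (r / 2).
  by rewrite subr_ge0 ltW// lt1 ?divr_gt0 ?exprn_gt0//; lra.
move: h1 h3 (ler_wpM2r h5 h4); set A := ((M + y) / 2) `^ r; set B := _ `^ (r / 2).
lra.
Qed.

(** Uniform convexity in pointwise form: after integration it bounds the
    [r]-th power of the distance of two functions by the midpoint gap of
    their norms, up to an arbitrarily small multiple of the norms. *)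
Lemma uniform_convexity (r e : R) : 1 < r -> 0 < e ->
  exists2 c : R, 0 <= c & forall z w,
    nk (z - w) `^ r <= e * (nk z `^ r + nk w `^ r) + c * midgap r z w.
Proof.
move=> r1 e0; have r0 : 0 < r by exact: lt_trans r1.
have gap0 z w : 0 <= midgap r z w.
  have := powR_mid_convex (ltW r1) (@nrm_ge0 R k K^o z) (@nrm_ge0 R k K^o w).
  rewrite /midgap subr_ge0; apply: le_trans.
  rewrite ge0_ler_powR ?nnegrE ?divr_ge0 ?addr_ge0 ?nrm_ge0 ?(ltW r0)//.
  by rewrite ler_pM2r// nrmD.
have [r2|r2] := leP 2 r.
  exists (2 `^ r); first exact: powR_ge0.
  move=> z w; apply: le_trans (midgap_ge2 z w r2) _.
  by rewrite lerDr mulr_ge0 ?addr_ge0 ?powR_ge0// ltW.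
(* Below the threshold eta the distance itself is absorbed by the term in e. *)
pose eta := Num.min 1 (e `^ r^-1).
have eta0 : 0 < eta by rewrite lt_min ltr01 powR_gt0.
have etae : eta `^ r <= e.
  rewrite (@le_trans _ _ ((e `^ r^-1) `^ r))//; last by rewrite -powRrM mulVf ?gt_eqF// powRr1// ltW.
  by rewrite ge0_ler_powR ?nnegrE ?powR_ge0 ?(ltW r0) ?(ltW eta0)// ge_min lexx orbT.
have eta1 : eta <= 1 by rewrite ge_min lexx.
have [c c0 hc] := midgap_lt2 r1 r2 eta0 eta1.
exists (2 `^ r / c); first by rewrite divr_ge0 ?powR_ge0// ltW.
move=> z w; set M := Num.max (nk z) (nk w).
have M0 : 0 <= M by rewrite le_max nrm_ge0.
have Mr : M `^ r <= nk z `^ r + nk w `^ r.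
  by rewrite /M /Num.max; case: ifP => _; rewrite ?lerDl ?lerDr powR_ge0.
have [D|D] := leP (nk (z - w)) (eta * M).
  apply: (@le_trans _ _ (e * (nk z `^ r + nk w `^ r))).
    apply: (@le_trans _ _ ((eta * M) `^ r)).
      by rewrite ge0_ler_powR ?nnegrE ?nrm_ge0 ?mulr_ge0 ?(ltW r0) ?(ltW eta0).
    by rewrite powRM ?(ltW eta0)// ler_pM ?powR_ge0.
  by rewrite lerDl mulr_ge0 ?divr_ge0 ?powR_ge0// ltW.
apply: (@le_trans _ _ (2 `^ r / c * midgap r z w)); last first.
  by rewrite lerDr mulr_ge0 ?addr_ge0 ?powR_ge0// ltW.
rewrite -mulrA (@le_trans _ _ (2 `^ r * M `^ r))//.
  rewrite -powRM// ge0_ler_powR ?nnegrE ?nrm_ge0 ?mulr_ge0 ?(ltW r0)//.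
  rewrite (le_trans (nrmD _ _))// nrmN mulr2n mulrDl mul1r lerD// le_max lexx ?orbT//.
by rewrite ler_wpM2l ?powR_ge0// ler_pdivlMl// hc.
Qed.

End uniform_convexity.

(** * Closest points and separation in L_r *)

Section separation.
Context {d : measure_display} {T : measurableType d} {R : realType} {k : scalar_kind}.
Local Notation K := (scalars R k).
Local Notation nk := (@nrm R k K^o).
Variable mu : {measure set T -> \bar R}.
Local Notation intble F := (mu.-integrable setT (EFin \o F)).
Variables (r q : R) (r1 : 1 < r) (q1 : 1 < q).
Hypothesis rq : r^-1 + q^-1 = 1.
Let r0 : 0 < r. Proof. exact: lt_trans r1. Qed.
Let rn0 : r != 0. Proof. by rewrite gt_eqF. Qed.
Let q0 : 0 < q. Proof. exact: lt_trans q1. Qed.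
Notation L := (Lp mu r1 K^o).

Lemma conj_exponent : (r - 1) * q = r.
Proof.
have qn0 : q != 0 by rewrite gt_eqF.
have : r * q * (r^-1 + q^-1) = r * q by rewrite rq mulr1.
rewrite mulrDr [r * q * r^-1]mulrAC divff// mul1r mulfK//.
by rewrite mulrBl mul1r => <-; ring.
Qed.

Lemma J_mem (f : LpFun mu r1 K^o) : (J r \o f) \in LpFun_pred mu q1 (X := K^o).
Proof.
have mJ : strongly_measurable (J r \o f).
  by apply: (@sm_comp _ _ K^o K^o); [exact: J_continuous|exact: LpFun_sm].
apply/LpFun_memP; split=> //.
apply: eq_integrable (LpFun_intble f) => // t _ /=; congr EFin.
by rewrite nk_J// -powRrM conj_exponent.
Qed.

Definition Jfun (f : LpFun mu r1 K^o) : LpFun mu q1 K^o := MkLpFun (J_mem f).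

Lemma pairing_Jfun (f : LpFun mu r1 K^o) :
  pairing mu (Jfun f) f = nrm (Lp_class f) `^ r.
Proof.
rewrite LpFun_norm_powR; apply: eq_Rintegral => t _.
by rewrite [X in re X](_ : _ = J r (f t) * f t)// J_mul// ofRK.
Qed.

Let mean_gap (x y z g m : R) : m <= z -> x <= m + g -> y <= m + g -> (x + y) / 2 - z <= g.
Proof. lra. Qed.

(** A minimising sequence is Cauchy: the midpoint of two almost minimal
    points is again almost minimal, and uniform convexity turns this into a
    bound on their distance. *)
Lemma closest_point (W : set L) (z : L) : closed W -> W 0 ->
  (forall x y, W x -> W y -> W (x + y)) ->
  (forall (c : R) x, W x -> W (ofR c *: x)) ->
  exists2 w, W w & forall w', W w' -> nrm (z - w) <= nrm (z - w').
Proof.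
move=> cW W0 WD WZ.
pose D := [set nrm (z - w) | w in W]; pose m := inf D.
have infD : has_inf D.
  by split; [exists (nrm (z - 0)), 0|exists 0 => _ [w _ <-]; exact: nrm_ge0].
have mle w : W w -> m <= nrm (z - w).
  by move=> Ww; apply: ge_inf; [exact: infD.2|exists w].
have m0 : 0 <= m by apply: lb_le_inf; [exact: infD.1|move=> _ [w _ <-]; exact: nrm_ge0].
have near_inf e : 0 < e -> exists w, [/\ W w, nrm (z - w) < m + e &
    nrm (z - w) `^ r < m `^ r + e].
  move=> e0; have [dt dt0 h] := powR_continuous_ge0 r0 m0 e0.
  have ed0 : 0 < Num.min e dt by rewrite lt_min e0.
  have [_ [w Ww <-] wm] := inf_adherent ed0 infD; exists w; split=> //.
    by rewrite (lt_le_trans wm)// lerD2l ge_min lexx.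
  have := h (nrm (z - w)) (nrm_ge0 _); rewrite distrC ger0_norm ?subr_ge0 ?mle//.
  rewrite ltrBlDl (lt_le_trans wm) ?lerD2l ?ge_min ?lexx ?orbT// => /(_ isT).
  by rewrite ltr_distlC => /andP[].
have /choice[w hw] n : exists w, [/\ W w, nrm (z - w) < m + 2 ^- n &
    nrm (z - w) `^ r < m `^ r + 2 ^- n].
  by apply: near_inf; exact: exp2V_gt0.
pose a n := z - w n.
have mid n j : m `^ r <= (nrm (a n + a j) / 2) `^ r.
  rewrite ge0_ler_powR ?nnegrE ?divr_ge0 ?nrm_ge0 ?(ltW r0)//.
  rewrite ler_pdivlMr//.
  have -> : a n + a j = ofR 2 *: (z - ofR 2^-1 *: (w n + w j)).
    rewrite scalerBr scalerA -ofRM divff// ofR1 scale1r.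
    rewrite (_ : ofR 2 = 1 + 1) ?scalerDl ?scale1r; last by rewrite -ofR1 -ofRD.
    by rewrite /a opprD addrACA.
  rewrite nrm_ofRZ ger0_norm// mulrC ler_pM2l// mle// -[ofR _ *: _]addr0.
  by apply: (WD) => //; apply: WZ; apply: WD; [have [] := hw n|have [] := hw j].
have ca : nrm_cauchy a.
  move=> e e0.
  pose M := m `^ r + 1.
  have M0 : 0 < M by rewrite ltr_wpDl// powR_ge0.
  have er0 : 0 < e `^ r by exact: powR_gt0.
  have [|c c0 uc] := @uniform_convexity R k r (e `^ r / 4 / M) r1 _.
    by rewrite !divr_gt0.
  have c10 : 0 < c + 1 by rewrite ltr_wpDl.
  have [|N hN] := @exp2V_lt R (e `^ r / 2 / (c + 1)).
    by rewrite !divr_gt0.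
  exists N => n j Nn Nj.
  pose A := Lp_repr (a n); pose B := Lp_repr (a j).
  have IA := Lp_intble (a n); have IB := Lp_intble (a j).
  have IAB : intble (fun t => (nrm ((A + B) t) / 2) `^ r).
    have := intbleZ ((2^-1) `^ r) (LpFun_intble (A + B)).
    by apply: eq_integrable => // t _ /=; rewrite -powRM ?nrm_ge0 ?invr_ge0// mulrC.
  have nAB : \int[mu]_t (nrm ((A + B) t) / 2) `^ r = (nrm (a n + a j) / 2) `^ r.
    rewrite powRM ?nrm_ge0 ?invr_ge0// mulrC -[a n]Lp_reprK -[a j]Lp_reprK -linearD.
    rewrite LpFun_norm_powR -RintZ; last exact: LpFun_intble.
    by apply: eq_Rintegral => t _; rewrite mulrC powRM ?nrm_ge0 ?invr_ge0// mulrC.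
  have bnd n' : (N <= n')%N -> nrm (a n') `^ r <= m `^ r + e `^ r / 2 / (c + 1) /\ nrm (a n') `^ r <= M.
    move=> Nn'; have [_ _ /ltW h] := hw n'; split.
      by rewrite (le_trans h)// lerD2l ltW// hN.
    rewrite (le_trans h)// lerD2l invf_le1 ?exprn_gt0//.
    by rewrite exprn_ege1// ler1n.
  have igap : intble (fun t => midgap r (A t) (B t)).
    have i1 := intbleD (intbleZ 2^-1 (intbleD IA IB)) (intbleZ (-1) IAB).
    apply: eq_integrable i1 => // t _ /=; congr EFin.
    by rewrite /midgap mulN1r mulrC.
  have gapE : \int[mu]_t midgap r (A t) (B t) =
      (nrm (a n) `^ r + nrm (a j) `^ r) / 2 - (nrm (a n + a j) / 2) `^ r.
    rewrite -nAB !Lp_norm_powR -RintD// mulrC -RintZ; last exact: intbleD.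
    rewrite -mulN1r -RintZ// -RintD; [|exact/intbleZ/intbleD|exact: intbleZ].
    by apply: eq_Rintegral => t _; rewrite /midgap mulN1r mulrC.
  have [a1 a2] := bnd _ Nn; have [b1 b2] := bnd _ Nj.
  have key : nrm (a n - a j) `^ r <= e `^ r / 4 / M * (nrm (a n) `^ r + nrm (a j) `^ r)
       + c * ((nrm (a n) `^ r + nrm (a j) `^ r) / 2 - (nrm (a n + a j) / 2) `^ r).
    have -> : nrm (a n - a j) `^ r = \int[mu]_t (nrm ((A - B) t) `^ r).
      by rewrite -LpFun_norm_powR [in RHS]linearB /A /B /= !Lp_reprK.
    rewrite -gapE [in X in _ <= X + _]Lp_norm_powR [in X in _ <= _ * (_ + X) + _]Lp_norm_powR.
    rewrite -RintD// -!RintZ//; last exact: intbleD.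
    rewrite -RintD; [|exact/intbleZ/intbleD|exact: intbleZ].
    apply: le_Rint; first exact: LpFun_intble.
      by apply: intbleD; [exact/intbleZ/intbleD|exact: intbleZ].
    by move=> t; exact: uc.
  have lt : nrm (a n - a j) `^ r < e `^ r.
    apply: le_lt_trans key _.
    have h1 : e `^ r / 4 / M * (nrm (a n) `^ r + nrm (a j) `^ r) <= e `^ r / 2.
      have -> : e `^ r / 2 = e `^ r / 4 / M * (M + M).
        by move: M0 => /lt0r_neq0 ?; field.
      apply: ler_wpM2l; last exact: lerD.
      by rewrite mulr_ge0 ?invr_ge0 ?(ltW M0) ?divr_ge0 ?powR_ge0.
    have h2 : c * ((nrm (a n) `^ r + nrm (a j) `^ r) / 2 - (nrm (a n + a j) / 2) `^ r) < e `^ r / 2.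
      have h3 : (nrm (a n) `^ r + nrm (a j) `^ r) / 2 - (nrm (a n + a j) / 2) `^ r
          <= e `^ r / 2 / (c + 1) by exact: mean_gap (mid n j) a1 b1.
      apply: le_lt_trans (ler_wpM2l c0 h3) _.
      by rewrite mulrCA gtr_pMr ?divr_gt0// ltr_pdivrMr// mul1r ltrDl.
    by rewrite [ltRHS](splitr (e `^ r)) ler_ltD.
  rewrite ltNge; apply/negP => h2; move: lt; apply/negP; rewrite -leNgt.
  by apply: ge0_ler_powR h2; rewrite ?nnegrE ?nrm_ge0// ltW.
have [l al] := Lp_seq_complete (@scalar_seq_complete R k) ca.
have lm : nrm l <= m.
  apply/ler_addgt0Pr => e e0; have e20 : 0 < e / 2 by rewrite divr_gt0.
  have [N hN] := exp2V_lt e20; move/nrm_cvgP : al => /(_ _ e20)[N' _ hN'].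
  have h1 := hN (maxn N N') (leq_maxl _ _).
  have h2 := hN' (maxn N N') (leq_maxr _ _).
  have [_ /ltW h3 _] := hw (maxn N N').
  rewrite -(subrK (a (maxn N N')) l) (le_trans (nrmD _ _))//.
  by rewrite (splitr e) addrC addrA lerD ?(ltW h2)// (le_trans h3)// lerD2l ltW.
exists (z - l); last by move=> w' /mle; rewrite subKr; exact: le_trans.
apply: cW; apply/closure_nrmP => e e0.
move/nrm_cvgP : al => /(_ _ e0)[N _ hN]; exists (w N); first by have [] := hw N.
rewrite (_ : z - l - w N = - (l - a N)) ?nrmN; first exact: hN (leqnn _).
by rewrite /a !opprB [in RHS]addrAC.
Qed.

(** The first variation of the norm: the tangent inequality of the convex
    function [|.| ^ r] at [a + c h] gives [0 <= <J (a + c h), h>] for [c >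
    0], and [c] tends to 0 by dominated convergence. *)
Lemma closest_point_orthogonal (a h : LpFun mu r1 K^o) :
  (forall c : R, nrm (Lp_class a) <= nrm (Lp_class (a + ofR c *: h))) ->
  pairing mu (Jfun a) h = 0.
Proof.
have qr : q^-1 + r^-1 = 1 by rewrite addrC.
suff key (h' : LpFun mu r1 K^o) :
    (forall c : R, nrm (Lp_class a) <= nrm (Lp_class (a + ofR c *: h'))) ->
    0 <= pairing mu (Jfun a) h'.
  move=> min; apply/eqP; rewrite eq_le key// andbT.
  have := key (ofR (-1) *: h); rewrite (pairing_ofRZ qr).
  rewrite mulN1r oppr_ge0; apply => c; rewrite scalerA -ofRM; exact: min.
move=> min; pose c n : R := 2 ^- n.
pose b n : LpFun mu r1 K^o := a + ofR (c n) *: h'.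
have bE n t : b n t = a t + ofR (c n) * h' t by [].
have pb n : 0 <= pairing mu (Jfun (b n)) h'.
  have ib := intble_re_mul qr (Jfun (b n)) h'.
  have cn0 : 0 < c n by exact: exp2V_gt0.
  have tangent t : r * c n * - re (J r (b n t) * h' t) <=
      nrm (a t) `^ r - nrm (b n t) `^ r.
    have h1 : re (J r (b n t) * a t) <= nrm (b n t) `^ (r - 1) * nrm (a t).
      by rewrite -nk_J// -nkM; exact: re_le_nk.
    have h2 := powR_tangent r1 (@nrm_ge0 R k K^o (a t)) (@nrm_ge0 R k K^o (b n t)).
    have h3 : re (J r (b n t) * b n t) = nrm (b n t) `^ r by rewrite J_mul// ofRK.
    have h4 : re (J r (b n t) * b n t) = re (J r (b n t) * a t) + c n * re (J r (b n t) * h' t).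
      by rewrite {2}bE mulrDr reD mulrCA re_ofRM.
    have h5 : nrm (b n t) * nrm (b n t) `^ (r - 1) = nrm (b n t) `^ r by rewrite mulr_powRB1// nrm_ge0.
    have h6 : 0 <= r * (nrm (b n t) `^ (r - 1) * nrm (a t) - re (J r (b n t) * a t)).
      by rewrite mulr_ge0 ?(ltW r0)// subr_ge0.
    have h7 := congr1 ( *%R r) h4; have h8 := congr1 ( *%R r) h3; have h9 := congr1 ( *%R r) h5.
    move: h2 h6 h7 h8 h9 {h1 h3 h4 h5}.
    set P := nrm (b n t) `^ (r - 1); set Q := nrm (b n t) `^ r; set V := nrm (a t) `^ r.
    set w := re (J r _ * b n t); set y := re (J r _ * a t); set x := re (J r _ * h' t).
    lra.
  have : \int[mu]_t (r * c n * - re (J r (b n t) * h' t)) <=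
      \int[mu]_t (nrm (a t) `^ r - nrm (b n t) `^ r).
    apply: le_Rint => //.
      apply: eq_integrable (intbleZ (- (r * c n)) ib) => // t _ /=.
      by rewrite mulrN mulNr.
    have := intbleD (LpFun_intble a) (intbleZ (-1) (LpFun_intble (b n))).
    by apply: eq_integrable => // t _; rewrite /= mulN1r.
  rewrite (_ : Rintegral _ _ _ = - (r * c n) * pairing mu (Jfun (b n)) h'); last first.
    by rewrite /pairing -RintZ//; apply: eq_Rintegral => t _; rewrite mulrN mulNr.
  rewrite (_ : \int[mu]_t (_ - _) = nrm (Lp_class a) `^ r - nrm (Lp_class (b n)) `^ r); last first.
    rewrite !LpFun_norm_powR -[in RHS]mulN1r -RintZ; last exact: LpFun_intble.
    rewrite -RintD; [|exact: LpFun_intble|exact/intbleZ/LpFun_intble].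
    by apply: eq_Rintegral => t _; rewrite mulN1r.
  have : nrm (Lp_class a) `^ r <= nrm (Lp_class (b n)) `^ r.
    by apply: ge0_ler_powR (min (c n)); rewrite ?nnegrE ?nrm_ge0// ltW.
  move=> h1 h2; have : - (r * c n) * pairing mu (Jfun (b n)) h' <= 0.
    by apply: le_trans h2 _; rewrite subr_le0.
  by rewrite mulNr oppr_le0 pmulr_rge0// mulr_gt0.
pose F n t := re (J r (b n t) * h' t) - re (J r (a t) * h' t).
have ia := intble_re_mul qr (Jfun a) h'.
have iF n : intble (F n).
  have := intbleD (intble_re_mul qr (Jfun (b n)) h') (intbleZ (-1) ia).
  by apply: eq_integrable => // t _; rewrite /= mulN1r.
have F0 : \int[mu]_t F n t @[n --> \oo] --> (0 : R).
  apply: (@dominated_cvg0 _ _ _ mu F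
      (fun t => 2 * (2 `^ r * (nrm (a t) `^ r + nrm (h' t) `^ r)))).
  - by move=> n; exact: intble_measurable.
  - move=> n t; pose S := nrm (a t) + nrm (h' t).
    have S0 : 0 <= S by rewrite addr_ge0 ?nrm_ge0.
    have hS : nrm (h' t) <= S by rewrite lerDr nrm_ge0.
    have JS y : nrm y <= S -> nrm (J r y * h' t) <= S `^ r.
      move=> yS; rewrite nkM nk_J// -(mulr_powRB1 S0 r0) mulrC.
      rewrite ler_pM ?nrm_ge0 ?powR_ge0// ge0_ler_powR ?nnegrE ?nrm_ge0//.
      by rewrite subr_ge0 ltW.
    rewrite (@le_trans _ _ (S `^ r + S `^ r))//; last first.
      by rewrite -mulr2n -[_ *+ 2]mulr_natl ler_wpM2l// powR_add_le ?nrm_ge0// ltW.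
    rewrite (le_trans (ler_normB _ _))// lerD//.
      rewrite (le_trans (norm_re_le _))// JS// bE (le_trans (nrmD _ _))// lerD2l.
      rewrite nkM nk_ofR ger0_norm ?ler_piMl ?nrm_ge0//.
        by rewrite invf_le1 ?exprn_gt0// exprn_ege1// ler1n.
      by rewrite ltW// exp2V_gt0.
    by rewrite (le_trans (norm_re_le _))// JS// lerDl nrm_ge0.
  - by apply: intbleZ; apply: intbleZ; apply: intbleD; exact: LpFun_intble.
  - move=> t; pose g (y : K^o) : R := re (J r y * h' t).
    have cg : continuous g.
      move=> y; apply: (@continuous_comp K^o K^o R (fun y => J r y * h' t)); last exact: re_continuous.
      by apply: (@cvgM K _ (nbhs (y : K^o))); [exact: J_continuous|exact: cvg_cst].
    have bd n : nrm (a t - b n t) = c n * nrm (h' t).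
      rewrite bE opprD addNKr nrmN nkM nk_ofR ger0_norm//.
      by rewrite ltW// exp2V_gt0.
    have bt : b n t @[n --> \oo] --> (a t : K^o).
      apply/(@nrm_cvgP R k K^o) => e e0.
      have [|N hN] := @exp2V_lt R (e / (nrm (h' t) + 1)).
        by rewrite divr_gt0// ltr_wpDl// nrm_ge0.
      exists N => // n /hN; rewrite ltr_pdivlMr ?ltr_wpDl ?nrm_ge0//.
      apply: le_lt_trans; rewrite -[X in X <= _]/(nrm (a t - b n t)) bd.
      by rewrite ler_wpM2l ?(ltW (exp2V_gt0 _))// lerDl.
    rewrite -(subrr (g (a t))); apply: cvgB; last exact: cvg_cst.
    exact: (continuous_cvg _ (cg _) bt).
have FE n : \int[mu]_t F n t = pairing mu (Jfun (b n)) h' - pairing mu (Jfun a) h'.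
  rewrite -[in RHS]mulN1r -RintZ// -RintD; [|exact: intble_re_mul|exact: intbleZ].
  by apply: eq_Rintegral => t _; rewrite mulN1r.
rewrite leNgt; apply/negP; rewrite -oppr_gt0 => h0.
have [N hN] := cvg0_lt h0 F0.
by have := hN N (leqnn N); have := pb N; rewrite FE; lra.
Qed.

(** Hahn-Banach separation made concrete: if [w] is the point of [W] closest
    to [z], the duality map sends [z - w] to a function of [L_q] that
    annihilates [W] but not [z - w]. *)
Lemma Lp_separation (W : set L) (z : L) : closed W -> W 0 ->
  (forall x y, W x -> W y -> W (x + y)) ->
  (forall (c : R) x, W x -> W (ofR c *: x)) -> ~ W z ->
  exists g : LpFun mu q1 K^o,
    (forall h, W h -> pairing mu g (Lp_repr h) = 0) /\ pairing mu g (Lp_repr z) <> 0.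
Proof.
move=> cW W0 WD WZ nWz.
have qr : q^-1 + r^-1 = 1 by rewrite addrC.
have [w Ww wmin] := @closest_point W z cW W0 WD WZ.
pose a := Lp_repr (z - w).
have orth h : W h -> pairing mu (Jfun a) (Lp_repr h) = 0.
  move=> Wh; apply: closest_point_orthogonal => c.
  have -> : Lp_class (a + ofR c *: Lp_repr h) = z - (w - ofR c *: h).
    by rewrite linearD linearZ/= !Lp_reprK opprB [RHS]addrCA [RHS]addrC.
  rewrite /a Lp_reprK; apply: wmin; apply: (WD) => //; rewrite -scaleNr.
  by rewrite -ofRN; exact: WZ.
exists (Jfun a); split=> // hz.
have az : z - w = 0.
  apply: nrm_eq0; apply: (@powR_eq0_eq0 _ _ r).
  rewrite -[z - w]Lp_reprK -pairing_Jfun -/a.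
  have <- : pairing mu (Jfun a) (a + Lp_repr w) = pairing mu (Jfun a) a.
    by rewrite (pairingDr qr) (orth _ Ww) addr0.
  rewrite -hz; apply: ae_eq_pairing; try exact: LpFun_sm; first exact: aeW.
  have := Lp_classK (a + Lp_repr w : LpFun mu r1 K^o).
  by rewrite linearD /a /= !Lp_reprK subrK; apply: filterS => t; exact: esym.
by apply: nWz; rewrite -(subrK w z) az add0r.
Qed.

End separation.

(** * Hahn-Banach extension under a partial gauge *)

Section hahn_banach.
Context {R : realType} {k : scalar_kind}.
Local Notation K := (scalars R k).
Variables (V : lmodType K) (P : V -> R -> Prop).
Implicit Types (v w : V) (a b c : R) (G : set (V * R)).

(** [P v c] reads: [v] is dominated, at cost [c]. The gauge may be infinite:
    only dominated vectors carry the extension. *)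
Hypothesis P0 : P 0 0.
Hypothesis PD : forall v w c e, P v c -> P w e -> P (v + w) (c + e).
Hypothesis PZ : forall l v c, 0 < l -> P v c -> P (ofR l *: v) (l * c).
Hypothesis PN : forall v c, P v c -> P (- v) c.

Definition real_linear_graph G :=
  [/\ G (0, 0), forall v a w b, G (v, a) -> G (w, b) -> G (v + w, a + b) &
      forall c v a, G (v, a) -> G (ofR c *: v, c * a)].

Definition dominated_graph G := forall v a, G (v, a) ->
  (exists c, P v c) /\ forall c, P v c -> a <= c.

Lemma dominated_scale w t : (exists c, P w c) -> exists c, P (ofR t *: w) c.
Proof.
move=> [c Pc]; have [t0|t0|->] := ltgtP t 0; last by exists 0; rewrite ofR0 scale0r.
  have s0 : 0 < - t by rewrite oppr_gt0.
  by exists (- t * c); have := PN (PZ s0 Pc); rewrite ofRN scaleNr opprK.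
by exists (t * c); apply: PZ.
Qed.

(** The value [al] at [w] has to satisfy [a - c <= al <= c' - a'] whenever
    [v - w] is dominated at cost [c] and [v' + w] at cost [c']; adding the
    two dominations shows that these constraints are compatible. *)
Lemma hahn_banach_step G w : real_linear_graph G -> dominated_graph G ->
  (exists c, P w c) -> exists2 H : set (V * R), G `<=` H &
    [/\ real_linear_graph H, dominated_graph H & exists a, H (w, a)].
Proof.
move=> [G0 GD GZ] domG [c0 Pw].
pose L := [set r | exists v a c, [/\ G (v, a), P (v - w) c & r = a - c]].
have LU v a c : G (v, a) -> P (v + w) c -> ubound L (c - a).
  move=> Gv Pv _ [v' [a' [c' [Gv' Pv' ->]]]].
  have [_ /(_ (c' + c))] := domG _ _ (GD _ _ _ _ Gv' Gv).
  have -> : v' + v = (v' - w) + (v + w) by rewrite addrACA addNr addr0.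
  by move=> /(_ (PD Pv' Pv)); lra.
have supL : has_sup L.
  split; last by exists (c0 - 0); apply: (LU 0) => //; rewrite add0r.
  by exists (0 - c0), 0, 0, c0; split=> //; rewrite sub0r; exact: PN.
pose al := sup L.
have up v a c : G (v, a) -> P (v + w) c -> a + al <= c.
  move=> Gv Pv; have : al <= c - a by apply: ge_sup; [exact: supL.1|exact: LU Gv Pv].
  by lra.
have down v a c : G (v, a) -> P (v - w) c -> a - al <= c.
  move=> Gv Pv; have : a - c <= al.
    by apply: (ub_le_sup supL.2); exists v, a, c.
  by lra.
pose H := [set z : V * R | exists v a t, [/\ G (v, a), z.1 = v + ofR t *: w & z.2 = a + t * al]].
exists H.
  by move=> [v a] Gv; exists v, a, 0; split; rewrite //= ?ofR0 ?scale0r ?mul0r addr0.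
split.
- split.
  + by exists 0, 0, 0; split; rewrite //= ?ofR0 ?scale0r ?mul0r addr0.
  + move=> v a v' a' [v1 [a1 [t1 [G1 /= -> ->]]]] [v2 [a2 [t2 [G2 /= -> ->]]]].
    exists (v1 + v2), (a1 + a2), (t1 + t2); split; first exact: GD.
      by rewrite /= ofRD scalerDl addrACA.
    by rewrite /= mulrDl addrACA.
  + move=> c v a [v1 [a1 [t1 [G1 /= -> ->]]]].
    exists (ofR c *: v1), (c * a1), (c * t1); split; first exact: GZ.
      by rewrite /= scalerDr scalerA ofRM.
    by rewrite /= mulrDr mulrA.
- move=> v a [v1 [a1 [t [G1 /= -> ->]]]]; split.
    have [[c1 P1] _] := domG _ _ G1; have [c2 P2] := dominated_scale t (ex_intro _ _ Pw).
    by exists (c1 + c2); exact: PD.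
  move=> c Pc; have [t0|t0|t0] := ltgtP t 0.
  + have s0 : 0 < - t^-1 by rewrite oppr_gt0 invr_lt0.
    have := down _ _ _ (GZ (- t^-1) _ _ G1) _ => /(_ (- t^-1 * c)).
    have -> : ofR (- t^-1) *: v1 - w = ofR (- t^-1) *: (v1 + ofR t *: w).
      rewrite scalerDr scalerA -ofRM mulNr mulVf ?lt_eqF//.
      by rewrite (ofRN 1) ofR1 scaleN1r.
    move=> /(_ (PZ s0 Pc)).
    have -> : - t^-1 * a1 - al = - t^-1 * (a1 + t * al).
      by have tn0 : t != 0 := ltr0_neq0 t0; field.
    by rewrite ler_pM2l.
  + have s0 : 0 < t^-1 by rewrite invr_gt0.
    have := up _ _ _ (GZ t^-1 _ _ G1) _ => /(_ (t^-1 * c)).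
    have -> : ofR t^-1 *: v1 + w = ofR t^-1 *: (v1 + ofR t *: w).
      by rewrite scalerDr scalerA -ofRM mulVf ?gt_eqF// ofR1 scale1r.
    move=> /(_ (PZ s0 Pc)).
    have -> : t^-1 * a1 + al = t^-1 * (a1 + t * al).
      by rewrite mulrDr mulrA mulVf ?gt_eqF// mul1r.
    by rewrite ler_pM2l.
  + move: Pc; rewrite t0 ofR0 scale0r mul0r !addr0 => Pc.
    by have [_] := domG _ _ G1; exact.
- by exists al, 0, 0, 1; split; rewrite //= ?ofR1 ?scale1r ?mul1r add0r.
Qed.

(** Zorn's lemma is applied to the sets whose union with the initial graph
    is good, so that the empty chain has the initial graph itself as a
    bound. *)
Lemma hahn_banach_graph G0 : real_linear_graph G0 -> dominated_graph G0 ->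
  exists2 G, G0 `<=` G & [/\ real_linear_graph G, dominated_graph G &
    forall v, (exists c, P v c) -> exists a, G (v, a)].
Proof.
move=> lG0 dG0.
pose good A := real_linear_graph (A `|` G0) /\ dominated_graph (A `|` G0).
have [|A [[lA dA] maxA]] := @Zorn_bigcup (V * R)%type good.
  move=> F Fgood Ftot; have [[X0 FX0]|F0] := pselect (exists X, F X); last first.
    rewrite /good bigcup0 ?set0U//.
    by move=> X FX; case: F0; exists X.
  pose U := \bigcup_(X in F) X `|` G0.
  have sub X : F X -> X `|` G0 `<=` U.
    by move=> FX z [Xz|Gz]; [left; exists X|right].
  have memU z : U z -> exists2 X, F X & (X `|` G0) z.
    by move=> [[X FX Xz]|Gz]; [exists X => //; left|exists X0 => //; right].
  have mem2 z z' : U z -> U z' -> exists2 X, F X & (X `|` G0) z /\ (X `|` G0) z'.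
    move=> /memU[X FX Xz] /memU[Y FY Yz]; have [XY|YX] := Ftot _ _ FX FY.
      by exists Y => //; split=> //; move: Xz => [/XY|]; [left|right].
    by exists X => //; split=> //; move: Yz => [/YX|]; [left|right].
  split; first split.
  - by right; case: lG0.
  - move=> v a w b Uv Uw; have [X FX [Xv Xw]] := mem2 _ _ Uv Uw.
    by apply: (sub X FX); have [[_ XD _] _] := Fgood _ FX; exact: XD.
  - move=> c v a /memU[X FX Xv]; apply: (sub X FX).
    by have [[_ _ XZ] _] := Fgood _ FX; exact: XZ.
  - by move=> v a /memU[X FX Xv]; have [_] := Fgood _ FX; exact.
exists (A `|` G0); first by move=> z; right.
split=> // w Pw; apply: contrapT => nw.
have [H AH [lH dH [a Ha]]] := hahn_banach_step lA dA Pw.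
apply: (maxA H).
  split; first by move=> z Az; apply: AH; left.
  by move=> HA; apply: nw; exists a; left; exact: HA.
rewrite /good; have -> : H `|` G0 = H by apply/setUidPl => z Gz; apply: AH; right.
by [].
Qed.

(** The value of [phi] at a vector that is not dominated is arbitrary, hence
    the restriction of additivity and homogeneity to dominated vectors. *)
Lemma hahn_banach G0 : real_linear_graph G0 -> dominated_graph G0 ->
  exists phi : V -> R, [/\ forall v a, G0 (v, a) -> phi v = a,
    forall v c, P v c -> phi v <= c,
    forall v w, (exists c, P v c) -> (exists c, P w c) -> phi (v + w) = phi v + phi w &
    forall c v, (exists c, P v c) -> phi (ofR c *: v) = c * phi v].
Proof.
move=> lG0 dG0; have [G G0G [[_ GD GZ] dG tG]] := hahn_banach_graph lG0 dG0.
have /choice[phi hphi] v : exists a, (exists c, P v c) -> G (v, a).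
  have [Pv|nP] := pselect (exists c, P v c); last by exists 0 => /nP.
  by have [a Ga] := tG _ Pv; exists a.
have uniq v a b : G (v, a) -> G (v, b) -> a = b.
  have le a' b' : G (v, a') -> G (v, b') -> a' <= b'.
    move=> Ga Gb; have := GD _ _ _ _ Ga (GZ (-1) _ _ Gb).
    rewrite (ofRN 1) ofR1 scaleN1r subrr => /dG[_ /(_ _ P0)]; lra.
  by move=> Ga Gb; apply/eqP; rewrite eq_le !le.
have domD v w : (exists c, P v c) -> (exists c, P w c) -> exists c, P (v + w) c.
  by move=> [c Pc] [e Pe]; exists (c + e); exact: PD.
exists phi; split.
- by move=> v a Gv; exact: (uniq _ _ _ (hphi v (dG _ _ (G0G _ Gv)).1) (G0G _ Gv)).
- by move=> v c Pc; have [|_] := dG v (phi v); [apply: hphi; exists c|exact].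
- by move=> v w Pv Pw; exact: (uniq _ _ _ (hphi _ (domD _ _ Pv Pw)) (GD _ _ _ _ (hphi _ Pv) (hphi _ Pw))).
- by move=> c v Pv; exact: (uniq _ _ _ (hphi _ (dominated_scale _ Pv)) (GZ _ _ _ (hphi _ Pv))).
Qed.

End hahn_banach.

(** * Riesz representation *)

Section riesz.
Context {d : measure_display} {T : measurableType d} {R : realType} {k : scalar_kind}.
Local Notation K := (scalars R k).
Variable mu : {measure set T -> \bar R}.
Variables (p q : R) (p1 : 1 < p) (q1 : 1 < q).
Hypothesis pq : p^-1 + q^-1 = 1.

Lemma pairing_classr (f : LpFun mu p1 K^o) (g : LpFun mu q1 K^o) :
  pairing mu f (Lp_repr (Lp_class g)) = pairing mu f g.
Proof.
by apply: ae_eq_pairing; try exact: LpFun_sm; [exact: aeW|exact: Lp_classK].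
Qed.

Lemma pairing_reprD (f : LpFun mu p1 K^o) (x y : Lp mu q1 K^o) :
  pairing mu f (Lp_repr (x + y)) = pairing mu f (Lp_repr x) + pairing mu f (Lp_repr y).
Proof.
rewrite -(pairingDr pq) -(pairing_classr f (Lp_repr x + Lp_repr y)).
by rewrite linearD /= !Lp_reprK.
Qed.

Lemma pairing_reprZ (f : LpFun mu p1 K^o) (a : K) (x : Lp mu q1 K^o) :
  pairing mu f (Lp_repr (a *: x)) = pairing mu (a *: f) (Lp_repr x).
Proof.
rewrite [RHS](_ : _ = pairing mu f (a *: Lp_repr x : LpFun mu q1 K^o)).
  by rewrite -(pairing_classr f (a *: Lp_repr x)) linearZ /= !Lp_reprK.
apply: eq_Rintegral => t _; set y := Lp_repr x t.
rewrite [in LHS](_ : _ * _ = a * f t * y)// [in RHS](_ : _ * _ = f t * (a * y))//.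
by rewrite mulrCA mulrA.
Qed.

Lemma pairing_repr_ofRZ (f : LpFun mu p1 K^o) (c : R) (x : Lp mu q1 K^o) :
  pairing mu f (Lp_repr (ofR c *: x)) = c * pairing mu f (Lp_repr x).
Proof.
rewrite -(pairing_ofRZ pq) -(pairing_classr f (ofR c *: Lp_repr x)).
by rewrite linearZ /= !Lp_reprK.
Qed.

(** Test against the image of [f] under the duality map. *)
Lemma pairing_eq0 (f : LpFun mu p1 K^o) :
  (forall y : Lp mu q1 K^o, pairing mu f (Lp_repr y) = 0) -> Lp_class f = 0.
Proof.
move=> h; apply: nrm_eq0; apply: (@powR_eq0_eq0 _ _ p).
rewrite -(pairing_Jfun q1 pq) pairingC -(h (Lp_class (Jfun q1 pq f))).
by rewrite pairing_classr.
Qed.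

(** A functional is determined by its kernel and one nonzero value;
    [Lp_separation] gives a function that annihilates the kernel but not a
    given point outside it. *)
Lemma Lp_riesz (psi : Lp mu q1 K^o -> R) (c : R) :
  (forall x y, psi (x + y) = psi x + psi y) ->
  (forall a x, psi (ofR a *: x) = a * psi x) ->
  (forall x, `|psi x| <= c * nrm x) ->
  exists f : LpFun mu p1 K^o, forall x, psi x = pairing mu f (Lp_repr x).
Proof.
move=> psiD psiZ psic.
have qp : q^-1 + p^-1 = 1 by rewrite addrC.
have psiN x : psi (- x) = - psi x by rewrite -scaleN1r -(ofR1 (k := k)) -ofRN psiZ mulN1r.
have psi0 : psi 0 = 0 by rewrite -(scale0r (0 : Lp mu q1 K^o)) -(@ofR0 R k) psiZ mul0r.
have [[z0 hz0]|h0] := pselect (exists z, psi z <> 0); last first.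
  exists 0 => x.
  have -> : psi x = 0 by apply: contrapT => hx; apply: h0; exists x.
  by have := pairing_repr_ofRZ 0 0 x; rewrite mul0r pairing_reprZ scaler0 => <-.
pose W := [set x | psi x = 0].
have cW : closed W.
  move=> x /closure_nrmP Wx; apply/eqP; rewrite -normr_eq0 eq_le normr_ge0 andbT.
  apply/ler_addgt0Pr => e e0; rewrite add0r.
  have c10 : 0 < `|c| + 1 by rewrite ltr_wpDl.
  have [y Wy xy] := Wx _ (divr_gt0 e0 c10).
  have -> : psi x = psi (x - y) by rewrite psiD psiN Wy subr0.
  apply: le_trans (psic _) _; rewrite ltr_pdivlMr// in xy.
  by have := ler_norm c; have := nrm_ge0 (x - y); nra.
have [g [gW gz]] := @Lp_separation _ _ _ _ mu _ _ q1 p1 qp W z0 cW psi0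
  (fun x y (Wx : psi x = 0) (Wy : psi y = 0) => etrans (psiD x y) (etrans (congr2 +%R Wx Wy) (addr0 0)))
  (fun a x (Wx : psi x = 0) => etrans (psiZ a x) (etrans (congr1 _ Wx) (mulr0 a))) hz0.
pose G := pairing mu g (Lp_repr z0).
have /eqP Gn0 : G <> 0 by [].
exists (ofR (psi z0 / G) *: g) => x.
move/eqP : hz0 => hz0.
have : pairing mu g (Lp_repr (x + ofR (- (psi x / psi z0)) *: z0)) = 0.
  by apply: gW; rewrite /W/= psiD psiZ mulNr divfK// subrr.
rewrite pairing_reprD pairing_repr_ofRZ -/G => /eqP; rewrite mulNr subr_eq0 => /eqP gx.
rewrite -pairing_reprZ pairing_repr_ofRZ gx; field.
by rewrite Gn0 hz0.
Qed.

End riesz.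

(** * Norms defined by bounded sets of linear forms *)

Section polar_space.
Context {R : realType} {k : scalar_kind}.
Local Notation K := (scalars R k).
Local Notation nk := (@nrm R k K^o).

(** The norm will be the supremum of the moduli of the forms in the set:
    boundedness makes it finite, and the multiples of the coordinate forms
    make it definite. *)
Record norming_set (n : nat) := NormingSet {
  forms :> set 'rV[K]_n ;
  forms_bounded : exists M : R, forall l, forms l -> forall j, nk (l 0 j) <= M ;
  forms_coord : exists2 c : R, 0 < c & forall j, forms (ofR c *: delta_mx 0 j) }.

Definition dot (n : nat) (v l : 'rV[K]_n) : K := \sum_j v 0 j * l 0 j.

Lemma dotD n (v w l : 'rV[K]_n) : dot (v + w) l = dot v l + dot w l.
Proof. by rewrite /dot -big_split; apply: eq_bigr => j _; rewrite mxE mulrDl. Qed.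

Lemma dotZ n (a : K) (v l : 'rV[K]_n) : dot (a *: v) l = a * dot v l.
Proof. by rewrite /dot mulr_sumr; apply: eq_bigr => j _; rewrite mxE mulrA. Qed.

Lemma dot_delta n (v : 'rV[K]_n) (a : K) j : dot v (a *: delta_mx 0 j) = a * v 0 j.
Proof.
rewrite /dot (bigD1 j)//= big1 ?addr0 => [|i ij]; first by rewrite !mxE !eqxx mulr1 mulrC.
by rewrite !mxE (negbTE ij) andbF !mulr0.
Qed.

Variables (n : nat) (A : norming_set n).
Implicit Types v w l : 'rV[K]_n.

(** The value 0 is added so that the set is never empty, in particular in
    dimension 0. *)
Definition polar_values v := [set x : R | x = 0 \/ exists2 l, forms A l & x = nk (dot v l)].
Definition polar v : R := sup (polar_values v).

Let values_sup v : has_sup (polar_values v).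
Proof.
split; first by exists 0; left.
have [M hM] := forms_bounded A.
exists (\sum_j nk (v 0 j) * `|M|) => _ [->|[l Al ->]].
  by apply: sumr_ge0 => j _; rewrite mulr_ge0 ?nrm_ge0.
apply: le_trans (@nrm_sum R k K^o _ _ _ _) _; apply: ler_sum => j _.
by rewrite nkM ler_wpM2l ?nrm_ge0// (le_trans (hM l Al j))// ler_norm.
Qed.

Lemma dot_le_polar v l : forms A l -> nk (dot v l) <= polar v.
Proof. by move=> Al; apply: (ub_le_sup (values_sup v).2); right; exists l. Qed.

Lemma polar_ge0 v : 0 <= polar v.
Proof. by apply: (ub_le_sup (values_sup v).2); left. Qed.

Lemma polar_le v (c : R) : 0 <= c -> (forall l, forms A l -> nk (dot v l) <= c) -> polar v <= c.
Proof.
move=> c0 h; apply: ge_sup; first exact: (values_sup v).1.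
by move=> _ [->//|[l Al ->]]; exact: h.
Qed.

Lemma polar_lower : exists2 c : R, 0 < c & forall v j, c * nk (v 0 j) <= polar v.
Proof.
have [c c0 hc] := forms_coord A; exists c => // v j.
by rewrite -[c in c * _]ger0_norm ?(ltW c0)// -(@nk_ofR R k) -nkM -dot_delta dot_le_polar.
Qed.

Lemma polar_upper : exists2 M : R, 0 < M & forall v, polar v <= M * \sum_j nk (v 0 j).
Proof.
have [M hM] := forms_bounded A; have M0 : 0 < `|M| + 1 by rewrite ltr_wpDl.
exists (`|M| + 1) => // v; apply: polar_le => [|l Al].
  by rewrite mulr_ge0 ?(ltW M0)// sumr_ge0// => j _; exact: nrm_ge0.
apply: le_trans (@nrm_sum R k K^o _ _ _ _) _; rewrite mulr_sumr; apply: ler_sum => j _.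
rewrite nkM mulrC ler_wpM2r ?nrm_ge0// (le_trans (hM l Al j))//.
by rewrite (le_trans (ler_norm _))// lerDl.
Qed.

Definition polar_space of norming_set n := 'rV[K]_n.
Local Notation PS := (polar_space A).
HB.instance Definition _ := GRing.Lmodule.on PS.

Let norm (v : PS) : K := ofR (polar v).

Let normD (v w : PS) : norm (v + w) <= norm v + norm w.
Proof.
rewrite /norm -ofRD ofR_le; apply: polar_le; first by rewrite addr_ge0 ?polar_ge0.
by move=> l Al; rewrite dotD (le_trans (@nrmD R k K^o _ _))// lerD ?dot_le_polar.
Qed.

Let polarZ_le (a : K) v : polar (a *: v) <= nk a * polar v.
Proof.
apply: polar_le => [|l Al]; first by rewrite mulr_ge0 ?nrm_ge0 ?polar_ge0.
by rewrite dotZ nkM ler_wpM2l ?nrm_ge0// dot_le_polar.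
Qed.

Let normZ (a : K) (v : PS) : norm (a *: v) = `|a| * norm v.
Proof.
rewrite -[`|a|](@nrmK R k K^o) -ofRM; congr ofR; apply/eqP; rewrite eq_le polarZ_le/=.
have [->|a0] := eqVneq a 0; first by rewrite nrm0 mul0r polar_ge0.
have na0 : 0 < nk a.
  by rewrite lt_neqAle nrm_ge0 andbT eq_sym; apply: contra_neq a0; exact: nrm_eq0.
rewrite -ler_pdivlMl// -nkV (le_trans _ (polarZ_le _ _))// scalerA mulVf//.
by rewrite scale1r.
Qed.

Let norm_eq0 (v : PS) : norm v = 0 -> v = 0.
Proof.
rewrite -(@ofR0 R k) => /ofR_inj v0; apply/rowP => j; rewrite mxE.
have [c c0 h] := polar_lower.
apply: (@nrm_eq0 R k K^o); apply/eqP; rewrite eq_le nrm_ge0 andbT.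
by have := h v j; rewrite v0 pmulr_rle0.
Qed.

HB.instance Definition _ :=
  @Lmodule_isNormed.Build K PS norm normD normZ norm_eq0.

Lemma polar_normE (v : PS) : nrm v = polar v.
Proof. exact: ofRK. Qed.

Lemma coord_continuous j : continuous ((fun v : PS => v 0 j) : PS -> K^o).
Proof.
move=> v; apply/(@nrm_cvgP R k K^o _ (nbhs (v : PS))) => e e0.
have [c c0 h] := polar_lower.
have /nrm_cvgP /(_ (c * e)) : id @ (v : PS) --> (v : PS) by exact: cvg_id.
rewrite mulr_gt0// => /(_ isT); apply: filterS => w vw.
have := h (v - w) j; rewrite !mxE => h'.
by rewrite -(ltr_pM2l c0) (le_lt_trans h')// -polar_normE.
Qed.

Lemma polar_space_complete : seq_complete PS.
Proof.
move=> u cu; have [c c0 hc] := polar_lower; have [M M0 hM] := polar_upper.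
have /choice[l hl] j : exists x : K^o, u m 0 j @[m --> \oo] --> x.
  apply: scalar_seq_complete => e e0.
  have [N hN] := cu _ (mulr_gt0 c0 e0); exists N => m m' Nm Nm'.
  rewrite -(ltr_pM2l c0) (le_lt_trans _ (hN m m' Nm Nm'))//.
  by have := hc (u m - u m') j; rewrite !mxE -polar_normE.
exists (\row_j l j); apply/nrm_cvgP => e e0.
have n0 : 0 < M * n.+1%:R by rewrite mulr_gt0.
have e1 : 0 < e / (M * n.+1%:R) by rewrite divr_gt0.
have : \forall m \near \oo, forall j, nk (l j - u m 0 j) < e / (M * n.+1%:R).
  by apply: filter_forall => j; have /(@nrm_cvgP R k K^o) := hl j; exact.
apply: filterS => m hm; rewrite polar_normE (le_lt_trans (hM _))//.
rewrite (@le_lt_trans _ _ (M * \sum_(j < n) e / (M * n.+1%:R)))//.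
  rewrite ler_wpM2l ?(ltW M0)// ler_sum// => j _; rewrite !mxE ltW//; exact: hm.
rewrite sumr_const card_ord -[_ *+ n]mulr_natr.
have -> : M * (e / (M * n.+1%:R) * n%:R) = e * (n%:R / n.+1%:R).
  have Mn0 := lt0r_neq0 M0; have : n.+1%:R != 0 :> R by rewrite pnatr_eq0.
  by move: (n.+1%:R) => x xn0; field; rewrite ?xn0 ?Mn0.
by rewrite gtr_pMr// ltr_pdivrMr// mul1r ltr_nat.
Qed.

Let polar_cauchy_cvg (F : set_system PS) : ProperFilter F -> cauchy F -> cvg F.
Proof. exact: (seq_complete_cauchy_cvg polar_space_complete). Qed.

HB.instance Definition _ := Uniform_isComplete.Build PS polar_cauchy_cvg.

Lemma polar_space_finite_dimensional : finite_dimensional PS.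
Proof.
exists n, (fun j => delta_mx 0 j) => v; exists (fun j => v 0 j).
exact: row_sum_delta.
Qed.

End polar_space.

(** * The estimate given by one finite dimensional space *)

Section key_estimate.
Context {d d' : measure_display} {T : measurableType d} {T' : measurableType d'}.
Context {R : realType} {k : scalar_kind}.
Local Notation K := (scalars R k).
Local Notation nk := (@nrm R k K^o).
Variables (mu : {measure set T -> \bar R}) (mu' : {measure set T' -> \bar R}).
Variables (p q : R) (p1 : 1 < p) (q1 : 1 < q).
Hypothesis pq : p^-1 + q^-1 = 1.
Let p0 : 0 < p. Proof. exact: lt_trans p1. Qed.
Let q0 : 0 < q. Proof. exact: lt_trans q1. Qed.

Section integrated_pairing.
Variables (n : nat) (A : @norming_set R k n) (xi : 'I_n -> LpFun mu' q1 K^o).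
Local Notation X := (polar_space A).

Lemma coord_mem (v : LpFun mu' p1 X) j :
  (fun t => (v t : 'rV_n) 0 j) \in LpFun_pred mu' p1 (X := K^o).
Proof.
have [c c0 hc] := polar_lower A.
have mv : strongly_measurable (fun t => (v t : 'rV_n) 0 j : K^o).
  by apply: (@sm_comp _ _ X K^o (fun v => v 0 j)); [exact: coord_continuous|exact: LpFun_sm].
apply: (LpFun_le (g := ofR c^-1 *: v)) => // t.
rewrite [X in _ <= X](@nrm_ofRZ R k X c^-1 (v t)) polar_normE.
by rewrite ger0_norm ?invr_ge0 ?(ltW c0)// ler_pdivlMl.
Qed.

Definition coord_fun (v : LpFun mu' p1 X) j : LpFun mu' p1 K^o := MkLpFun (coord_mem v j).

(** The pairing of [L_p(mu'; X)] with [sum_j xi_j e_j^*]. *)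
Definition vpairing (v : Lp mu' p1 X) : R :=
  \sum_j pairing mu' (xi j) (coord_fun (Lp_repr v) j).

Let qp : q^-1 + p^-1 = 1. Proof. by rewrite addrC. Qed.

Lemma vpairing_class (v : LpFun mu' p1 X) :
  vpairing (Lp_class v) = \sum_j pairing mu' (xi j) (coord_fun v j).
Proof.
apply: eq_bigr => j _; apply: ae_eq_pairing; try exact: LpFun_sm; first exact: aeW.
by apply: filterS (Lp_classK v) => t /= ->.
Qed.

Lemma vpairingD (v w : Lp mu' p1 X) : vpairing (v + w) = vpairing v + vpairing w.
Proof.
rewrite -[v]Lp_reprK -[w]Lp_reprK -linearD !vpairing_class -big_split.
apply: eq_bigr => j _; apply: etrans (pairingDr qp (xi j) (coord_fun (Lp_repr v) j) (coord_fun (Lp_repr w) j)).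
congr pairing.
by apply/funext => t; rewrite /= [LHS](_ : _ = (Lp_repr v t + Lp_repr w t : 'rV_n) 0 j)// mxE.
Qed.

Lemma vpairing0 : vpairing 0 = 0.
Proof. by apply: (addrI (vpairing 0)); rewrite -vpairingD !addr0. Qed.

Lemma vpairing_sum (I : Type) (r : seq I) (F : I -> Lp mu' p1 X) :
  vpairing (\sum_(i <- r) F i) = \sum_(i <- r) vpairing (F i).
Proof. exact: (big_morph vpairing vpairingD vpairing0). Qed.

Lemma vpairingN (v : Lp mu' p1 X) : vpairing (- v) = - vpairing v.
Proof. by apply: (addrI (vpairing v)); rewrite -vpairingD !subrr vpairing0. Qed.

Lemma vpairing_tens (f : Lp mu' p1 K^o) (x : X) :
  vpairing (tens f x) = \sum_j pairing mu' (xi j) (Lp_repr ((x : 'rV_n) 0 j *: f)).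
Proof.
rewrite vpairing_class; apply: eq_bigr => j _.
rewrite pairing_reprZ [RHS]pairingZ.
congr pairing; apply/funext => t /=.
by rewrite [LHS](_ : _ = (Lp_repr f t *: x : 'rV_n) 0 j)// mxE mulrC.
Qed.

(** Hoelder's inequality for this pairing: [beta] controls the polar norm from
    the dual side. *)
Lemma vpairing_le (beta : T' -> R) (B : R) (v : Lp mu' p1 X) :
  measurable_fun setT beta -> (forall t, 0 <= beta t) ->
  mu'.-integrable setT (EFin \o (fun t => beta t `^ q)) ->
  0 <= B -> \int[mu']_t (beta t `^ q) <= B `^ q ->
  (forall t (x : 'rV[K]_n), nk (\sum_j x 0 j * xi j t) <= beta t * polar A x) ->
  vpairing v <= B * nrm v.
Proof.
move=> mb b0 ib B0 bB hb.
have mv := measurable_nrm (LpFun_sm (Lp_repr v)).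
have [ibv hbv] := hoelder_bound B (nrm v) q0 p0 qp mb mv b0 (fun t => nrm_ge0 _) ib (Lp_intble v).
apply: le_trans (hbv B0 (nrm_ge0 _) bB _); last by rewrite Lp_norm_powR.
rewrite /vpairing /pairing -Rint_sum => [|j]; last exact: intble_re_mul.
apply: le_Rint => //; first by apply: intble_sum => j; exact: intble_re_mul.
move=> t; rewrite -re_sum (le_trans (re_le_nk _))// polar_normE.
rewrite (le_trans _ (hb t (Lp_repr v t)))// le_eqVlt; apply/orP; left; apply/eqP.
by congr nrm; apply: eq_bigr => j _; exact: mulrC.
Qed.

Variable Rp : closedSubspace (Lp mu' p1 K^o).
Hypothesis xiRp : forall j r, r \in Rp -> pairing mu' (xi j) (Lp_repr r) = 0.

(** A bounded functional that vanishes on the algebraic tensors vanishes on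
    their closure, so [vpairing] is defined on the quotient by [R_p(X)]. *)
Lemma vpairing_closure (C : R) : (forall v, vpairing v <= C * nrm v) ->
  forall v, v \in tensor_closure X Rp -> vpairing v = 0.
Proof.
move=> hC v /asboolP /closure_nrmP hv.
have y0 y : tensor_span Rp y -> vpairing y = 0.
  move=> [m [r [x ->]]]; rewrite vpairing_sum big1// => i _.
  rewrite vpairing_tens big1// => j _; apply: xiRp; apply: rpredZ.
  exact: (valP (r i)).
have C10 : 0 < `|C| + 1 by rewrite ltr_wpDl.
have le w : (w = v \/ w = - v) -> vpairing w <= 0.
  move=> wv; apply/ler_addgt0Pr => e e0; rewrite add0r.
  have [y /y0 hy vy] := hv _ (divr_gt0 e0 C10).
  have [z hz wz] : exists2 z, vpairing z = 0 & nrm (w - z) < e / (`|C| + 1).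
    case: wv => ->; first by exists y.
    by exists (- y); rewrite ?vpairingN ?hy ?oppr0// -opprD nrmN.
  have -> : vpairing w = vpairing (w - z) by rewrite vpairingD vpairingN hz subr0.
  apply: le_trans (hC _) _; rewrite ltr_pdivlMr// in wz.
  by have := ler_norm C; have := nrm_ge0 (w - z); nra.
apply/eqP; rewrite eq_le le/=; last by left.
by have := le (- v) (or_intror erefl); rewrite vpairingN oppr_le0.
Qed.

End integrated_pairing.

Variables (Sp : closedSubspace (Lp mu p1 K^o)) (Rp : closedSubspace (Lp mu' p1 K^o)).
Variables (u : {linear subspace_of Sp -> quotient_space Rp}) (C : R).
Hypothesis C0 : 0 <= C.
Hypothesis uX : forall X : completeNormedModType K, finite_dimensional X ->
  exists2 U : {linear subspace_of (tensor_closure X Sp) ->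
                      quotient_space (tensor_closure X Rp)},
    is_tensor_extension u U & opnorm U <= C.

Lemma opnorm_le (V W : normedModType K) (U : {linear V -> W}) x :
  bounded_op U -> nrm (U x) <= opnorm U * nrm x.
Proof.
move=> [c0 hc0]; have infU : has_inf [set c | op_bound U c].
  by split; [exists c0|exists 0 => c []].
apply/ler_addgt0Pr => e e0.
have [c [_ hc] cU] := inf_adherent (divr_gt0 e0 (ltr_wpDl (nrm_ge0 x) ltr01)) infU.
apply: le_trans (hc x) _.
rewrite (le_trans (ler_wpM2r (nrm_ge0 x) (ltW cU)))// mulrDl lerD2l.
have x1 : 0 < nrm x + 1 by rewrite ltr_wpDl ?nrm_ge0.
by rewrite mulrAC -mulrA ler_piMr ?(ltW e0)// ler_pdivrMr// mul1r lerDl.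
Qed.

Lemma quotient_lift (V : normedModType K) (W : closedSubspace V) (z : quotient_space W) e :
  0 < e -> exists2 v, quotient_map W v = z & nrm v < nrm z + e.
Proof.
move=> e0; rewrite quotient_normE.
have [|_ [v vz <-] ve] := @inf_adherent _ [set nrm v | v in [set v | quotient_map W v = z]] _ e0.
  split; first by exists (nrm (repr z)), (repr z) => //; exact: qpi_repr.
  by exists 0 => _ [v _ <-]; exact: nrm_ge0.
by exists v.
Qed.

(** The vector [sum_j s_j e_j] of [S_p(X)] has norm at most [a], because
    [alpha] dominates the pointwise norm. Its image in [Q_p(X)] lifts to a
    function of norm almost at most [C a], whose pairing with the [xi_j] is
    controlled by [beta]. The pairing does not depend on the lift, and on
    the lift [sum_j u(s_j) e_j] it is the left-hand side. *)
Lemma polar_estimate (n : nat) (A : @norming_set R k n) (s : 'I_n -> subspace_of Sp)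
    (xi : 'I_n -> LpFun mu' q1 K^o) (alpha : T -> R) (beta : T' -> R) (a b : R) :
  (forall j r, r \in Rp -> pairing mu' (xi j) (Lp_repr r) = 0) ->
  mu.-integrable setT (EFin \o alpha) -> \int[mu]_x alpha x <= a `^ p -> 0 <= a ->
  (forall x, polar A (\row_j Lp_repr (subspace_val (s j)) x) `^ p <= alpha x) ->
  measurable_fun setT beta -> (forall t, 0 <= beta t) ->
  mu'.-integrable setT (EFin \o (fun t => beta t `^ q)) ->
  0 <= b -> \int[mu']_t (beta t `^ q) <= b `^ q ->
  (forall t (x : 'rV[K]_n), nk (\sum_j x 0 j * xi j t) <= beta t * polar A x) ->
  \sum_j pairing mu' (xi j) (Lp_repr (repr (u (s j)))) <= C * (a * b).
Proof.
move=> xiRp ia aa a0 hA mb b0 ib bb0 bb hb.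
have [U [bU Ue] UC] := uX (polar_space_finite_dimensional A).
set X := polar_space A in U bU Ue UC.
pose e j : X := delta_mx 0 j.
pose f := \sum_j sub_tens (s j) (e j).
pose w : Lp mu' p1 X := \sum_j tens (repr (u (s j))) (e j).
have Uf : U f = quotient_map (tensor_closure X Rp) w.
  by rewrite !linear_sum; apply: eq_bigr => j _; rewrite Ue.
have vle v := vpairing_le v mb b0 ib bb0 bb hb.
have wE : vpairing xi w = \sum_j pairing mu' (xi j) (Lp_repr (repr (u (s j)))).
  rewrite vpairing_sum; apply: eq_bigr => j _; rewrite vpairing_tens (bigD1 j)//=.
  rewrite big1 => [|i ij]; first by rewrite !mxE !eqxx scale1r addr0.
  by rewrite !mxE (negbTE ij) andbF scale0r; apply: xiRp; exact: rpred0.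
have fa : nrm f <= a.
  rewrite subspace_normE.
  pose F : LpFun mu p1 X := \sum_j tens_fun (Lp_repr (subspace_val (s j))) (e j).
  have -> : subspace_val f = Lp_class F.
    rewrite [LHS](raddf_sum (val : subspace_of (tensor_closure X Sp) -> _)).
    by rewrite linear_sum.
  apply: (nrm_le_powR p1) => //; rewrite LpFun_norm_powR; apply: le_trans aa.
  apply: le_Rint => //; first exact: LpFun_intble.
  move=> x; apply: le_trans (hA x); rewrite polar_normE.
  rewrite le_eqVlt; apply/orP; left; apply/eqP; congr (polar A _ `^ p).
  rewrite [LHS](_ : _ = \sum_j Lp_repr (subspace_val (s j)) x *: e j :> 'rV[K]_n).
    by rewrite [RHS]row_sum_delta; apply: eq_bigr => j _; rewrite mxE.
  rewrite /F; elim/big_rec2: _ => // j y1 y2 _ <-.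
  by [].
rewrite -wE; apply/ler_addgt0Pr => h h0.
have b10 : 0 < b + 1 by rewrite ltr_wpDl.
have [v vU vn] := quotient_lift (U f) (divr_gt0 h0 b10).
have -> : vpairing xi w = vpairing xi v.
  apply/eqP; rewrite -subr_eq0 -vpairingN -vpairingD; apply/eqP.
  apply: (vpairing_closure xiRp vle); apply/qpiP; rewrite -[LHS]/(quotient_map _ w) -Uf -vU.
  by [].
apply: le_trans (vle v) _.
have Ufn : nrm (U f) <= C * a.
  apply: le_trans (opnorm_le f bU) _.
  apply: le_trans (ler_wpM2r (nrm_ge0 _) UC) _.
  by rewrite ler_wpM2l.
rewrite (le_trans (ler_wpM2l bb0 (ltW vn)))// mulrDr lerD//.
  by rewrite mulrA [X in _ <= X]mulrC ler_wpM2l.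
by rewrite mulrCA ler_piMr ?(ltW h0)// ler_pdivrMr// mul1r lerDl.
Qed.

End key_estimate.

(** * Selecting an index of maximum *)

Section maxima.
Context {R : realType} (n : nat).
Implicit Types g : 'I_n -> R.
Local Notation maxf g := (\big[Num.max/0]_i g i).

(** Taking the first index makes the events for different indices disjoint,
    and the strict inequality excludes the case where the maximum is 0. *)
Definition first_max g (i : 'I_n) : bool :=
  (maxf g <= g i) && (\big[Num.max/0]_(j : 'I_n | (j < i)%N) g j < maxf g).

Lemma first_max_val g i : first_max g i -> g i = maxf g.
Proof. by move=> /andP[h _]; apply/eqP; rewrite eq_le h le_bigmax. Qed.

Lemma first_max_uniq g i j : first_max g i -> first_max g j -> i = j.
Proof.
have lt i' j' : first_max g i' -> first_max g j' -> ~ (i' < j')%N.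
  move=> /first_max_val gi /andP[_ h] ij; move: h; apply/negP; rewrite -leNgt -gi.
  exact: le_bigmax_cond.
move=> fi fj; apply/val_inj; have [ij|ji|//] := ltngtP i j.
  by case: (lt _ _ fi fj).
by case: (lt _ _ fj fi).
Qed.

Lemma first_max_exists g : (forall i, 0 <= g i) -> 0 < maxf g -> exists i, first_max g i.
Proof.
move=> g0 gp.
have [j0 _] : exists2 j : 'I_n, true & 0 < g j.
  apply: contrapT => h; move: gp; apply/negP; rewrite -leNgt; apply/bigmax_leP; split=> // j _.
  by rewrite leNgt; apply/negP => gj; apply: h; exists j.
have [i _ hi] := @eq_bigmax _ _ _ (0 : R) j0 predT g isT (fun i _ => g0 i).
have ex : exists m, [exists i' : 'I_n, (i' == m :> nat) && (maxf g <= g i')].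
  by exists i; apply/existsP; exists i; rewrite eqxx hi lexx.
case: (ex_minnP ex) => m /existsP[i' /andP[/eqP im gi']] minm.
exists i'; rewrite /first_max gi'/=; apply/bigmax_ltP; split=> // j ji.
rewrite ltNge; apply/negP => gj; have := minm j; rewrite leqNgt -im ji.
by move=> /(_ _) /negP; apply => //; apply/existsP; exists j; rewrite eqxx.
Qed.

Lemma sum_first_max g (F : 'I_n -> R) c : (forall i, 0 <= g i) ->
  (forall i, first_max g i -> F i = c) -> (maxf g = 0 -> c = 0) ->
  \sum_i (if first_max g i then F i else 0) = c.
Proof.
move=> g0 Fc c0; have [M0|Mn0] := eqVneq (maxf g) 0.
  rewrite c0// big1// => i _; case: ifP => // /Fc ->; exact: c0.
have [|i fi] := first_max_exists g0.
  by rewrite lt_neqAle eq_sym Mn0 bigmax_ge_id.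
rewrite (bigD1 i)//= fi Fc// big1 ?addr0// => j ji; case: ifP => // fj.
by move/eqP : ji; case; exact: first_max_uniq fj fi.
Qed.

Lemma measurable_bigmax d (T : measurableType d) (F : 'I_n -> T -> R) (P : pred 'I_n) :
  (forall i, measurable_fun setT (F i)) ->
  measurable_fun setT (fun t => \big[Num.max/0]_(i | P i) F i t).
Proof.
move=> mF; elim: (index_enum _) => [|i r ih].
  by under eq_fun do rewrite big_nil; exact: measurable_cst.
under eq_fun do rewrite big_cons; case: (P i) => //.
exact: measurable_maxr.
Qed.

End maxima.

(** * Kernels dominated by products of densities *)

Section dominated_tensors.
Context {d d' : measure_display} {T : measurableType d} {T' : measurableType d'}.
Context {R : realType} {k : scalar_kind}.
Local Notation K := (scalars R k).
Local Notation nk := (@nrm R k K^o).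
Variables (mu : {measure set T -> \bar R}) (mu' : {measure set T' -> \bar R}).
Variables (p q : R) (p1 : 1 < p) (q1 : 1 < q).
Hypothesis pq : p^-1 + q^-1 = 1.
Let p0 : 0 < p. Proof. exact: lt_trans p1. Qed.
Let q0 : 0 < q. Proof. exact: lt_trans q1. Qed.
Let pn0 : p != 0. Proof. by rewrite gt_eqF. Qed.
Let qn0 : q != 0. Proof. by rewrite gt_eqF. Qed.
Let qp : q^-1 + p^-1 = 1. Proof. by rewrite addrC. Qed.

Lemma powR_conj (m : R) : 0 <= m -> m `^ p^-1 * m `^ q^-1 = m.
Proof.
by move=> m0; rewrite -powRD ?pq ?powRr1// oner_eq0.
Qed.

Lemma powRK (r x : R) : r != 0 -> 0 <= x -> (x `^ r) `^ r^-1 = x.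
Proof. by move=> r0 x0; rewrite -powRrM divff// powRr1. Qed.

Lemma powRVK (r x : R) : r != 0 -> 0 <= x -> (x `^ r^-1) `^ r = x.
Proof. by move=> r0 x0; rewrite -powRrM mulVf// powRr1. Qed.

Definition density (dd : measure_display) (S : measurableType dd)
    (nu : {measure set S -> \bar R}) (a : S -> R) (m : R) :=
  [/\ nu.-integrable setT (EFin \o a), forall x, 0 <= a x & \int[nu]_x a x <= m].

Lemma densityD dd (S : measurableType dd) (nu : {measure set S -> \bar R}) a a' m m' :
  density nu a m -> density nu a' m' -> density nu (fun x => a x + a' x) (m + m').
Proof.
move=> [ia a0 am] [ia' a0' am']; split; [exact: intbleD|by move=> x; exact: addr_ge0|].
by rewrite RintD// lerD.
Qed.

Lemma densityZ dd (S : measurableType dd) (nu : {measure set S -> \bar R}) a m l :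
  0 <= l -> density nu a m -> density nu (fun x => l * a x) (l * m).
Proof.
move=> l0 [ia a0 am]; split; [exact: intbleZ|by move=> x; exact: mulr_ge0|].
by rewrite RintZ// ler_wpM2l.
Qed.

Lemma density_ge0 dd (S : measurableType dd) (nu : {measure set S -> \bar R}) a m :
  density nu a m -> 0 <= m.
Proof. by move=> [_ a0 am]; apply: le_trans am; exact: ge0_Rint. Qed.

Lemma density_Lp (f : LpFun mu p1 K^o) :
  density mu (fun x => nk (f x) `^ p) (nrm (Lp_class f) `^ p).
Proof.
by split; [exact: LpFun_intble|move=> x; exact: powR_ge0|rewrite LpFun_norm_powR].
Qed.

Definition dominates (a : T -> R) (b : T' -> R) (w : T -> T' -> K^o) :=
  forall x t, nk (w x t) <= a x `^ p^-1 * b t `^ q^-1.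

Variables (Sp : closedSubspace (Lp mu p1 K^o)) (Rp : closedSubspace (Lp mu' p1 K^o)).
Variables (u : {linear subspace_of Sp -> quotient_space Rp}) (C : R).
Hypothesis C0 : 0 < C.
Hypothesis uX : forall X : completeNormedModType K, finite_dimensional X ->
  exists2 U : {linear subspace_of (tensor_closure X Sp) ->
                      quotient_space (tensor_closure X Rp)},
    is_tensor_extension u U & opnorm U <= C.

Local Notation perp xi := (forall r, r \in Rp -> pairing mu' xi (Lp_repr r) = 0).

(** The hypothesis on [u] is used for one space only: [K ^ n] with the norm
    whose unit ball is polar to the vectors [(xi_j t)_j], divided by the
    [q]-th root of [b t]. By domination [(s_j x)_j] then has norm at most
    the [p]-th root of [a x]. Adding [e] times the powers of the [s_j] and
    [xi_j] to [a] and [b] makes the norm finite and definite; then [e] tends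
    to 0. *)
Lemma dominated_estimate (n : nat) (s : 'I_n -> subspace_of Sp)
    (xi : 'I_n -> LpFun mu' q1 K^o) a b m :
  (forall j, perp (xi j)) -> density mu a m -> density mu' b m ->
  dominates a b (fun x t => \sum_j Lp_repr (subspace_val (s j)) x * xi j t) ->
  \sum_j pairing mu' (xi j) (Lp_repr (repr (u (s j)))) <= C * m.
Proof.
move=> xiRp da db dom.
pose f j := Lp_repr (subspace_val (s j)).
pose M := \sum_j nrm (Lp_class (f j)) `^ p + \sum_j nrm (Lp_class (xi j)) `^ q.
have M0 : 0 <= M by rewrite addr_ge0// sumr_ge0// => j _; exact: powR_ge0.
have m0 := density_ge0 da.
suff key e : 0 < e ->
    \sum_j pairing mu' (xi j) (Lp_repr (repr (u (s j)))) <= C * (m + e * M).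
  apply/ler_addgt0Pr => e e0.
  have CM : 0 < C * M + 1 by rewrite ltr_wpDl// mulr_ge0// ltW.
  have /key := divr_gt0 e0 CM; move/le_trans; apply.
  rewrite mulrDr lerD2l mulrCA mulrA mulrAC -mulrA mulrAC -mulrA.
  by rewrite ler_piMr ?(ltW e0)// ler_pdivrMr// mul1r mulrC lerDl.
move=> e0; have [ia a0 am] := da; have [ib b0 bm] := db.
(* The perturbed densities: strictly positive where some s_j or xi_j is nonzero. *)
pose a' x := a x + e * \sum_j nk (f j x) `^ p.
pose b' t := b t + e * \sum_j nk (xi j t) `^ q.
have mM : 0 <= m + e * M by rewrite addr_ge0// mulr_ge0// ltW.
have sf x : 0 <= \sum_j nk (f j x) `^ p by rewrite sumr_ge0// => j _; exact: powR_ge0.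
have sxi t : 0 <= \sum_j nk (xi j t) `^ q by rewrite sumr_ge0// => j _; exact: powR_ge0.
have if' : mu.-integrable setT (EFin \o (fun x => \sum_j nk (f j x) `^ p)).
  by apply: intble_sum => j; exact: LpFun_intble.
have ixi : mu'.-integrable setT (EFin \o (fun t => \sum_j nk (xi j t) `^ q)).
  by apply: intble_sum => j; exact: LpFun_intble.
have [ia' a0' am'] : density mu a' (m + e * M).
  split; first by apply: intbleD => //; exact: intbleZ.
    by move=> x; rewrite addr_ge0// mulr_ge0// ltW.
  rewrite RintD//; last exact: intbleZ.
  rewrite lerD// RintZ// ler_wpM2l ?(ltW e0)//.
  rewrite Rint_sum => [|j]; last exact: LpFun_intble.
  rewrite /M (eq_bigr (fun j => nrm (Lp_class (f j)) `^ p)) => [|j _].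
    by rewrite lerDl sumr_ge0// => j _; exact: powR_ge0.
  by rewrite LpFun_norm_powR.
have [ib' b0' bm'] : density mu' b' (m + e * M).
  split; first by apply: intbleD => //; exact: intbleZ.
    by move=> x; rewrite addr_ge0// mulr_ge0// ltW.
  rewrite RintD//; last exact: intbleZ.
  rewrite lerD// RintZ// ler_wpM2l ?(ltW e0)//.
  rewrite Rint_sum => [|j]; last exact: LpFun_intble.
  rewrite /M (eq_bigr (fun j => nrm (Lp_class (xi j)) `^ q)) => [|j _].
    by rewrite lerDr sumr_ge0// => j _; exact: powR_ge0.
  by rewrite LpFun_norm_powR.
(* Where beta vanishes all xi_j vanish, so that the inverse of 0 does no harm. *)
pose beta t := b' t `^ q^-1.
have beta0 t : 0 <= beta t by exact: powR_ge0.
have single (r : R) (I : finType) (F : I -> R) j : 0 < r -> (forall i, 0 <= F i) ->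
    F j <= (\sum_i F i `^ r) `^ r^-1.
  move=> r0 F0; rewrite -{1}(@powRK r (F j)) ?gt_eqF//.
  rewrite ge0_ler_powR ?nnegrE ?invr_ge0 ?(ltW r0) ?powR_ge0//.
    by rewrite sumr_ge0// => i _; exact: powR_ge0.
  by rewrite (bigD1 j)//= lerDl sumr_ge0// => i _; exact: powR_ge0.
have xib j t : e `^ q^-1 * nk (xi j t) <= beta t.
  rewrite (@le_trans _ _ ((e * \sum_j nk (xi j t) `^ q) `^ q^-1))//.
    by rewrite powRM ?(ltW e0)// ler_wpM2l ?powR_ge0// (single q _ (fun j => nk (xi j t)))// => i; exact: nrm_ge0.
  rewrite ge0_ler_powR ?nnegrE ?invr_ge0 ?(ltW q0) ?mulr_ge0 ?(ltW e0)//.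
  by rewrite lerDr.
have eq0 : 0 < e `^ q^-1 by exact: powR_gt0.
pose forms := [set l : 'rV[K]_n | (exists t, l = \row_j (ofR (beta t)^-1 * xi j t)) \/
   exists j, l = ofR (e `^ p^-1) *: delta_mx 0 j].
have forms_bounded : exists M : R, forall l, forms l -> forall j, nk (l 0 j) <= M.
  exists ((e `^ q^-1)^-1 + e `^ p^-1) => l [[t ->]|[i ->]] j; rewrite !mxE nkM nk_ofR.
    rewrite ger0_norm ?invr_ge0// (@le_trans _ _ (e `^ q^-1)^-1)//; last first.
      by rewrite lerDl powR_ge0.
    have [->|bn0] := eqVneq (beta t) 0; first by rewrite invr0 mul0r invr_ge0 ltW.
    have bp : 0 < beta t by rewrite lt_neqAle eq_sym bn0 beta0.
    by rewrite ler_pdivrMl// ler_pdivlMr// mulrC.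
  rewrite ger0_norm ?powR_ge0// (@le_trans _ _ (e `^ p^-1))//.
    by rewrite eqxx/=; case: (_ == _); rewrite ?nk1 ?nrm0 ?mulr1 ?mulr0 ?powR_ge0.
  by rewrite lerDr invr_ge0 ltW.
have forms_coord : exists2 c : R, 0 < c & forall j, forms (ofR c *: delta_mx 0 j).
  by exists (e `^ p^-1); [exact: powR_gt0|move=> j; right; exists j].
pose A := NormingSet forms_bounded forms_coord.
have := @polar_estimate _ _ _ _ _ _ mu mu' p q p1 q1 pq _ _ u C (ltW C0) uX n A s xi a' beta
  ((m + e * M) `^ p^-1) ((m + e * M) `^ q^-1).
rewrite powR_conj//; apply => //.
- by rewrite powRVK.
- exact: powR_ge0.
- move=> x; rewrite -[leRHS](@powRVK p)//.
  rewrite ge0_ler_powR ?nnegrE ?polar_ge0 ?powR_ge0 ?(ltW p0)//.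
  apply: polar_le; first exact: powR_ge0.
  move=> l [[t ->]|[j ->]].
    have -> : dot (\row_j f j x) (\row_j (ofR (beta t)^-1 * xi j t)) =
        ofR (beta t)^-1 * \sum_j f j x * xi j t.
      rewrite /dot mulr_sumr; apply: eq_bigr => j _; rewrite !mxE; exact: mulrCA.
    rewrite nkM nk_ofR ger0_norm ?invr_ge0//.
    have [->|bn0] := eqVneq (beta t) 0; first by rewrite invr0 mul0r powR_ge0.
    have bp : 0 < beta t by rewrite lt_neqAle eq_sym bn0 beta0.
    rewrite ler_pdivrMl//.
    have ha : a x `^ p^-1 <= a' x `^ p^-1.
      apply: ge0_ler_powR; rewrite ?nnegrE ?invr_ge0 ?(ltW p0) ?a0 ?a0'//.
      by rewrite lerDl mulr_ge0 ?sf ?(ltW e0).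
    have hb : b t `^ q^-1 <= beta t.
      apply: ge0_ler_powR; rewrite ?nnegrE ?invr_ge0 ?(ltW q0) ?b0 ?b0'//.
      by rewrite lerDl mulr_ge0 ?sxi ?(ltW e0).
    apply: le_trans (dom x t) _; rewrite [leRHS]mulrC.
    by apply: ler_pM ha hb; exact: powR_ge0.
  rewrite dot_delta mxE nkM nk_ofR ger0_norm ?powR_ge0//.
  apply: (@le_trans _ _ ((e * \sum_j nk (f j x) `^ p) `^ p^-1)).
    by rewrite powRM ?(ltW e0)// ler_wpM2l ?powR_ge0// (single p _ (fun j => nk (f j x)))// => i; exact: nrm_ge0.
  by rewrite ge0_ler_powR ?nnegrE ?invr_ge0 ?(ltW p0) ?mulr_ge0 ?(ltW e0)// lerDr.
- by apply: measurable_powR; exact: (intble_measurable ib').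
- by apply: eq_integrable ib' => // t _ /=; rewrite powRVK.
- exact: powR_ge0.
- rewrite powRVK// (_ : Rintegral _ _ _ = \int[mu']_t b' t)//.
  by apply: eq_Rintegral => t _; rewrite powRVK.
- move=> t x; have [bt0|bn0] := eqVneq (beta t) 0.
    rewrite bt0 mul0r big1 ?nrm0// => j _.
    have := xib j t; rewrite bt0 pmulr_rle0// => h.
    rewrite (_ : (xi j t : K) = 0) ?mulr0//; apply: (@nrm_eq0 R k K^o).
    by apply/eqP; rewrite eq_le h nrm_ge0.
  have bp : 0 < beta t by rewrite lt_neqAle eq_sym bn0 beta0.
  rewrite -ler_pdivrMl//; have : forms (\row_j (ofR (beta t)^-1 * xi j t)) by left; exists t.
  move=> /(@dot_le_polar _ _ _ A x); apply: le_trans.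
  have -> : dot x (\row_j (ofR (beta t)^-1 * xi j t)) = ofR (beta t)^-1 * \sum_j x 0 j * xi j t.
    by rewrite /dot mulr_sumr; apply: eq_bigr => j _; rewrite !mxE; exact: mulrCA.
  by rewrite nkM nk_ofR ger0_norm ?invr_ge0.
Qed.

(** The gauge of the extension. Taking densities [a] and [b] of equal mass
    makes the gauge subadditive and homogeneous without optimising over
    their masses. *)
Definition cost (w : T -> T' -> K^o) (c : R) := exists a b m,
  [/\ density mu a m, density mu' b m, dominates a b w & c = C * m].

Lemma cost0 : cost 0 0.
Proof.
exists (fun=> 0), (fun=> 0), 0; split; rewrite ?mulr0//.
- by split=> //; [exact: intble0|rewrite /Rintegral integral0].
- by split=> //; [exact: intble0|rewrite /Rintegral integral0].
- by move=> x t; rewrite [X in nrm X](_ : _ = 0)// nrm0 mulr_ge0 ?powR_ge0.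
Qed.

(** Hoelder's inequality for sums of two terms. *)
Lemma costD v w c e : cost v c -> cost w e -> cost (v + w) (c + e).
Proof.
move=> [a [b [m [da db dom ->]]]] [a' [b' [m' [da' db' dom' ->]]]].
exists (fun x => a x + a' x), (fun t => b t + b' t), (m + m'); split.
- exact: densityD.
- exact: densityD.
- move=> x t; have [_ a0 _] := da; have [_ b0 _] := db.
  have [_ a0' _] := da'; have [_ b0' _] := db'.
  rewrite [X in nrm X](_ : _ = v x t + w x t)// (le_trans (nrmD _ _))//.
  rewrite (le_trans (lerD (dom x t) (dom' x t)))//.
  have := @hoelder2 R (a x `^ p^-1) (a' x `^ p^-1) (b t `^ q^-1) (b' t `^ q^-1) p q.
  by rewrite !powR_ge0 !powRVK//; apply.
- by rewrite mulrDr.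
Qed.

Lemma costZ l v c : 0 < l -> cost v c -> cost (ofR l *: v) (l * c).
Proof.
move=> l0 [a [b [m [da db dom ->]]]].
exists (fun x => l * a x), (fun t => l * b t), (l * m); split.
- by apply: densityZ => //; exact: ltW.
- by apply: densityZ => //; exact: ltW.
- move=> x t; have [_ a0 _] := da; have [_ b0 _] := db.
  rewrite !powRM ?(ltW l0)// mulrACA powR_conj ?(ltW l0)//.
  rewrite [X in nrm X](_ : _ = ofR l *: v x t)// nrm_ofRZ ger0_norm ?(ltW l0)//.
  by rewrite ler_wpM2l ?(ltW l0)// dom.
- by rewrite mulrCA.
Qed.

Lemma costN v c : cost v c -> cost (- v) c.
Proof.
move=> [a [b [m [da db dom ->]]]]; exists a, b, m; split=> // x t.
by rewrite [X in nrm X](_ : _ = - v x t)// nrmN dom.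
Qed.

Definition ftens (x : T -> K^o) (y : T' -> K^o) : T -> T' -> K^o :=
  fun s t => (x s : K) * y t.

(** On the tensors of [S_p] and the annihilator of [R_p], lifting [u] to
    [L_p(mu')] amounts to prescribing the functional that pairs with [u],
    since the choice of representatives in [R_p] is invisible there. *)
Definition lift_graph : set ((T -> T' -> K^o) * R) := [set z |
  exists l : seq (subspace_of Sp * LpFun mu' q1 K^o),
    [/\ forall e, e \in l -> perp e.2,
      z.1 = \sum_(e <- l) ftens (Lp_repr (subspace_val e.1)) e.2 &
      z.2 = \sum_(e <- l) pairing mu' e.2 (Lp_repr (repr (u e.1)))]].

Lemma lift_graph_linear : real_linear_graph lift_graph.
Proof.
split.
- by exists [::]; split=> //; rewrite big_nil.
- move=> v a w b [l [hl /= -> ->]] [l' [hl' /= -> ->]].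
  exists (l ++ l'); split=> [e||]; rewrite ?big_cat//.
  by rewrite mem_cat => /orP[/hl|/hl'].
- move=> c v a [l [hl /= -> ->]].
  exists [seq (e.1, ofR c *: e.2) | e <- l]; split=> /=.
  + move=> _ /mapP[e el ->] r rR /=; rewrite pairingC (pairing_ofRZ pq).
    by rewrite pairingC hl// mulr0.
  + rewrite scaler_sumr big_map; apply: eq_bigr => e _; apply/funext => x; apply/funext => t.
    by rewrite [LHS](_ : _ = ofR c * (Lp_repr (subspace_val e.1) x * e.2 t))// mulrCA.
  + rewrite mulr_sumr big_map; apply: eq_bigr => e _ /=.
    by rewrite pairingC [in RHS]pairingC (pairing_ofRZ pq).
Qed.

Lemma lift_graph_dominated : dominated_graph cost lift_graph.
Proof.
move=> v r [l [hl /= -> ->]]; split.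
  elim: l {hl} => [|e l [c hc]]; first by rewrite big_nil; exists 0; exact: cost0.
  rewrite big_cons.
  pose m := nrm (subspace_val e.1) `^ p + nrm (Lp_class e.2) `^ q.
  exists (C * m + c); apply: costD => //.
  exists (fun x => nk (Lp_repr (subspace_val e.1) x) `^ p), (fun t => nk (e.2 t) `^ q), m; split=> //.
  + have [i0 i1 i2] := density_Lp (Lp_repr (subspace_val e.1)); split=> //.
    by apply: le_trans i2 _; rewrite Lp_reprK lerDl powR_ge0.
  + split; [exact: LpFun_intble|by move=> t; exact: powR_ge0|].
    by rewrite -LpFun_norm_powR lerDr powR_ge0.
  + by move=> x t; rewrite !powRK ?nrm_ge0// nkM.
move=> c [a [b [m [da db dom ->]]]].
rewrite big_tnth; apply: (dominated_estimate (s := fun j => (tnth (in_tuple l) j).1)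
   (xi := fun j => (tnth (in_tuple l) j).2) _ da db).
  by move=> j; apply: hl; exact: mem_tnth.
move=> x t; apply: le_trans (dom x t); rewrite le_eqVlt; apply/orP; left; apply/eqP.
congr nrm; rewrite big_tnth; elim/big_rec2: _ => // j y1 y2 _ ->.
by [].
Qed.

End dominated_tensors.

(** * Maximal functions of finite families *)

Section maximal_functions.
Context {d : measure_display} {T : measurableType d} {R : realType} {k : scalar_kind}.
Local Notation K := (scalars R k).
Local Notation nk := (@nrm R k K^o).
Variables (mu : {measure set T -> \bar R}) (p : R) (p1 : 1 < p).
Let p0 : 0 < p. Proof. exact: lt_trans p1. Qed.

Lemma bigmax_intble n (f : 'I_n -> LpFun mu p1 K^o) :
  mu.-integrable setT (EFin \o (fun s => (\big[Num.max/0]_i nk (f i s)) `^ p)).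
Proof.
apply: (intble_le (G := fun s => \sum_i nk (f i s) `^ p)).
- apply: measurable_powR; apply: measurable_bigmax => i.
  exact/measurable_nrm/LpFun_sm.
- move=> s; rewrite ger0_norm ?powR_ge0//.
  have sum0 : 0 <= \sum_i nk (f i s) `^ p by apply: sumr_ge0 => i _; exact: powR_ge0.
  rewrite -[leRHS](@powRVK _ p) ?gt_eqF//.
  apply: ge0_ler_powR; rewrite ?nnegrE ?(ltW p0) ?powR_ge0 ?bigmax_ge_id//.
  apply/bigmax_leP; split=> [|i _]; first exact: powR_ge0.
  rewrite -[leLHS](@powRK _ p) ?gt_eqF ?nrm_ge0//.
  apply: ge0_ler_powR; rewrite ?nnegrE ?invr_ge0 ?(ltW p0) ?powR_ge0//.
  by rewrite (bigD1 i)//= lerDl sumr_ge0// => j _; exact: powR_ge0.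
- by apply: intble_sum => i; exact: LpFun_intble.
Qed.

Lemma sup_pnormE n (x : 'I_n -> Lp mu p1 K^o) :
  sup_pnorm x = ((\int[mu]_s ((\big[Num.max/0]_i nk (Lp_repr (x i) s)) `^ p)) `^ p^-1)%:E.
Proof.
rewrite -poweR_EFin EFin_Rint; last exact: (bigmax_intble (fun i => Lp_repr (x i))).
by rewrite -Lnorm_nonneg// => t; exact: bigmax_ge_id.
Qed.

End maximal_functions.

(** * The operator given by a dominated functional *)

Section lifting.
Context {d d' : measure_display} {T : measurableType d} {T' : measurableType d'}.
Context {R : realType} {k : scalar_kind}.
Local Notation K := (scalars R k).
Local Notation nk := (@nrm R k K^o).
Variables (mu : {measure set T -> \bar R}) (mu' : {measure set T' -> \bar R}).
Variables (p q : R) (p1 : 1 < p) (q1 : 1 < q).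
Hypothesis pq : p^-1 + q^-1 = 1.
Let p0 : 0 < p. Proof. exact: lt_trans p1. Qed.
Let q0 : 0 < q. Proof. exact: lt_trans q1. Qed.
Let pn0 : p != 0. Proof. by rewrite gt_eqF. Qed.
Let qn0 : q != 0. Proof. by rewrite gt_eqF. Qed.
Variables (C : R) (phi : (T -> T' -> K^o) -> R).
Hypothesis C0 : 0 < C.
Local Notation cost := (cost mu mu' p q C).
Local Notation tame w := (exists c, cost w c).
Hypothesis phi_cost : forall v c, cost v c -> phi v <= c.
Hypothesis phiD : forall v w, tame v -> tame w -> phi (v + w) = phi v + phi w.
Hypothesis phiZ : forall (c : R) v, tame v -> phi (ofR c *: v) = c * phi v.

(** Rescaling the two densities to a common mass turns the gauge bound into
    a bound by the product of the two norms. *)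
Lemma phi_le a b (A B : R) w : 0 <= A -> 0 <= B ->
  density mu a (A `^ p) -> density mu' b (B `^ q) -> dominates p q a b w ->
  phi w <= C * (A * B).
Proof.
move=> A0 B0 da db dom.
rewrite mulrC -ler_pdivrMr//; apply: ler_mul_addgt0 => // e e0.
rewrite ler_pdivrMr// mulrC.
have Ae : 0 < A + e by rewrite ltr_wpDl.
have Be : 0 < B + e by rewrite ltr_wpDl.
set A' := A + e; set B' := B + e.
have Ap : 0 < A' `^ p by exact: powR_gt0.
have Bq : 0 < B' `^ q by exact: powR_gt0.
have AB0 : 0 < A' * B' by exact: mulr_gt0.
(* The factors that give both densities the mass A' * B'. *)
pose l := A' * B' * (A'^-1 `^ p); pose l' := A' * B' * (B'^-1 `^ q).
have Ai : 0 < A'^-1 by rewrite invr_gt0.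
have Bi : 0 < B'^-1 by rewrite invr_gt0.
have l0 : 0 < l by rewrite mulr_gt0 ?powR_gt0.
have l0' : 0 < l' by rewrite mulr_gt0 ?powR_gt0.
have ll : l `^ p^-1 * l' `^ q^-1 = 1.
  rewrite /l /l' powRM ?powR_ge0 ?(ltW AB0)// [in X in _ * X]powRM ?powR_ge0 ?(ltW AB0)//.
  rewrite mulrACA powR_conj// ?(ltW AB0)// !powRK ?(ltW Ai) ?(ltW Bi)//.
  by rewrite -invfM mulfV// gt_eqF.
have lA : l * A' `^ p = A' * B'.
  by rewrite /l -mulrA -powRM ?(ltW Ai) ?(ltW Ae)// mulVf ?gt_eqF// powR1 mulr1.
have lB : l' * B' `^ q = A' * B'.
  by rewrite /l' -mulrA -powRM ?(ltW Bi) ?(ltW Be)// mulVf ?gt_eqF// powR1 mulr1.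
apply: phi_cost; exists (fun x => l * a x), (fun t => l' * b t), (A' * B'); split=> //.
- have [ia a0 am] := densityZ (ltW l0) da; split=> //; apply: le_trans am _.
  rewrite -lA ler_wpM2l ?(ltW l0)//.
  by apply: ge0_ler_powR; rewrite ?nnegrE ?(ltW p0) ?(ltW Ae)// lerDl ltW.
- have [ib b0 bm] := densityZ (ltW l0') db; split=> //; apply: le_trans bm _.
  rewrite -lB ler_wpM2l ?(ltW l0')//.
  by apply: ge0_ler_powR; rewrite ?nnegrE ?(ltW q0) ?(ltW Be)// lerDl ltW.
- have [_ a0 _] := da; have [_ b0 _] := db.
  move=> x t; rewrite powRM ?(ltW l0)// powRM ?(ltW l0')// mulrACA ll mul1r.
  exact: dom.
Qed.

Lemma ftens_dominates (x : LpFun mu p1 K^o) (y : LpFun mu' q1 K^o) :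
  dominates p q (fun s => nk (x s) `^ p) (fun t => nk (y t) `^ q) (ftens x y).
Proof. by move=> s t; rewrite !powRK ?nrm_ge0// nkM. Qed.

Lemma ftens_tame (x : LpFun mu p1 K^o) (y : LpFun mu' q1 K^o) : tame (ftens x y).
Proof.
pose m := nrm (Lp_class x) `^ p + nrm (Lp_class y) `^ q.
exists (C * m), (fun s => nk (x s) `^ p), (fun t => nk (y t) `^ q), m; split=> //.
- have [i0 i1 i2] := density_Lp x; split=> //.
  by apply: le_trans i2 _; rewrite lerDl powR_ge0.
- have [i0 i1 i2] := density_Lp y; split=> //.
  by apply: le_trans i2 _; rewrite lerDr powR_ge0.
- exact: ftens_dominates.
Qed.

Lemma phiN w : tame w -> phi (- w) = - phi w.
Proof.
by move=> hw; have := phiZ (-1) hw; rewrite ofRN ofR1 scaleN1r mulN1r.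
Qed.

Lemma phi_ftens_le (x : LpFun mu p1 K^o) (y : LpFun mu' q1 K^o) :
  `|phi (ftens x y)| <= C * (nrm (Lp_class x) * nrm (Lp_class y)).
Proof.
have dom := ftens_dominates x y.
have dx := density_Lp x; have dy := density_Lp y.
rewrite ler_norml lerNl -phiN; last exact: ftens_tame.
rewrite !(phi_le (nrm_ge0 _) (nrm_ge0 _) dx dy)// => s t.
by rewrite [X in nrm X](_ : _ = - ftens x y s t)// nrmN.
Qed.

Lemma phi_ftensDl (x x' : LpFun mu p1 K^o) (y : LpFun mu' q1 K^o) :
  phi (ftens (x + x') y) = phi (ftens x y) + phi (ftens x' y).
Proof.
rewrite -phiD; [|exact: ftens_tame|exact: ftens_tame].
by congr phi; apply/funext => s; apply/funext => t; exact: mulrDl.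
Qed.

Lemma phi_ftensDr (x : LpFun mu p1 K^o) (y y' : LpFun mu' q1 K^o) :
  phi (ftens x (y + y')) = phi (ftens x y) + phi (ftens x y').
Proof.
rewrite -phiD; [|exact: ftens_tame|exact: ftens_tame].
by congr phi; apply/funext => s; apply/funext => t; exact: mulrDr.
Qed.

Lemma phi_ftensC (a : K) (x : LpFun mu p1 K^o) (y : LpFun mu' q1 K^o) :
  phi (ftens (a *: x) y) = phi (ftens x (a *: y)).
Proof.
by congr phi; apply/funext => s; apply/funext => t; rewrite /ftens [LHS](_ : _ = a * x s * y t)// [RHS](_ : _ = x s * (a * y t))// mulrCA mulrA.
Qed.

Lemma phi_ftensZ (c : R) (x : LpFun mu p1 K^o) (y : LpFun mu' q1 K^o) :
  phi (ftens x (ofR c *: y)) = c * phi (ftens x y).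
Proof.
rewrite -phiZ; last exact: ftens_tame.
congr phi; apply/funext => s; apply/funext => t.
by rewrite /ftens [LHS](_ : _ = x s * (ofR c * y t))// [RHS](_ : _ = ofR c * (x s * y t))// mulrCA.
Qed.

Lemma phi_ftens_class (x x' : LpFun mu p1 K^o) (y y' : LpFun mu' q1 K^o) :
  Lp_class x = Lp_class x' -> Lp_class y = Lp_class y' ->
  phi (ftens x y) = phi (ftens x' y').
Proof.
move=> xx yy.
have -> : phi (ftens x y) = phi (ftens x' y).
  apply/eqP; rewrite -subr_eq0 -normr_eq0 eq_le normr_ge0 andbT.
  have -> : phi (ftens x y) - phi (ftens x' y) = phi (ftens (x - x') y).
    by have := phi_ftensDl (x - x') x' y; rewrite subrK => ->; rewrite addrK.
  by apply: le_trans (phi_ftens_le _ _) _; rewrite linearB/= xx subrr nrm0 mul0r mulr0.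
apply/eqP; rewrite -subr_eq0 -normr_eq0 eq_le normr_ge0 andbT.
have -> : phi (ftens x' y) - phi (ftens x' y') = phi (ftens x' (y - y')).
  by have := phi_ftensDr x' (y - y') y'; rewrite subrK => ->; rewrite addrK.
by apply: le_trans (phi_ftens_le _ _) _; rewrite linearB/= yy subrr nrm0 !mulr0.
Qed.

Lemma phi_ftens_sum n (f : 'I_n -> LpFun mu p1 K^o) (y : 'I_n -> LpFun mu' q1 K^o) :
  tame (\sum_i ftens (f i) (y i)) /\
  phi (\sum_i ftens (f i) (y i)) = \sum_i phi (ftens (f i) (y i)).
Proof.
elim/big_ind2: _ => [|v a w b [tv <-] [tw <-]|i _]; last by split=> //; exact: ftens_tame.
  have t0 : tame (0 : T -> T' -> K^o) by exists 0; exact: cost0.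
  by split=> //; have := phiZ 0 t0; rewrite ofR0 scale0r mul0r.
split; last exact: phiD.
by case: tv tw => c hc [e he]; exists (c + e); exact: costD.
Qed.

(** Bounded on elementary tensors, [phi] is a bounded bilinear form on [L_p]
    and [L_q]; Riesz representation in the second variable produces the
    operator. Complex linearity holds because scalars can be moved between
    the two factors of a tensor. *)
Lemma lifting_operator : exists A : {linear Lp mu p1 K^o -> Lp mu' p1 K^o},
  forall (x : LpFun mu p1 K^o) (y : LpFun mu' q1 K^o),
    phi (ftens x y) = pairing mu' (Lp_repr (A (Lp_class x))) y.
Proof.
pose B (f : Lp mu p1 K^o) (y : Lp mu' q1 K^o) := phi (ftens (Lp_repr f) (Lp_repr y)).
have ex f : exists F : LpFun mu' p1 K^o, forall y, B f y = pairing mu' F (Lp_repr y).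
  apply: (Lp_riesz p1 pq (c := C * nrm f)).
  - move=> y y'; rewrite /B -phi_ftensDr; apply: phi_ftens_class => //.
    by rewrite linearD/= !Lp_reprK.
  - move=> a y; rewrite /B -phi_ftensZ; apply: phi_ftens_class => //.
    by rewrite linearZ/= !Lp_reprK.
  - by move=> y; rewrite -mulrA -{2}(Lp_reprK f) -{2}(Lp_reprK y); exact: phi_ftens_le.
have [F FB] := choice ex.
have Flin : linear (fun f => Lp_class (F f) : Lp mu' p1 K^o).
  move=> a f g; apply/eqP; rewrite -subr_eq0 -linearP -linearB/=; apply/eqP.
  apply: (pairing_eq0 pq) => y.
  set G := a *: F f + F g; apply: (addIr (pairing mu' G (Lp_repr y))).
  rewrite add0r -(pairingDl pq) subrK /G (pairingDl pq) -(pairing_reprZ (q1 := q1)) -!FB /B.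
  have -> : phi (ftens (Lp_repr f) (Lp_repr (a *: y))) = phi (ftens (a *: Lp_repr f) (Lp_repr y)).
    by rewrite phi_ftensC; apply: phi_ftens_class => //; rewrite linearZ/= !Lp_reprK.
  by rewrite -phi_ftensDl; apply: phi_ftens_class => //; rewrite linearP/= !Lp_reprK.
pose A : {linear Lp mu p1 K^o -> Lp mu' p1 K^o} :=
  HB.pack (fun f => Lp_class (F f) : Lp mu' p1 K^o) (GRing.isLinear.Build K _ _ *:%R _ Flin).
exists A => x y.
rewrite (phi_ftens_class (x' := Lp_repr (Lp_class x)) (y' := Lp_repr (Lp_class y))) ?Lp_reprK//.
rewrite -[LHS]/(B _ _) FB pairing_classr.
apply: ae_eq_pairing; [exact: LpFun_sm|exact: LpFun_sm|exact: LpFun_sm|exact: LpFun_sm| |].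
  by apply/Lp_classP; rewrite Lp_reprK.
exact: aeW.
Qed.

(** The bound on [phi] is tested on the kernel [sum_i x_i (x) y_i], where
    [y_i] is the image of [A x_i] under the duality map on the set where [|A
    x_i|] is the first maximum. Its value is the integral of [G ^ p], with
    [G = max_i |A x_i|]; since only one [y_i] is nonzero at each point, it
    is dominated by [H] and [G ^ (p - 1)], with [H = max_i |x_i|], and
    Hoelder's exponents do the rest. *)
Lemma lifting_regular (A : {linear Lp mu p1 K^o -> Lp mu' p1 K^o}) :
  (forall (x : LpFun mu p1 K^o) (y : LpFun mu' q1 K^o),
    phi (ftens x y) = pairing mu' (Lp_repr (A (Lp_class x))) y) ->
  reg_bound A C.
Proof.
move=> phiA; split=> [|n x]; first exact: ltW.
pose f i := Lp_repr (x i); pose g i := Lp_repr (A (x i)).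
pose H s := \big[Num.max/0]_i nk (f i s); pose G t := \big[Num.max/0]_i nk (g i t).
have H0 s : 0 <= H s by exact: bigmax_ge_id.
have G0 t : 0 <= G t by exact: bigmax_ge_id.
pose fm i t := first_max (fun j => nk (g j t)) i.
have mg i : measurable_fun setT (fun t => nk (g i t)) by exact/measurable_nrm/LpFun_sm.
have mfm i : measurable_fun setT (fm i).
  apply: measurable_and; first by apply: measurable_fun_ler => //; exact: measurable_bigmax.
  by apply: measurable_fun_ltr; exact: measurable_bigmax.
have yL i : (fun t => if fm i t then J p (g i t) else 0) \in LpFun_pred mu' q1 (X := K^o).
  apply: (LpFun_le (g := Jfun q1 pq (g i))).
    exact: sm_if (LpFun_sm (Jfun q1 pq (g i))).
  by move=> t; case: (boolP (fm i t)) => // _; rewrite nrm0 nrm_ge0.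
pose y i := MkLpFun (yL i).
pose I := \int[mu']_t (G t `^ p); pose Jx := \int[mu]_s (H s `^ p).
have I0 : 0 <= I by apply: ge0_Rint => t; exact: powR_ge0.
have Jx0 : 0 <= Jx by apply: ge0_Rint => t; exact: powR_ge0.
rewrite (sup_pnormE x) (sup_pnormE (fun i => A (x i))) -EFinM lee_fin.
rewrite -[leLHS]/(I `^ p^-1) -[leRHS]/(C * Jx `^ p^-1).
have [tame_sum phi_sum] := phi_ftens_sum f y.
have yE i t : y i t = if fm i t then J p (g i t) else 0 by [].
have {}phi_sum : phi (\sum_i ftens (f i) (y i)) = I.
  rewrite phi_sum; under eq_bigr => i _ do rewrite phiA Lp_reprK.
  rewrite -Rint_sum => [|i]; last exact: intble_re_mul.
  apply: eq_Rintegral => t _.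
  rewrite (eq_bigr (fun i => if fm i t then nk (g i t) `^ p else 0)) => [|i _]; last first.
    rewrite yE; case: (fm i t); last by rewrite mulr0 re0.
    by have := J_mul p1 (g i t); rewrite mulrC => h; rewrite -[RHS](@ofRK R k) -h.
  apply: sum_first_max => [i|i fi|G00]; first exact: nrm_ge0.
    by congr (_ `^ p); exact: (first_max_val fi).
  by rewrite /G G00 powR0.
have p10 : 0 < p - 1 by rewrite subr_gt0.
have dom : dominates p q (fun s => H s `^ p) (fun t => G t `^ p) (\sum_i ftens (f i) (y i)).
  move=> s t.
  have -> : (\sum_i ftens (f i) (y i)) s t = \sum_i (f i s : K) * y i t.
    by elim/big_rec2: _ => // i v w _ <-.
  apply: le_trans (@nrm_sum R k K^o _ _ _ _) _.
  have -> : (H s `^ p) `^ p^-1 * (G t `^ p) `^ q^-1 = H s * G t `^ (p - 1).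
    have ce : (p - 1) * q = p by apply: conj_exponent.
    have pE : p * q^-1 = p - 1 by rewrite -{1}ce mulfK.
    by rewrite powRK// -powRrM pE.
  rewrite -[leRHS](@sum_first_max _ _ (fun j => nk (g j t)) (fun i => H s * nk (g i t) `^ (p - 1))).
  - apply: ler_sum => i _; rewrite yE -/(fm i t) nkM; case: (fm i t); last by rewrite nrm0 mulr0.
    by rewrite (nk_J p1) ler_wpM2r ?powR_ge0//; exact: le_bigmax.
  - by move=> i; exact: nrm_ge0.
  - by move=> i fi; congr (_ * _ `^ _); exact: (first_max_val fi).
  - by rewrite /G => ->; rewrite powR0 ?mulr0// gt_eqF.
have dH : density mu (fun s => H s `^ p) ((Jx `^ p^-1) `^ p).
  by split; [exact: bigmax_intble|move=> s; exact: powR_ge0|rewrite powRVK].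
have dG : density mu' (fun t => G t `^ p) ((I `^ q^-1) `^ q).
  by split; [exact: bigmax_intble|move=> t; exact: powR_ge0|rewrite powRVK].
have := phi_le (powR_ge0 _ _) (powR_ge0 _ _) dH dG dom.
rewrite phi_sum -{1}(powR_conj pq I0) mulrA.
have [->|In0] := eqVneq I 0; first by rewrite powR0 ?invr_eq0// mulr_ge0 ?powR_ge0 ?(ltW C0).
by rewrite ler_pM2r// powR_gt0// lt_neqAle eq_sym In0.
Qed.

End lifting.

(** * From finite dimensional spaces to a regular lifting *)

Section finite_dimensional_to_regular.
Context {d d' : measure_display} {T : measurableType d} {T' : measurableType d'}.
Context {R : realType} {k : scalar_kind}.
Local Notation K := (scalars R k).
Variables (mu : {measure set T -> \bar R}) (mu' : {measure set T' -> \bar R}).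
Variables (p : R) (p1 : 1 < p).
Variables (Sp : closedSubspace (Lp mu p1 K^o)) (Rp : closedSubspace (Lp mu' p1 K^o)).
Variables (u : {linear subspace_of Sp -> quotient_space Rp}) (C : R).

(** The operator represents an extension of the functional that pairs with
    [u]. If [A s - u s] were outside [R_p], some [g] in the annihilator of
    [R_p] would detect it; but [A s] and [u s] have the same pairing with
    every such [g]. *)
Lemma regular_lifting : 0 < C ->
  (forall X : completeNormedModType K, finite_dimensional X ->
    exists2 U : {linear subspace_of (tensor_closure X Sp) ->
                        quotient_space (tensor_closure X Rp)},
      is_tensor_extension u U & opnorm U <= C) ->
  exists A : {linear Lp mu p1 K^o -> Lp mu' p1 K^o},
    [/\ regular_op A, reg_norm A <= C &
        forall s : subspace_of Sp, u s = quotient_map Rp (A (subspace_val s))].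
Proof.
move=> C0 uX.
have p0 : 0 < p by exact: lt_trans p1.
have p10 : 0 < p - 1 by rewrite subr_gt0.
pose q := p / (p - 1).
have q1 : 1 < q by rewrite /q ltr_pdivlMr// mul1r gtrBl.
have pq : p^-1 + q^-1 = 1.
  by rewrite /q invf_div -[X in X + _]mul1r -mulrDl addrC subrK mulfV ?gt_eqF.
have [phi [phiG phi_cost phiD phiZ]] := hahn_banach (cost0 mu mu' p q C)
  (costD p1 q1 pq (C := C)) (costZ pq (C := C)) (costN (C := C))
  (lift_graph_linear q1 pq u) (lift_graph_dominated pq C0 uX).
have [A phiA] := lifting_operator p1 q1 pq C0 phi_cost phiD phiZ.
have regA := lifting_regular pq C0 phi_cost phiD phiZ phiA.
exists A; split.
- by exists C.
- by apply: ge_inf => //; exists 0 => c [].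
move=> s; rewrite -[u s]qpi_repr; apply/qpiP.
apply: contrapT => nW.
have [||||g [gR gn]] := Lp_separation q1 pq (W := [set f | f \in Rp])
  (z := repr (u s) - A (subspace_val s)) _ _ _ _ nW.
- exact: topclosed_subproof.
- exact: rpred0.
- by move=> x y; exact: rpredD.
- by move=> c x; exact: rpredZ.
apply: gn.
have h : phi (ftens (Lp_repr (subspace_val s)) g) = pairing mu' g (Lp_repr (repr (u s))).
  apply: phiG; exists [:: (s, g)]; split=> /=; rewrite ?big_seq1//.
  by move=> e; rewrite inE => /eqP -> r; exact: gR.
rewrite phiA Lp_reprK in h.
apply: (addIr (pairing mu' g (Lp_repr (A (subspace_val s))))).
have qp : q^-1 + p^-1 = 1 by rewrite addrC.
by rewrite -(pairing_reprD qp) subrK add0r [RHS]pairingC h.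
Qed.

End finite_dimensional_to_regular.

(** * Sums of elementary tensors *)

Section tensor_sums.
Context {d : measure_display} {T : measurableType d} {R : realType} {k : scalar_kind}.
Local Notation K := (scalars R k).
Context {mu : {measure set T -> \bar R}} {p : R} {p1 : 1 < p}.
Variable X : normedModType K.

Lemma tens0r (f : Lp mu p1 K^o) : tens f (0 : X) = 0.
Proof. by have := tensPr (-1) f (0 : X) 0; rewrite scaler0 addr0 scaleN1r addNr. Qed.

Lemma tens_sumr (f : Lp mu p1 K^o) n (c : 'I_n -> K) (x : 'I_n -> X) :
  tens f (\sum_i c i *: x i) = \sum_i c i *: tens f (x i).
Proof.
by elim/big_rec2: _ => [|i v w _ <-]; [exact: tens0r|rewrite tensPr].
Qed.

Lemma tens_suml n (c : 'I_n -> K) (f : 'I_n -> Lp mu p1 K^o) (x : X) :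
  tens (\sum_i c i *: f i) x = \sum_i c i *: tens (f i) x.
Proof.
elim/big_rec2: _ => [|i v w _ <-]; last by rewrite tensPl.
by have := tensZl 0 (0 : Lp mu p1 K^o) x; rewrite !scale0r.
Qed.

Lemma tens_exchange n L (f : 'I_n -> Lp mu p1 K^o) (e : 'I_L -> Lp mu p1 K^o) (c : 'I_n -> 'I_L -> K)
    (x : 'I_n -> X) :
  (forall i, f i = \sum_l c i l *: e l) ->
  \sum_i tens (f i) (x i) = \sum_l tens (e l) (\sum_i c i l *: x i).
Proof.
move=> fE; under eq_bigr => i _ do rewrite fE tens_suml.
rewrite exchange_big/=; apply: eq_bigr => l _.
by rewrite tens_sumr.
Qed.

Lemma tens_norm_le (f : Lp mu p1 K^o) (x : X) : nrm (tens f x) <= nrm f * nrm x.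
Proof.
apply: (nrm_le_powR p1); first by rewrite mulr_ge0 ?nrm_ge0.
rewrite powRM ?nrm_ge0// LpFun_norm_powR Lp_norm_powR mulrC -RintZ; last exact: Lp_intble.
rewrite le_eqVlt; apply/orP; left; apply/eqP; apply: eq_Rintegral => s _.
by rewrite [X in nrm X](_ : _ = (Lp_repr f s : K) *: x)// nrmZ powRM ?nrm_ge0// mulrC.
Qed.

End tensor_sums.

(** * A finite norming set of phases *)

Section phase_net.
Context {R : realType} {k : scalar_kind}.
Local Notation K := (scalars R k).
Local Notation nk := (@nrm R k K^o).

(** One argument for both fields: the scalars are spanned over the reals by
    [1] and an element [j] of modulus at most one ([j = 0] or [j = i]). *)
Lemma scalar_decomp : exists2 j : K, nk j <= 1 & forall z : K, exists a b : R,
  [/\ `|a| <= nk z, `|b| <= nk z & z = ofR a + ofR b * j].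
Proof.
case: k.
  exists 0; first by rewrite nrm0.
  by move=> z; exists z, 0; split; rewrite ?normr0 ?mulr0 ?ofR0 ?addr0 ?nrm_ge0.
have nk_i : @nrm R ComplexScalars (scalars R ComplexScalars)^o 'i%C = 1.
  by rewrite /nrm normc_def/= expr0n/= expr1n add0r sqrtr1.
exists 'i%C; first by rewrite nk_i.
move=> [a b]; exists a, b; split.
- exact: (@norm_re_le R ComplexScalars (Complex a b)).
- have := @norm_re_le R ComplexScalars ((- 'i%C) * Complex a b).
  rewrite nkM nrmN nk_i mul1r; congr (_ <= _); congr `|_|.
  by rewrite /re/= ; ring.
- by apply/eqP; rewrite eq_complex /=; apply/andP; split; apply/eqP; ring.
Qed.

Lemma real_grid (N : nat) (x : R) : `|x| <= 1 -> exists j : 'I_(N.+1.*2.+1),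
  `|x - (j%:R / N.+1%:R - 1)| <= N.+1%:R^-1.
Proof.
rewrite ler_norml => /andP[x1 x2].
have N0 : 0 < N.+1%:R :> R by rewrite ltr0n.
have y0 : 0 <= (x + 1) * N.+1%:R by rewrite mulr_ge0 ?(ltW N0)//; lra.
have /andP[l1 l2] := truncn_itv y0.
have jN : (Num.truncn ((x + 1) * N.+1%:R)%R < N.+1.*2.+1)%N.
  rewrite ltnS -(ler_nat R) (le_trans l1)// -addnn natrD.
  have : x + 1 <= 2 by lra.
  by move=> h; rewrite (le_trans (ler_wpM2r (ltW N0) h))//; lra.
exists (Ordinal jN) => /=; set j := Num.truncn _ in l1 l2 *.
have -> : x - (j%:R / N.+1%:R - 1) = ((x + 1) * N.+1%:R - j%:R) / N.+1%:R.
  by field; rewrite gt_eqF//; lra.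
rewrite ger0_norm ?divr_ge0 ?ler0n ?subr_ge0//.
rewrite ler_pdivrMr// mulVf ?gt_eqF// lerBlDr -[X in X + j%:R]/(1%:R) -natrD add1n; exact: ltW.
Qed.

(** The phases are those of the inverses of the points of a grid of the
    square: rounding [z / |z|] to a grid point [w] at distance at most [2 /
    N] changes the real part of its product with the phase of [w] by at most
    [4 / N]. *)
Lemma phase_net (e : R) : 0 < e -> exists m (th : 'I_m -> K),
  (forall i, nk (th i) <= 1) /\ forall z, exists i, (1 - e) * nk z <= re (th i * z).
Proof.
move=> e0; have [j j1 hj] := scalar_decomp.
pose N := Num.truncn (4 / e).
have N0 : 0 < N.+1%:R :> R by rewrite ltr0n.
have Ne : 4 / N.+1%:R <= e.
  rewrite ler_pdivrMr// mulrC -ler_pdivrMr//.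
  by have /andP[_ /ltW] := truncn_itv (ltW (divr_gt0 (ltr0Sn R 3) e0)).
pose I := ('I_(N.+1.*2.+1) * 'I_(N.+1.*2.+1))%type.
(* The grid points, with coordinates in [-1, 1], and the phases that make them
   nonnegative. *)
pose w (i : I) : K := ofR (i.1%:R / N.+1%:R - 1) + ofR (i.2%:R / N.+1%:R - 1) * j.
pose th (i : I) : K := ofR (nk (w i)) * (w i)^-1.
exists #|{: I}|, (fun i => th (enum_val i)); split=> [i|z].
  rewrite nkM nk_ofR nkV ger0_norm ?nrm_ge0//.
  by have [->|wn0] := eqVneq (nk (w (enum_val i))) 0; rewrite ?mul0r ?mulfV.
suff [i hi] : exists i : I, (1 - e) * nk z <= re (th i * z).
  by exists (enum_rank i); rewrite enum_rankK.
have [z0|zn0] := eqVneq (nk z) 0.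
  exists (ord0, ord0); rewrite z0 mulr0.
  by have /nrm_eq0 -> : @nrm R k K^o z = 0 by []; rewrite mulr0 re0.
have zp : 0 < nk z by rewrite lt_neqAle eq_sym zn0 nrm_ge0.
pose v : K := ofR (nk z)^-1 * z.
have zv : z = ofR (nk z) * v by rewrite /v mulrA -ofRM mulfV// ofR1 mul1r.
have v1 : nk v = 1.
  by rewrite /v nkM nk_ofR ger0_norm ?invr_ge0 ?nrm_ge0// mulVf.
have [a [b [a1 b1 vab]]] := hj v; rewrite v1 in a1 b1.
have [i1 h1] := real_grid N a1; have [i2 h2] := real_grid N b1.
exists (i1, i2); set i := (i1, i2).
have vw : nk (v - w i) <= 2 / N.+1%:R.
  have -> : v - w i = ofR (a - (i1%:R / N.+1%:R - 1)) + ofR (b - (i2%:R / N.+1%:R - 1)) * j.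
    by rewrite vab /w /i /= opprD addrACA -mulrBl -!ofRN -!ofRD.
  apply: le_trans (@nrmD R k K^o _ _) _.
  rewrite nkM !nk_ofR mulrDl !mul1r lerD// -[leRHS]mulr1.
  by apply: ler_pM => //; exact: nrm_ge0.
have thv : 1 - e <= re (th i * v).
  have -> : th i * v = th i * w i + th i * (v - w i) by ring.
  rewrite reD.
  have -> : th i * w i = ofR (nk (w i)).
    rewrite /th; have [w0|wn0] := eqVneq (w i) 0; first by rewrite w0 mulr0 nrm0 ofR0.
    by rewrite mulfVK.
  rewrite ofRK.
  have th1 : nk (th i) <= 1.
    rewrite nkM nk_ofR nkV ger0_norm ?nrm_ge0//.
    by have [->|wn0] := eqVneq (nk (w i)) 0; rewrite ?mul0r ?mulfV.
  have h3 : `|re (th i * (v - w i))| <= 2 / N.+1%:R.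
    apply: le_trans (norm_re_le _) _; rewrite nkM -[leRHS]mul1r.
    by apply: ler_pM => //; exact: nrm_ge0.
  have h4 : 1 - nk (w i) <= 2 / N.+1%:R.
    apply: le_trans vw; rewrite -v1; apply: le_trans (ler_norm _) _.
    exact: (@nrm_dist R k K^o).
  move: h3; rewrite ler_norml => /andP[h3 _].
  by move: Ne h3 h4; set M := N.+1%:R^-1 => *; lra.
rewrite {2}zv mulrCA re_ofRM mulrC ler_pM2l//.
Qed.

End phase_net.

(** * Tensor bounds for regular operators *)

Section regular_bound.
Context {d d' : measure_display} {T : measurableType d} {T' : measurableType d'}.
Context {R : realType} {k : scalar_kind} {p : R} {p1 : 1 < p}.
Local Notation K := (scalars R k).
Local Notation nk := (@nrm R k K^o).
Context {mu : {measure set T -> \bar R}} {mu' : {measure set T' -> \bar R}}.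
Variable A : {linear Lp mu p1 K^o -> Lp mu' p1 K^o}.
Let p0 : 0 < p. Proof. exact: lt_trans p1. Qed.
Let pn0 : p != 0. Proof. by rewrite gt_eqF. Qed.

(** The infimum defining the regular norm is attained, because the
    inequality is stable under limits of the constant. *)
Lemma reg_bound_of_norm (C : R) : regular_op A -> reg_norm A <= C -> reg_bound A C.
Proof.
move=> [c0 hc0] normA.
have infA : has_inf [set c | reg_bound A c].
  by split; [exists c0|exists 0 => c []].
split=> [|n x].
  by apply: le_trans normA; apply: lb_le_inf; [exact: infA.1|move=> c []].
rewrite (sup_pnormE x) (sup_pnormE (fun i => A (x i))) -EFinM lee_fin.
set a := (X in X <= _); set b := (X in _ <= _ * X).
have b0 : 0 <= b by exact: powR_ge0.
apply/ler_addgt0Pr => e e0.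
have b10 : 0 < b + 1 by rewrite ltr_wpDl.
have [c [_ hc] cA] := inf_adherent (divr_gt0 e0 b10) infA.
have := hc n x; rewrite (sup_pnormE x) (sup_pnormE (fun i => A (x i))) -EFinM lee_fin.
move=> /le_trans; apply; rewrite -/b.
apply: le_trans (ler_wpM2r b0 (ltW cA)) _; rewrite mulrDl lerD ?ler_wpM2r//.
by rewrite mulrAC ler_pdivrMr// ler_wpM2l ?(ltW e0)// lerDl.
Qed.

Variable C : R.
Hypothesis regA : reg_bound A C.

Let C0 : 0 <= C. Proof. by case: regA. Qed.

(** Frees the estimates from representatives of classes, on which the maxima
    depend on null sets only. *)
Lemma reg_bound_le (n : nat) (x : 'I_n -> LpFun mu p1 K^o) (X Y : normedModType K)
    (h : LpFun mu p1 X) (g : LpFun mu' p1 Y) :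
  (forall i s, nk (x i s) <= nrm (h s)) ->
  {ae mu', forall t, nrm (g t) <= \big[Num.max/0]_i nk (Lp_repr (A (Lp_class (x i))) t)} ->
  nrm (Lp_class g) <= C * nrm (Lp_class h).
Proof.
move=> xh gA; have [_ /(_ n (fun i => Lp_class (x i)))] := regA.
rewrite (sup_pnormE (fun i => Lp_class (x i))) (sup_pnormE (fun i => A (Lp_class (x i)))).
rewrite -EFinM lee_fin => hA; rewrite !LpFun_normE.
have mono a b : 0 <= a -> 0 <= b -> a <= b -> a `^ p^-1 <= b `^ p^-1.
  by move=> a0 b0 ab; apply: ge0_ler_powR; rewrite ?nnegrE ?invr_ge0 ?(ltW p0).
have monop a b : 0 <= a -> 0 <= b -> a <= b -> a `^ p <= b `^ p.
  by move=> a0 b0 ab; apply: ge0_ler_powR; rewrite ?nnegrE ?(ltW p0).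
apply: (@le_trans _ _ ((\int[mu']_t
    (\big[Num.max/0]_i nk (Lp_repr (A (Lp_class (x i))) t)) `^ p) `^ p^-1)).
  apply: mono; [by apply: ge0_Rint => t; exact: powR_ge0| |].
    by apply: ge0_Rint => t; exact: powR_ge0.
  apply: ae_le_Rint.
  - by move=> t; exact: powR_ge0.
  - by move=> t; exact: powR_ge0.
  - exact: LpFun_intble.
  - exact: (bigmax_intble (fun i => Lp_repr (A (Lp_class (x i))))).
  - apply: filterS gA => t ht; apply: monop => //; first exact: nrm_ge0.
    exact: bigmax_ge_id.
apply: (le_trans hA); apply: ler_wpM2l; first exact: C0.
apply: mono; [by apply: ge0_Rint => t; exact: powR_ge0| |].
  by apply: ge0_Rint => t; exact: powR_ge0.
apply: ae_le_Rint.
- by move=> t; exact: powR_ge0.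
- by move=> t; exact: powR_ge0.
- exact: (bigmax_intble (fun i => Lp_repr (Lp_class (x i)))).
- exact: LpFun_intble.
- have hx : {ae mu, forall s, forall i, Lp_repr (Lp_class (x i)) s = x i s}.
    by apply: filter_forall => i; exact: Lp_classK.
  apply: filterS hx => s hs; apply: monop; [exact: bigmax_ge_id|exact: nrm_ge0|].
  by apply/bigmax_leP; split=> [|i _]; rewrite ?nrm_ge0// hs.
Qed.

Lemma regular_bounded (f : Lp mu p1 K^o) : nrm (A f) <= C * nrm f.
Proof.
rewrite -[f in leRHS]Lp_reprK -[A f]Lp_reprK.
apply: (reg_bound_le (x := fun _ : 'I_1 => Lp_repr f)) => //.
by apply: aeW => t; rewrite Lp_reprK; exact: (le_bigmax _ _ (ord0 : 'I_1)).
Qed.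

Variable X : normedModType K.

(** The step where regularity enters. On disjointly supported functions
    [e_l] the functions [sum_l th_l |z_l| e_l] are all below [|sum_l e_l
    z_l|], for any phases [th_l], while the maximum of their images over all
    choices of phases in a net is almost [sum_l |z_l| |A e_l|]. *)
Lemma disjoint_tensor_bound (L : nat) (e : 'I_L -> LpFun mu p1 K^o) (z : 'I_L -> X) :
  (forall s l l', e l s != 0 -> e l' s != 0 -> l = l') ->
  nrm (\sum_l tens (A (Lp_class (e l))) (z l)) <= C * nrm (\sum_l tens (Lp_class (e l)) (z l)).
Proof.
move=> disj.
pose a l := Lp_repr (A (Lp_class (e l))).
pose h : LpFun mu p1 X := \sum_l tens_fun (e l) (z l).
pose g : LpFun mu' p1 X := \sum_l tens_fun (a l) (z l).
have -> : \sum_l tens (Lp_class (e l)) (z l) = Lp_class h.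
  by rewrite linear_sum; apply: eq_bigr => l _; rewrite tens_class.
have -> : \sum_l tens (A (Lp_class (e l))) (z l) = Lp_class g.
  by rewrite linear_sum.
have hE s : h s = \sum_l (e l s : K) *: z l by rewrite /h; elim/big_rec2: _ => // l v w _ <-.
have gE t : g t = \sum_l (a l t : K) *: z l by rewrite /g; elim/big_rec2: _ => // l v w _ <-.
suff key eps : 0 < eps -> eps < 1 -> (1 - eps) * nrm (Lp_class g) <= C * nrm (Lp_class h).
  apply/ler_addgt0Pr => eps eps0.
  have g1 : 0 < nrm (Lp_class g) + 1 + eps by rewrite ltr_wpDl// addr_ge0 ?nrm_ge0.
  have e1 : eps / (nrm (Lp_class g) + 1 + eps) < 1.
    by rewrite ltr_pdivrMr// mul1r ltrDr ltr_wpDl ?nrm_ge0.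
  have := key _ (divr_gt0 eps0 g1) e1; rewrite mulrBl mul1r lerBlDr => /le_trans; apply.
  rewrite lerD2l mulrAC ler_pdivrMr// ler_wpM2l ?(ltW eps0)//.
  by rewrite -addrA lerDl addr_ge0 ?(ltW eps0).
move=> eps0 eps1; have [m [th [th1 hth]]] := @phase_net R k eps eps0.
(* One member of the family for each choice of a phase for every index l. *)
pose c (i : 'I_#|{: {ffun 'I_L -> 'I_m}}|) l : K := th (enum_val i l) * ofR (nrm (z l)).
pose x i : LpFun mu p1 K^o := \sum_l c i l *: e l.
have xE i s : x i s = \sum_l c i l * e l s by rewrite /x; elim/big_rec2: _ => // l v w _ <-.
have eps1' : 0 <= 1 - eps by rewrite subr_ge0 ltW.
have -> : (1 - eps) * nrm (Lp_class g) = nrm (Lp_class (ofR (1 - eps) *: g)).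
  by rewrite linearZ/= nrm_ofRZ ger0_norm.
apply: (reg_bound_le (x := x)).
  move=> i s; rewrite xE hE.
  have [[l0 el0]|nex] := pselect (exists l, e l s != 0).
    have e0 l : l != l0 -> (e l s : K) = 0.
      by move=> ll0; apply/eqP; apply: contraNT ll0 => /disj/(_ el0)/eqP.
    rewrite (bigD1 l0)//= big1 => [|l /e0 ->]; last by rewrite mulr0.
    rewrite (bigD1 l0)//= [X in _ <= nrm (_ + X)]big1 => [|l /e0 ->]; last by rewrite scale0r.
    rewrite !addr0 nrmZ nkM nkM nk_ofR ger0_norm ?nrm_ge0// mulrC ler_wpM2l ?nrm_ge0//.
    by rewrite ler_piMl ?nrm_ge0.
  rewrite big1 ?nrm0 ?nrm_ge0// => l _.
  have -> : (e l s : K) = 0 by apply/eqP; apply: contrapT => /negP h'; apply: nex; exists l.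
  by rewrite mulr0.
have hA : {ae mu', forall t, forall i,
    Lp_repr (A (Lp_class (x i))) t = \sum_l c i l * a l t}.
  apply: filter_forall => i.
  have -> : A (Lp_class (x i)) = Lp_class (\sum_l c i l *: a l).
    rewrite /x !linear_sum; apply: eq_bigr => l _.
    by rewrite !linearZ/= Lp_reprK.
  apply: filterS (Lp_classK (\sum_l c i l *: a l)) => t ->.
  by elim/big_rec2: _ => // l v w _ <-.
apply: filterS hA => t ht.
have [th' hth'] : exists th' : {ffun 'I_L -> 'I_m}, forall l,
    (1 - eps) * nk (a l t) <= re (th (th' l) * a l t).
  have [F hF] := choice (fun l => hth (a l t)).
  by exists (finfun F) => l; rewrite ffunE.
apply: le_trans (le_bigmax _ _ (enum_rank th')); rewrite ht.
apply: le_trans (re_le_nk _).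
rewrite [X in nrm X](_ : _ = ofR (1 - eps) *: g t)// nrm_ofRZ ger0_norm// gE.
apply: le_trans (ler_wpM2l eps1' (nrm_sum _ _ _)) _.
rewrite mulr_sumr re_sum; apply: ler_sum => l _.
rewrite nrmZ mulrA /c enum_rankK.
have -> : th (th' l) * ofR (nrm (z l)) * a l t = ofR (nrm (z l)) * (th (th' l) * a l t).
  by rewrite [th _ * ofR _]mulrC mulrA.
by rewrite re_ofRM mulrC ler_wpM2l ?nrm_ge0// hth'.
Qed.

(** Jointly simple functions are combinations of indicators of disjoint
    sets. *)
Lemma simple_tensor_bound n (s : 'I_n -> LpFun mu p1 K^o) (x : 'I_n -> X) :
  (forall i, simple_fun (s i)) ->
  nrm (\sum_i tens (A (Lp_class (s i))) (x i)) <= C * nrm (\sum_i tens (Lp_class (s i)) (x i)).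
Proof.
move=> ss; pose S t : seq K := [seq s i t | i <- enum 'I_n].
have SE (i : 'I_n) t : nth 0 (S t) i = s i t.
  by rewrite (nth_map i) ?size_enum_ord// nth_ord_enum.
have sS : simple_fun S by exact: (simple_fun_map (enum 'I_n) ss).
have [vs0 vsE] : exists vs0 : seq (seq K), range S = [set` vs0] by apply/finite_seqP; case: sS.
pose vs := undup vs0; pose v (l : 'I_(size vs)) : seq K := nth [::] vs l.
have v_inj l l' : v l = v l' -> l = l'.
  by move/eqP; rewrite nth_uniq ?undup_uniq// => /eqP/val_inj.
have v_ex t : exists l, v l = S t.
  have : range S (S t) by exists t.
  rewrite vsE /= -mem_undup -/vs.
  by move=> /(nthP [::])[l lv <-]; exists (Ordinal lv).
pose nz (w : seq K) := has (fun c => c != 0) w.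
(* The set where all coordinates vanish may have infinite measure, so its
   indicator is replaced by 0. *)
pose ef l t : K^o := if (S t == v l) && nz (S t) then 1 else 0.
have eL l : ef l \in LpFun_pred mu p1 (X := K^o).
  have sme : strongly_measurable (ef l).
    apply: sm_simple; exact: (simple_fun_comp
      (fun w : seq K => if (w == v l) && nz w then 1 else 0 : K^o) sS).
  have [[i hi]|h0] := pselect (exists i : 'I_n, nth 0 (v l) i != 0); last first.
    apply: (LpFun_le (g := (0 : LpFun mu p1 K^o)) sme) => t; rewrite /ef.
    case: (boolP (_ && _)) => [/andP[/eqP Sv]|_]; last by rewrite nrm0 ?nrm_ge0.
    move=> /(hasP)[c /mapP[i _ ci] c0]; exfalso; apply: h0; exists i.
    by rewrite -Sv SE -ci.
  apply: (LpFun_le (g := (nth 0 (v l) i)^-1 *: s i) sme) => t; rewrite /ef.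
  case: (boolP (_ && _)) => [/andP[/eqP Sv _]|_]; last by rewrite nrm0 nrm_ge0.
  rewrite [X in _ <= nrm X](_ : _ = (nth 0 (v l) i)^-1 * s i t)//.
  by rewrite -SE Sv mulVf.
pose e l : LpFun mu p1 K^o := MkLpFun (eL l).
have sE i : s i = \sum_l nth 0 (v l) i *: e l.
  apply/val_inj/funext => t.
  transitivity (\sum_l nth 0 (v l) i * ef l t); last first.
    by elim/big_rec2: _ => // l w w' _ ->.
  have [l0 vl0] := v_ex t.
  rewrite (bigD1 l0)//= big1 => [|l ll0]; last first.
    rewrite /ef -vl0 (_ : (v l0 == v l) = false) ?mulr0//.
    by apply/negbTE; apply: contraNN ll0 => /eqP/v_inj ->.
  rewrite addr0 /ef vl0 eqxx/=; case: ifPn => [_|/hasPn h].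
    by rewrite mulr1 SE.
  rewrite mulr0 -[LHS]SE; apply/eqP; rewrite -[_ == _]negbK; apply: h.
  by rewrite SE; apply: map_f; rewrite mem_enum.
have classE i : Lp_class (s i) = \sum_l nth 0 (v l) i *: Lp_class (e l).
  by rewrite sE linear_sum; apply: eq_bigr => l _; rewrite linearZ.
have AclassE i : A (Lp_class (s i)) = \sum_l nth 0 (v l) i *: A (Lp_class (e l)).
  by rewrite classE linear_sum; apply: eq_bigr => l _; rewrite linearZ.
rewrite (tens_exchange x classE) (tens_exchange x AclassE).
apply: disjoint_tensor_bound => t l l'.
rewrite /e /= /ef; case: (boolP (_ && _)) => [/andP[/eqP -> _] _|_]; last by rewrite eqxx.
by case: (boolP (_ && _)) => [/andP[/eqP/v_inj -> _] _|_]; last by rewrite eqxx.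
Qed.

(** Both sides are continuous in the [f_i], so that simple functions
    suffice. *)
Lemma tensor_bound n (f : 'I_n -> Lp mu p1 K^o) (x : 'I_n -> X) :
  nrm (\sum_i tens (A (f i)) (x i)) <= C * nrm (\sum_i tens (f i) (x i)).
Proof.
pose N := \sum_i nrm (x i).
have N0 : 0 <= N by apply: sumr_ge0 => i _; exact: nrm_ge0.
have tensB dd (S : measurableType dd) (nu : {measure set S -> \bar R})
    (a b : 'I_n -> Lp nu p1 K^o) (dl : R) : (forall i, nrm (a i - b i) <= dl) ->
    nrm (\sum_i tens (a i) (x i) - \sum_i tens (b i) (x i)) <= dl * N.
  move=> ab; rewrite -sumrB /N mulr_sumr; apply: le_trans (nrm_sum _ _ _) _.
  apply: ler_sum => i _.
  have -> : tens (a i) (x i) - tens (b i) (x i) = tens (a i - b i) (x i).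
    by rewrite addrC -scaleN1r -tensPl scaleN1r addrC.
  by apply: le_trans (tens_norm_le _ _) _; rewrite ler_wpM2r ?nrm_ge0.
apply/ler_addgt0Pr => eps eps0.
(* Replacing every f_i at distance dl costs C * dl * N on each side. *)
pose D := 2 * C * N + 1.
have D0 : 0 < D by rewrite ltr_wpDl ?mulr_ge0.
pose dl := eps / D; have dl0 : 0 < dl by exact: divr_gt0.
have [s hs] := choice (fun i => simple_approx (Lp_repr (f i)) dl0).
have fs i : nrm (f i - Lp_class (s i)) <= dl.
  by have [_ /ltW] := hs i; rewrite Lp_reprK.
have Afs i : nrm (A (f i) - A (Lp_class (s i))) <= C * dl.
  by rewrite -linearB; apply: le_trans (regular_bounded _) _; rewrite ler_wpM2l.
have h1 := tensB _ _ _ _ _ _ Afs; have h2 := tensB _ _ _ _ _ _ fs.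
have h3 := simple_tensor_bound x (fun i => (hs i).1).
move: h1 h2 h3.
set w := \sum_i tens (A (f i)) (x i); set w' := \sum_i tens (A (Lp_class _)) (x i).
set v := \sum_i tens (f i) (x i); set v' := \sum_i tens (Lp_class _) (x i).
move=> h1 h2 h3.
have h4 : nrm w <= nrm (w - w') + nrm w' by rewrite -{1}(subrK w' w) nrmD.
have h5 : nrm v' <= nrm (v - v') + nrm v by rewrite nrm_distC -{1}(subrK v v') nrmD.
have h6 : C * nrm v' <= C * (dl * N + nrm v).
  by rewrite ler_wpM2l//; apply: le_trans h5 _; rewrite lerD2r.
have h7 : 2 * C * N * dl <= eps.
  by rewrite /dl mulrA ler_pdivrMr// mulrC ler_wpM2l ?(ltW eps0)// /D lerDl.
by move: h1 h3 h4 h6 h7; lra.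
Qed.

End regular_bound.

(** * Extension of bounded graphs *)

Section extension.
Context {R : realType} {k : scalar_kind}.
Local Notation K := (scalars R k).
Variables (V W : normedModType K) (D : closedSubspace V) (C : R) (G : set (V * W)).
Hypothesis completeW : seq_complete W.
Hypothesis C0 : 0 <= C.
Hypothesis G_linear : forall a v w v' w', G (v, w) -> G (v', w') -> G (a *: v + v', a *: w + w').
Hypothesis G_bound : forall v w, G (v, w) -> nrm w <= C * nrm v.
Hypothesis G_dense : forall f, f \in D -> forall e : R, 0 < e ->
  exists v w, G (v, w) /\ nrm (f - v) < e.

Let Gbar f g := forall e : R, 0 < e -> exists v w,
  [/\ G (v, w), nrm (f - v) < e & nrm (g - w) < e].

Let Gbar_linear a f g f' g' : Gbar f g -> Gbar f' g' -> Gbar (a *: f + f') (a *: g + g').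
Proof.
move=> fg fg' e e0; pose c := re `|a| + 1.
have a0 : 0 <= re `|a| by rewrite -(@re0 R k) re_le.
have c0 : 0 < c by rewrite ltr_wpDl.
have e2 : 0 < e / (2 * c) by rewrite divr_gt0// mulr_gt0.
have [v [w [vw fv gw]]] := fg _ e2; have [v' [w' [vw' fv' gw']]] := fg' _ e2.
have ce : re `|a| * (e / (2 * c)) + e / (2 * c) < e.
  rewrite -[X in _ + X]mul1r -mulrDl -/c.
  have -> : c * (e / (2 * c)) = e / 2 by field; rewrite gt_eqF.
  by rewrite ltr_pdivrMr// ltr_pMr// ltr1n.
have est (Z : normedModType K) (x x' y y' : Z) : nrm (x - y) < e / (2 * c) ->
    nrm (x' - y') < e / (2 * c) -> nrm (a *: x + x' - (a *: y + y')) < e.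
  move=> xy xy'; rewrite opprD addrACA -scalerBr.
  apply: le_lt_trans (nrmD _ _) _; rewrite nrmZ; apply: le_lt_trans ce.
  by apply: lerD; [apply: ler_wpM2l => //; exact: ltW|exact: ltW].
by exists (a *: v + v'), (a *: w + w'); split; [exact: G_linear|exact: est|exact: est].
Qed.

Let Gbar_bound f g : Gbar f g -> nrm g <= C * nrm f.
Proof.
move=> fg; apply/ler_addgt0Pr => e e0.
have e2 : 0 < e / (C + 1) by rewrite divr_gt0// ltr_wpDl.
have [v [w [/G_bound vw fv gw]]] := fg _ e2.
have h1 : nrm g <= nrm (g - w) + nrm w by rewrite -{1}(subrK w g) nrmD.
have h2 : nrm v <= nrm (f - v) + nrm f by rewrite nrm_distC -{1}(subrK f v) nrmD.
have h3 : C * nrm v <= C * (e / (C + 1) + nrm f).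
  by rewrite ler_wpM2l//; apply: le_trans h2 _; rewrite lerD2r ltW.
have h4 : C * (e / (C + 1)) + e / (C + 1) = e by field; rewrite gt_eqF// ltr_wpDl.
by move: h1 h3 h4 vw gw; lra.
Qed.

Let Gbar_total f : f \in D -> exists g, Gbar f g.
Proof.
move=> fD.
have ex n : exists z : V * W, G z /\ nrm (f - z.1) < 2 ^- n.
  by have [v [w [vw fv]]] := G_dense fD (@exp2V_gt0 R n); exists (v, w).
have [z hz] := choice ex.
have zsub m n : nrm ((z m).2 - (z n).2) <= C * nrm ((z m).1 - (z n).1).
  apply: G_bound; have := G_linear (-1) (w := (z n).2) (w' := (z m).2) (v := (z n).1) (v' := (z m).1).
  rewrite !scaleN1r ![- _ + _]addrC; apply; rewrite -surjective_pairing.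
    exact: (hz n).1.
  exact: (hz m).1.
have cz : nrm_cauchy (fun n => (z n).2).
  move=> e e0; have e2 : 0 < e / (2 * (C + 1)) by rewrite divr_gt0// mulr_gt0// ltr_wpDl.
  have [N hN] := exp2V_lt e2; exists N => n m Nn Nm.
  apply: le_lt_trans (zsub _ _) _.
  have h : nrm ((z n).1 - (z m).1) <= e / (2 * (C + 1)) + e / (2 * (C + 1)).
    have -> : (z n).1 - (z m).1 = ((z n).1 - f) + (f - (z m).1) by rewrite addrA subrK.
    apply: le_trans (nrmD _ _) _; rewrite nrm_distC.
    by apply: lerD; apply/ltW; [exact: lt_trans (hz n).2 (hN _ Nn)|exact: lt_trans (hz m).2 (hN _ Nm)].
  apply: le_lt_trans (ler_wpM2l C0 h) _.
  have -> : C * (e / (2 * (C + 1)) + e / (2 * (C + 1))) = C * (e / (C + 1)).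
    by field; rewrite gt_eqF// ltr_wpDl.
  by rewrite mulrA ltr_pdivrMr ?ltr_wpDl// mulrC ltr_pM2l// ltrDl.
have [g zg] := completeW cz; exists g => e e0.
have /nrm_cvgP/(_ _ e0)[N _ hN] := zg.
have [N' hN'] := exp2V_lt e0.
exists (z (maxn N N')).1, (z (maxn N N')).2; split.
- by rewrite -surjective_pairing; exact: (hz _).1.
- by apply: lt_trans (hz _).2 (hN' _ _); exact: leq_maxr.
- by apply: hN => /=; exact: leq_maxl.
Qed.

(** The closure of the graph of a densely defined bounded operator is again
    a graph, everywhere defined when the target is complete. *)
Lemma bounded_extension : exists E : {linear subspace_of D -> W},
  (forall f, nrm (E f) <= C * nrm f) /\
  (forall f w, G (subspace_val f, w) -> E f = w).
Proof.
have uniq f g g' : Gbar f g -> Gbar f g' -> g = g'.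
  move=> fg fg'; have := Gbar_bound (Gbar_linear (-1) fg fg').
  rewrite !scaleN1r [- f + f]addNr nrm0 mulr0 => h.
  apply/esym/eqP; rewrite -subr_eq0 addrC; apply/eqP/nrm_eq0/eqP.
  by rewrite eq_le h nrm_ge0.
have [E EG] := choice (fun f : subspace_of D => Gbar_total (valP f)).
have Elin : linear E.
  by move=> a f g; apply: uniq (EG _) _; exact: (Gbar_linear a (EG f) (EG g)).
pose E' : {linear subspace_of D -> W} := HB.pack E (GRing.isLinear.Build K _ _ *:%R _ Elin).
exists E'; split=> [f|f w fw]; first exact: (Gbar_bound (EG f)).
apply: uniq (EG f) _ => e e0; exists (subspace_val f), w.
by rewrite !subrr !nrm0.
Qed.

End extension.

(** * From a regular lifting to all Banach spaces *)

Section regular_to_tensor.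
Context {d d' : measure_display} {T : measurableType d} {T' : measurableType d'}.
Context {R : realType} {k : scalar_kind}.
Local Notation K := (scalars R k).
Variables (mu : {measure set T -> \bar R}) (mu' : {measure set T' -> \bar R}).
Variables (p : R) (p1 : 1 < p).
Variables (Sp : closedSubspace (Lp mu p1 K^o)) (Rp : closedSubspace (Lp mu' p1 K^o)).
Variables (u : {linear subspace_of Sp -> quotient_space Rp}) (C : R).

Lemma quotient_map_le (V : normedModType K) (S : closedSubspace V) (v : V) :
  nrm (quotient_map S v) <= nrm v.
Proof.
rewrite quotient_normE; apply: ge_inf; last by exists v.
by exists 0 => _ [w _ <-]; exact: nrm_ge0.
Qed.

(** The tensor product of [A] and the identity is bounded on algebraic
    tensors and extends to [S_p(X)]; composing with the quotient map gives
    the extension of the tensor product of [u] and the identity. *)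
Lemma regular_tensor_extension (A : {linear Lp mu p1 K^o -> Lp mu' p1 K^o})
    (X : completeNormedModType K) :
  regular_op A -> reg_norm A <= C ->
  (forall s : subspace_of Sp, u s = quotient_map Rp (A (subspace_val s))) ->
  exists2 uX : {linear subspace_of (tensor_closure X Sp) ->
                       quotient_space (tensor_closure X Rp)},
    is_tensor_extension u uX & opnorm uX <= C.
Proof.
move=> rA normA liftA; have regA := reg_bound_of_norm rA normA; have C0 := regA.1.
pose G : set (Lp mu p1 X * Lp mu' p1 X) := [set z | exists n (s : 'I_n -> subspace_of Sp)
  (x : 'I_n -> X), z.1 = \sum_i tens (subspace_val (s i)) (x i) /\
                   z.2 = \sum_i tens (A (subspace_val (s i))) (x i)].
have [|||E [Eb EG]] := @bounded_extension R k _ _ (tensor_closure X Sp) C G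
    (Lp_seq_complete (complete_seq (X := X))) C0.
- move=> a v w v' w' [n [s [x [/= -> ->]]]] [m [r [y [/= -> ->]]]].
  exists (n + m)%N.
  exists (fun i => match fintype.split i with inl j => a *: s j | inr j => r j end).
  exists (fun i => match fintype.split i with inl j => x j | inr j => y j end).
  rewrite !big_split_ord/= !scaler_sumr; split; congr (_ + _); apply: eq_bigr => i _.
  + by rewrite (unsplitK (inl i)) /= tensZl.
  + by rewrite (unsplitK (inr i)).
  + by rewrite (unsplitK (inl i)) /= -tensZl -linearZ.
  + by rewrite (unsplitK (inr i)).
- by move=> v w [n [s [x [/= -> ->]]]]; exact: (tensor_bound regA).
- move=> f fD e e0; have /asboolP/closure_nrmP/(_ _ e0)[_ [n [s [x ->]]] fe] := fD.
  by exists (\sum_i tens (subspace_val (s i)) (x i)),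
    (\sum_i tens (A (subspace_val (s i))) (x i)); split=> //; exists n, s, x.
pose U : {linear subspace_of (tensor_closure X Sp) -> quotient_space (tensor_closure X Rp)} :=
  quotient_map (tensor_closure X Rp) \o E.
have Ubound : op_bound U C.
  by split=> // f; apply: le_trans (quotient_map_le _ _) (Eb f).
exists U; last by apply: ge_inf => //; exists 0 => c [].
split; first by exists C.
move=> s x; rewrite /U /= liftA quot_tensE; congr quotient_map.
by apply: EG; exists 1%N, (fun=> s), (fun=> x); rewrite !big_ord1.
Qed.

End regular_to_tensor.

(** * The theorem *)

Theorem theorem10p1 (R : realType) (k : scalar_kind)
    (d d' : measure_display) (T : measurableType d) (T' : measurableType d')
    (mu : {measure set T -> \bar R}) (mu' : {measure set T' -> \bar R})
    (p : R) (p1 : 1 < p)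
    (Sp : closedSubspace (Lp mu p1 (scalars R k)^o))
    (Rp : closedSubspace (Lp mu' p1 (scalars R k)^o))
    (u : {linear subspace_of Sp -> quotient_space Rp})
    (C : R) (C1 : 1 <= C) :
  [<-> exists A : {linear Lp mu p1 (scalars R k)^o -> Lp mu' p1 (scalars R k)^o},
         [/\ regular_op A, reg_norm A <= C &
             forall s : subspace_of Sp, u s = quotient_map Rp (A (subspace_val s))];
       forall X : completeNormedModType (scalars R k),
         exists2 uX : {linear subspace_of (tensor_closure X Sp) ->
                              quotient_space (tensor_closure X Rp)},
           is_tensor_extension u uX & opnorm uX <= C;
       forall X : completeNormedModType (scalars R k), finite_dimensional X ->
         exists2 uX : {linear subspace_of (tensor_closure X Sp) ->
                              quotient_space (tensor_closure X Rp)},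
           is_tensor_extension u uX & opnorm uX <= C].
Proof.
have C0 : 0 < C by exact: lt_le_trans C1.
tfae.
- by move=> [A [rA normA liftA]] X; exact: regular_tensor_extension rA normA liftA.
- by move=> h X _; exact: h.
- exact: regular_lifting.
Qed.
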